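(* The Maximum Connectivity Improvement (MCI) problem on DAGs is fixed-parameter tractable with respect to $\nu(G)$, the matching number of the input graph $G$.
   Context: For a directed graph $G=(V,E)$ let $f(G)$ be the number of ordered pairs $(v,u)\in V\times V$ such that there is a directed path from $v$ to $u$ in $G$ (each vertex reaches itself). For a set $N$ of ordered pairs, $G(N)=(V,E\cup N)$. MCI: given a DAG $G=(V,E)$ and an integer $B\ge 0$, find $N\subseteq (V\times V)\setminus E$ with $|N|\le B$ maximizing $f(G(N))$. $\nu(G)$ is the maximum size of a matching in $G$, i.e. of a set of edges no two of which share a vertex. FPT with respect to a parameter $k$ means solvable exactly in time $g(k)\cdot |V|^{O(1)}$ for some computable $g$. *)

(* Defs.v *)
From mathcomp Require Import all_boot.

Set Implicit Arguments.
Unset Strict Implicit.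
Unset Printing Implicit Defensive.

(* A directed graph on the vertex set V is given by its edge set. *)
Section Digraphs.
Variable V : finType.
Implicit Types E M N : {set V * V}.

Definition edge E : rel V := [rel u v | (u, v) \in E].

(* In MathComp a [cycle] is a closed walk, and [::] is one by convention. *)
Definition acyclic E : Prop := forall c : seq V, cycle (edge E) c -> c = [::].

Definition reach_count E : nat :=
  #|[set p : V * V | connect (edge E) p.1 p.2]|.

(* Edge directions are ignored: distinct edges must have disjoint ends. *)
Definition matching M : bool :=
  [forall p in M, forall q in M,
     (p != q) ==> [disjoint [set p.1; p.2] & [set q.1; q.2]]].

Definition matching_number E : nat :=
  \max_(M : {set V * V} | (M \subset E) && matching M) #|M|.

Definition mci_feasible E (B : nat) N : bool := (N \subset ~: E) && (#|N| <= B).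

Definition mci_optimal E (B : nat) N : Prop :=
  mci_feasible E B N /\
  forall N', mci_feasible E B N' ->
    reach_count (E :|: N') <= reach_count (E :|: N).

End Digraphs.

(* Model of computation: structured programs for a random access machine whose
   memory consists of unbounded arrays of natural numbers; a program names only
   finitely many of them.  [m a i] is the content of cell i of array a.
   Every operator evaluated, constant read, memory access and test costs one
   unit.  The arithmetic is addition, truncated subtraction and halving, so the
   bit length of the largest number in memory grows by O(1) per unit of time,
   and uniform-cost time is polynomially related to Turing machine time; unit
   cost multiplication, which would break this, is excluded. *)
Definition memory := nat -> nat -> nat.

Inductive expr :=
| ECst of nat
| EGet of nat & expr
| EAdd of expr & expr
| ESub of expr & expr
| EHalf of expr.

Fixpoint eval (m : memory) (e : expr) : nat :=
  match e with
  | ECst c => c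
  | EGet a i => m a (eval m i)
  | EAdd e1 e2 => eval m e1 + eval m e2
  | ESub e1 e2 => eval m e1 - eval m e2
  | EHalf e1 => (eval m e1)./2
  end.

Fixpoint cost (e : expr) : nat :=
  match e with
  | ECst _ => 1
  | EGet _ i => (cost i).+1
  | EAdd e1 e2 | ESub e1 e2 => (cost e1 + cost e2).+1
  | EHalf e1 => (cost e1).+1
  end.

Inductive prog :=
| Skip
| Put of nat & expr & expr
| Seq of prog & prog
| If of expr & prog & prog
| While of expr & prog.

Definition upd (m : memory) (a i x : nat) : memory :=
  fun b j => if (b == a) && (j == i) then x else m b j.

(* [exec p m t m']: started in memory m, the program p halts after exactly t
   units of time, with memory m'.  As tests, expressions are true when they are
   nonzero. *)
Inductive exec : prog -> memory -> nat -> memory -> Prop :=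
| ExecSkip m : exec Skip m 1 m
| ExecPut a i e m :
    exec (Put a i e) m (cost i + cost e).+1 (upd m a (eval m i) (eval m e))
| ExecSeq p q m1 m2 m3 t1 t2 :
    exec p m1 t1 m2 -> exec q m2 t2 m3 -> exec (Seq p q) m1 (t1 + t2) m3
| ExecIfTrue e p q m m' t :
    eval m e != 0 -> exec p m t m' -> exec (If e p q) m ((cost e).+1 + t) m'
| ExecIfFalse e p q m m' t :
    eval m e = 0 -> exec q m t m' -> exec (If e p q) m ((cost e).+1 + t) m'
| ExecWhileFalse e p m :
    eval m e = 0 -> exec (While e p) m (cost e).+1 m
| ExecWhileTrue e p m1 m2 m3 t1 t2 :
    eval m1 e != 0 -> exec p m1 t1 m2 -> exec (While e p) m2 t2 m3 ->
    exec (While e p) m1 ((cost e).+1 + t1 + t2) m3.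

Lemma exec_det p m t1 m1 t2 m2 :
  exec p m t1 m1 -> exec p m t2 m2 -> t1 = t2 /\ m1 = m2.
Proof.
move=> H; elim: H t2 m2 => {p m t1 m1}; intros;
  match goal with H : exec _ _ ?t ?m |- _ = ?t /\ _ = ?m => inversion H; subst end;
  repeat match goal with
  | IH : forall t m, exec ?p ?m1 t m -> _, H : exec ?p ?m1 _ _ |- _ =>
      case: (IH _ _ H) => ? ?; subst; clear H
  | H : is_true (?a != 0), H' : ?a = 0 |- _ => by rewrite H' in H
  end; by [].
Qed.

Definition nat_input (k : nat) : memory :=
  fun a i => if (a == 0) && (i == 0) then k else 0.

Definition computable (g : nat -> nat) : Prop :=
  exists p, forall k, exists t m, exec p (nat_input k) t m /\ m 0 0 = g k.

(* A problem has instances in I, presented in memory by [input]; [solved x m]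
   says that the final memory m holds a correct answer for x.  The parameter is
   not part of the input.  The polynomial is taken in (size x).+1 because
   (size x) ^ c would vanish on the empty graph; for size x > 0 the factor
   2 ^ c that this costs is absorbed by g. *)
Definition fixed_parameter_tractable (I : Type) (input : I -> memory)
    (solved : I -> memory -> Prop) (size param : I -> nat) : Prop :=
  exists (p : prog) (g : nat -> nat) (c : nat),
    computable g /\
    forall x : I, exists (t : nat) (m : memory),
      [/\ exec p (input x) t m,
          t <= g (param x) * (size x).+1 ^ c
        & solved x m].

Record mci_instance := MciInstance {
  nvertices : nat;
  edges : {set 'I_nvertices * 'I_nvertices};
  budget : nat;
  edges_acyclic : acyclic edges
}.

(* Array 0 holds the number n of vertices and the budget; array 1 holds the
   adjacency matrix, row by row: the entry (u, v) is in cell u * n + v. *)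
Definition mci_input (x : mci_instance) : memory := fun a i =>
  match a, i with
  | 0, 0 => nvertices x
  | 0, 1 => budget x
  | 1, _ => [exists p in edges x, i == p.1 * nvertices x + p.2]
  | _, _ => 0
  end.

(* The answer N is read off array 2 as an adjacency matrix; nonzero entries are
   members of N. *)
Definition mci_output (x : mci_instance) (m : memory) :
    {set 'I_(nvertices x) * 'I_(nvertices x)} :=
  [set p : 'I_(nvertices x) * 'I_(nvertices x) |
     m 2 (p.1 * nvertices x + p.2) != 0].

Definition mci_solved (x : mci_instance) (m : memory) : Prop :=
  mci_optimal (edges x) (budget x) (mci_output x m).

(* Main.v *)
(* The running time is controlled by the number q of twin classes (vertices with
   the same neighbours), which is at most 2 nu + 16^nu since the vertices outside
   a maximal matching are independent.

   Added edges may be taken to go from sinks to sources.  Call such an edge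
   cyclic if it lies on a cycle of the resulting graph.  In an optimal solution
   with as few acyclic edges as possible there are at most q^2 + 4 of these: of
   two acyclic edges between twins one is dispensable, and spending it on an edge
   that closes a cycle through the other gains at least as many pairs.  The
   cyclic edges can be replaced, without increasing their number, by a strongly
   connected core on at most q of them (Eswaran and Tarjan) to which isolated
   vertices, sinks and sources are then attached; how many pairs this connects
   only depends on how many vertices of these three kinds are attached.  The
   boundedly many edges outside this last step can be moved, by swapping twins,
   to a set of vertices bounded in q, so it suffices to try all of them together
   with all numbers of attached vertices, which a random access machine does by
   nested loops around Warshall's algorithm. *)

Require Import Defs.
From mathcomp Require Import all_boot perm zify.

Set Implicit Arguments.
Unset Strict Implicit.
Unset Printing Implicit Defensive.

(** The obstacle is that the budget, and with it the size of an optimal solution, is not bounded in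
    nu, so a solution cannot be guessed edge by edge. Cyclic edges escape this: beyond boundedly
    many of them, the pairs they connect form a rectangle, all vertices above the core times all
    vertices below it, whose size depends on counts only. Acyclic edges have no such description, so
    their number itself must be bounded.

    That bound is an exchange. Deleting an acyclic edge that has a twin edge loses only pairs
    starting at its tail or ending at its head, whereas an edge that closes a cycle through a vertex
    x adds at least |anc x| + |des x| - 2 pairs. The comparison of twins breaks down at isolated
    vertices, whose neighbours all come from added edges; they account for the 4 in q^2 + 4, namely
    two isolated tails and two isolated heads, told apart by whether another added edge continues
    through the vertex.

    The program never learns nu. It counts twin classes itself, and nu enters only the analysis: q
    is at most 2^(4 nu + 1), and all sets of pairs among polynomially many (in q) vertices are
    tried, hence the double exponential. *)

Notation conn E := (connect (edge E)).

(** * Reachability in directed graphs *)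

Section Reachability.
Variable V : finType.
Implicit Types (E F K N : {set V * V}) (u v x y : V) (e : V * V).

Definition reach_set E : {set V * V} := [set p | conn E p.1 p.2].
Definition anc E x : {set V} := [set y | conn E y x].
Definition des E x : {set V} := [set y | conn E x y].
Definition converse E : {set V * V} := [set e | (e.2, e.1) \in E].

Lemma conn_edge E u v : (u, v) \in E -> conn E u v.
Proof. by move=> uv; apply: connect1. Qed.

Lemma conn_sub E F :
  (forall u v, (u, v) \in E -> conn F u v) ->
  forall u v, conn E u v -> conn F u v.
Proof. by move=> EF; apply: connect_sub => u v; apply: EF. Qed.

Lemma connS E F : E \subset F -> forall u v, conn E u v -> conn F u v.
Proof. by move=> /subsetP EF; apply: conn_sub => u v /EF /conn_edge. Qed.

Lemma conn_conv E u v : conn (converse E) u v = conn E v u.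
Proof.
suff H F x y : conn (converse F) x y -> conn F y x.
  apply/idP/idP => [/H //|h]; apply: H.
  by rewrite (_ : converse (converse E) = E) //; apply/setP=> -[a b]; rewrite !inE.
move=> /connectP[p]; elim: p x => [x _ -> //|z p IH x /= /andP[xz zp] yE].
apply: connect_trans (IH _ zp yE) (conn_edge _).
by move: xz; rewrite /edge /= inE.
Qed.

Lemma converseU E F : converse (E :|: F) = converse E :|: converse F.
Proof. by apply/setP=> e; rewrite !inE. Qed.

Lemma converseK : involutive converse.
Proof. by move=> E; apply/setP=> -[a b]; rewrite !inE. Qed.

Lemma card_conv E : #|converse E| = #|E|.
Proof.
rewrite -(card_imset (converse E) (f := fun e : V * V => (e.2, e.1))); last first.
  by move=> [a b] [c d] [-> ->].
apply: eq_card => -[a b]; apply/imsetP/idP => [[[c d]]|abE].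
  by rewrite inE /= => cd [-> ->].
by exists (b, a); rewrite ?inE.
Qed.

Lemma reach_conv E : reach_count (converse E) = reach_count E.
Proof.
rewrite /reach_count -[RHS]card_conv; apply: eq_card => -[a b].
by rewrite !inE /= conn_conv.
Qed.

(** A path is cut at its first edge outside [E]. *)
Lemma conn_first E K u v : conn (E :|: K) u v ->
  conn E u v \/ exists2 e, e \in K & conn E u e.1 && conn (E :|: K) e.2 v.
Proof.
move=> /connectP[p]; elim: p u => [u _ ->|z p IH u /= /andP[uz zp] vE].
  by left; apply: connect0.
have zv : conn (E :|: K) z v by apply/connectP; exists p.
move: uz; rewrite /edge /= inE => /orP[uz|uz]; last first.
  by right; exists (u, z); rewrite //= connect0.
case: (IH _ zp vE) => [h|[e eK /andP[h1 h2]]].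
  by left; apply: connect_trans h; apply: conn_edge.
by right; exists e; rewrite // h2 andbT; apply: connect_trans h1; apply: conn_edge.
Qed.

Lemma conn_last E K u v : conn (E :|: K) u v ->
  conn E u v \/ exists2 e, e \in K & conn (E :|: K) u e.1 && conn E e.2 v.
Proof.
rewrite -conn_conv converseU => /conn_first[]; rewrite ?conn_conv; first by left.
move=> [e eK]; rewrite -converseU !conn_conv => h; right; exists (e.2, e.1); last by rewrite andbC.
by move: eK; rewrite inE.
Qed.

Lemma conn_setU1 E e u v :
  conn (e |: E) u v = conn E u v || conn E u e.1 && conn E e.2 v.
Proof.
apply/idP/orP => [h|[|/andP[h1 h2]]]; last 2 first.
- by apply: connS; apply: subsetUr.
- have s := connS (subsetUr [set e] E).
  apply: connect_trans (s _ _ h1) (connect_trans _ (s _ _ h2)).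
  by apply: conn_edge; rewrite -surjective_pairing setU11.
move: h; rewrite setUC => h.
case: (conn_first h) => [->|[e1 /set1P -> /andP[h1 _]]]; first by left.
case: (conn_last h) => [->|[e2 /set1P -> /andP[_ h2]]]; first by left.
by right; rewrite h1 h2.
Qed.

Lemma conn_lastE E u v : conn E u v -> u != v ->
  exists2 p, conn E u p & (p, v) \in E.
Proof.
move=> /connectP[p]; case/lastP: p => [_ -> /eqP //|p z].
rewrite rcons_path last_rcons => /andP[pp pz] -> _.
by exists (last u p) => //; apply/connectP; exists p.
Qed.

Lemma conn_firstE E u v : conn E u v -> u != v ->
  exists2 p, (u, p) \in E & conn E p v.
Proof.
rewrite -conn_conv eq_sym => h /(conn_lastE h)[p]; rewrite inE conn_conv.
by exists p.
Qed.

Lemma reach_countE E : reach_count E = #|reach_set E|.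
Proof. by []. Qed.

Lemma reach_set_sub E F :
  (forall u v, conn E u v -> conn F u v) -> reach_set E \subset reach_set F.
Proof. by move=> h; apply/subsetP=> p; rewrite !inE; apply: h. Qed.

Lemma reach_count_le E F :
  (forall u v, conn E u v -> conn F u v) -> reach_count E <= reach_count F.
Proof. by move=> h; apply/subset_leq_card/reach_set_sub. Qed.

Lemma reach_count_eq E F :
  (forall u v, conn E u v -> conn F u v) -> reach_count F <= reach_count E ->
  forall u v, conn F u v -> conn E u v.
Proof.
move=> /reach_set_sub sub le u v.
have /eqP/setP/(_ (u, v)) : reach_set E == reach_set F by rewrite eqEcard sub.
by rewrite !inE /= => ->.
Qed.

Definition sink E : pred V := fun t => [forall v, (t, v) \notin E].
Definition source E : pred V := fun s => [forall v, (v, s) \notin E].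
Definition ss E : {set V * V} := [set e | sink E e.1 && source E e.2].

Lemma sink_conv E : sink (converse E) =1 source E.
Proof. by move=> u; apply: eq_forallb => v; rewrite inE. Qed.

Lemma source_conv E : source (converse E) =1 sink E.
Proof. by move=> u; apply: eq_forallb => v; rewrite inE. Qed.

Lemma ss_conv E : ss (converse E) = converse (ss E).
Proof. by apply/setP=> e; rewrite !inE sink_conv source_conv andbC. Qed.

(** Loops are excluded separately because [connect] is reflexive and cannot see them. *)
Definition dag E : Prop :=
  (forall u v, conn E u v -> conn E v u -> u = v) /\ forall u, (u, u) \notin E.

Lemma acyclic_dag E : acyclic E -> dag E.
Proof.
move=> acE; split=> [u v|u]; last first.
  by apply/negP=> uu; have := acE [:: u]; rewrite /= /edge /= uu => /(_ isT).
move=> uv vu; apply/eqP/negPn/negP=> neq.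
case: (conn_firstE uv neq) => w uw wv.
case/connectP: (connect_trans wv vu) => p wp uE.
have := acE (rcons p w); case: p wp uE => [|z p] wp uE /=.
  rewrite /= in uE; have := acE [:: w]; rewrite -{1}uE in uw *.
  by rewrite /= /edge /= -uE uw => /(_ isT).
have := acE (w :: z :: p); rewrite /= rcons_path /=.
move: wp => /= /andP[-> ->] /=; rewrite -(_ : u = last z p) //.
by rewrite /edge /= uw => /(_ isT).
Qed.

Lemma dag_conv E : dag E -> dag (converse E).
Proof.
case=> h1 h2; split=> [u v|u]; last by rewrite inE.
by rewrite !conn_conv => h /h1; apply.
Qed.

Lemma sink_conn E t v : sink E t -> conn E t v -> v = t.
Proof.
move=> /forallP st h; apply/eqP/negPn/negP=> neq; rewrite eq_sym in neq.
by case: (conn_firstE h neq) => p; rewrite (negPf (st p)).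
Qed.

Lemma source_conn E s v : source E s -> conn E v s -> v = s.
Proof. by rewrite -sink_conv -conn_conv; apply: sink_conn. Qed.

(** A vertex with fewest descendants among those below [x] lies in a terminal strong component. *)
Lemma min_des E x : exists2 d, conn E x d & forall y, conn E d y -> conn E y d.
Proof.
have [|d xd dmin] := @arg_minnP _ x (fun d => conn E x d) (fun d => #|des E d|).
  exact: connect0.
exists d => // y dy.
have sub : des E y \subset des E d.
  by apply/subsetP=> w; rewrite !inE; apply: connect_trans.
have : d \in des E d by rewrite inE connect0.
suff /eqP <- : des E y == des E d by rewrite inE.
by rewrite eqEcard sub dmin //; apply: connect_trans dy.
Qed.

Lemma dag_sink E u : dag E -> exists2 t, conn E u t & sink E t.
Proof.
move=> [anti irr]; case: (min_des E u) => t ut tmin; exists t => //.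
apply/forallP=> v; apply/negP=> tv.
have := anti _ _ (conn_edge tv) (tmin _ (conn_edge tv)) => tE.
by move: tv; rewrite -tE (negPf (irr t)).
Qed.

Lemma dag_source E u : dag E -> exists2 s, conn E s u & source E s.
Proof.
move=> /dag_conv/dag_sink => /(_ u)[s]; rewrite conn_conv sink_conv.
by exists s.
Qed.

End Reachability.

(** * Extremal solutions and their acyclic edges *)

Section Extremal.
Variable V : finType.
Implicit Types (E F K N : {set V * V}) (u v x y : V) (e : V * V).

Definition cyclic E N : pred (V * V) := fun e => conn (E :|: N) e.2 e.1.
Definition acy E N : {set V * V} := [set e in N | ~~ cyclic E N e].

Definition extremal E B N : Prop :=
  [/\ N \subset ss E, #|N| <= B & forall N', N' \subset ss E -> #|N'| <= B ->
      reach_count (E :|: N') < reach_count (E :|: N) \/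
      reach_count (E :|: N') = reach_count (E :|: N) /\
      #|acy E N| + #|N| <= #|acy E N'| + #|N'|].

Lemma acy_conv E N : acy (converse E) (converse N) = converse (acy E N).
Proof. by apply/setP=> e; rewrite !inE /cyclic -converseU conn_conv. Qed.

Lemma extremal_conv E B N : extremal E B N -> extremal (converse E) B (converse N).
Proof.
case=> Nss NB Nmax; split; rewrite ?card_conv //.
  rewrite ss_conv; apply/subsetP=> e; rewrite !inE => eN.
  by have /subsetP/(_ _ eN) := Nss; rewrite inE.
move=> N' N's N'B; have N'E : N' = converse (converse N') by rewrite converseK.
rewrite N'E -!converseU !reach_conv !acy_conv !card_conv -(card_conv N').
apply: Nmax; rewrite ?card_conv //.
apply/subsetP=> e; rewrite inE => eN.
by have /subsetP/(_ _ eN) := N's; rewrite ss_conv inE /= -surjective_pairing.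
Qed.

Lemma extremal_exists E B : exists N, extremal E B N.
Proof.
pose w N := #|acy E N| + #|N|; pose W := #|{: V * V}| + #|{: V * V}|.
have wW N : w N <= W by apply: leq_add; apply: max_card.
have P0 : (set0 \subset ss E) && (#|set0 : {set V * V}| <= B).
  by rewrite sub0set cards0.
(* The lexicographic order as a single number: [w] never exceeds [W], so one more connected pair
   outweighs it. *)
case: (@arg_maxnP _ set0 (fun N => (N \subset ss E) && (#|N| <= B))
  (fun N => reach_count (E :|: N) * W.+1 + (W - w N)) P0) => N /andP[Ns NB] Nmax.
exists N; split=> // N' N's N'B; have := Nmax N'; rewrite N's N'B => /(_ isT).
move: (wW N) (wW N'); rewrite -/(w N) -/(w N').
set a := reach_count (E :|: N); set b := reach_count (E :|: N').
move: a b (w N) (w N') => a b c d cW dW /= h.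
case: (ltngtP b a) => [ab|ba|ab]; [by left| |by right; split=> //; rewrite ab in h; lia].
have : a.+1 * W.+1 <= b * W.+1 by rewrite leq_mul2r ba orbT.
rewrite mulSn; lia.
Qed.

(** Pushing the tail of an added edge down to a sink and its head up to a source loses nothing: the
    old tail still reaches the old head through the new edge. *)
Lemma to_ss E N : dag E -> exists N', [/\ N' \subset ss E, #|N'| <= #|N| &
  reach_count (E :|: N) <= reach_count (E :|: N')].
Proof.
move=> dE.
have /fin_all_exists[f fP] u : exists t, conn E u t && sink E t.
  by case: (dag_sink u dE) => t h1 h2; exists t; rewrite h1.
have /fin_all_exists[g gP] u : exists t, conn E t u && source E t.
  by case: (dag_source u dE) => t h1 h2; exists t; rewrite h1.
exists [set (f e.1, g e.2) | e in N]; split.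
- apply/subsetP=> _ /imsetP[e _ ->]; rewrite inE /=.
  by case/andP: (fP e.1) => _ ->; case/andP: (gP e.2) => _ ->.
- exact: leq_imset_card.
apply/reach_count_le/conn_sub => u v; rewrite inE => /orP[uv|uv].
  by apply: conn_edge; rewrite inE uv.
have s := connS (subsetUl E [set (f e.1, g e.2) | e in N]).
case/andP: (fP u) => /s h1 _; case/andP: (gP v) => /s h2 _.
apply: connect_trans h1 (connect_trans _ h2); apply: conn_edge.
by rewrite inE; apply/orP; right; apply/imsetP; exists (u, v).
Qed.

Variables (E : {set V * V}) (B : nat) (N : {set V * V}).
Hypotheses (dE : dag E) (exN : extremal E B N).
Local Notation H := (E :|: N).

Lemma exss e : e \in N -> sink E e.1 && source E e.2.
Proof. by case: exN => /subsetP s _ _ /s; rewrite inE. Qed.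

Lemma ext_sup N' : N' \subset ss E -> #|N'| <= #|N| ->
  (forall u v, conn H u v -> conn (E :|: N') u v) ->
  (forall u v, conn (E :|: N') u v -> conn H u v) /\
  #|acy E N| + #|N| <= #|acy E N'| + #|N'|.
Proof.
case: exN => _ NB Nmax N's N'N sub.
have le := reach_count_le sub.
case: (Nmax _ N's (leq_trans N'N NB)) => [|[eq h]]; first by rewrite ltnNge le.
by split=> //; apply: reach_count_eq; rewrite ?eq.
Qed.

Lemma ext_irred e : e \in N -> ~ conn (E :|: (N :\ e)) e.1 e.2.
Proof.
move=> eN h.
have sub u v : conn H u v -> conn (E :|: N :\ e) u v.
  apply: conn_sub => a b; rewrite inE => /orP[ab|ab].
    by apply: conn_edge; rewrite inE ab.
  have [abE|ne] := eqVneq (a, b) e; first by move: h; rewrite -abE.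
  by apply: conn_edge; rewrite !inE ne ab orbT.
have N's : N :\ e \subset ss E.
  by apply: subset_trans (subsetDl _ _) _; case: exN.
have card := cardsD1 e N; rewrite eN in card.
case: (ext_sup N's _ sub) => [|_ eq]; first by rewrite card leq_addl.
have le : #|acy E (N :\ e)| <= #|acy E N|; last first.
  move: (leq_trans eq (leq_add le (leqnn _))); rewrite leq_add2l card add1n.
  by rewrite ltnn.
apply/subset_leq_card/subsetP=> f; rewrite !inE => /andP[/andP[_ ->]] /=.
by apply: contra; apply: sub.
Qed.

(** Move the tail of [(t, s2)] to a sink [d] below [s1]. No pair is lost, so by extremality none is
    new, and [d] reaches [s2] already in [H]. Either this gives a bypass of [(t, s2)] through [s1]
    and [d], or [d] reaches [t] and [(t, s1)] lies on a cycle. *)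
Lemma acy_tail t s1 s2 : (t, s1) \in N -> ~~ cyclic E N (t, s1) ->
  (t, s2) \in N -> s2 = s1.
Proof.
rewrite /cyclic /= => e1N ac e2N; apply/eqP/negPn/negP=> ne.
pose N1 := N :\ (t, s2).
have HE : H = (t, s2) |: (E :|: N1).
  apply/setP=> e; rewrite !inE; have [->|] := eqVneq e (t, s2); rewrite ?e2N ?orbT //.
have ts1 : conn (E :|: N1) t s1.
  by apply: conn_edge; rewrite !inE e1N andbT xpair_eqE eqxx /= eq_sym ne orbT.
case: (dag_sink s1 dE) => d s1d sd.
have sub1 := connS (subsetUl E N1).
pose N2 := (d, s2) |: N1.
have sub2 : forall u v, conn (E :|: N1) u v -> conn (E :|: N2) u v.
  by apply: connS; apply: setUS; apply: subsetUr.
have N2s : N2 \subset ss E.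
  apply/subsetP=> e; rewrite in_setU1 => /orP[/eqP ->|].
    by case/andP: (exss e2N) => _ k; rewrite inE /= sd.
  by case/setD1P=> _ /exss; rewrite inE.
have N2c : #|N2| <= #|N|.
  by rewrite cardsU1 (cardsD1 (t, s2) N) e2N leq_add2r leq_b1.
have ds2 : conn (E :|: N2) d s2 by apply: conn_edge; rewrite !inE eqxx orbT.
case: (ext_sup N2s N2c) => [|h _].
  apply: conn_sub => u v; rewrite HE in_setU1 => /orP[/eqP[-> ->]|uv].
    apply: connect_trans (sub2 _ _ ts1) (connect_trans _ ds2).
    exact/sub2/sub1.
  exact/sub2/conn_edge.
have nred := ext_irred e2N.
have := h _ _ ds2; rewrite HE conn_setU1 /= => /orP[k|/andP[k _]].
  by apply: nred => /=; apply: connect_trans ts1 (connect_trans (sub1 _ _ s1d) k).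
case/negP: ac; rewrite HE conn_setU1 (connect_trans (sub1 _ _ s1d) k) //.
Qed.

End Extremal.

Section Extremal2.
Variable V : finType.
Implicit Types (F K : {set V * V}) (u v x y : V) (e : V * V).
Variables (E : {set V * V}) (B : nat) (N : {set V * V}).
Hypotheses (dE : dag E) (exN : extremal E B N).
Local Notation H := (E :|: N).

Lemma acy_head t1 t2 s : (t1, s) \in N -> ~~ cyclic E N (t1, s) ->
  (t2, s) \in N -> t2 = t1.
Proof.
move=> e1 c1 e2; apply: (acy_tail (dag_conv dE) (extremal_conv exN) (t := s));
  rewrite ?inE // /cyclic -converseU conn_conv; exact: c1.
Qed.

Definition triv F x := forall y, conn F x y -> conn F y x -> y = x.

(** The tail is a sink of [E] and by [acy_tail] has no other added edge, so a closed walk through it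
    would use [e]. *)
Lemma acy_triv1 e : e \in N -> ~~ cyclic E N e -> triv H e.1.
Proof.
move=> eN ec y xy yx; apply/eqP/negPn/negP=> ne; rewrite eq_sym in ne.
case: (conn_firstE xy ne) => p; rewrite inE => /orP[|xp py].
  by case/andP: (exss exN eN) => /forallP/(_ p)/negPf ->.
rewrite (acy_tail dE exN (t := e.1) (s1 := e.2) _ _ xp) -?surjective_pairing // in py.
by case/negP: ec; apply: connect_trans py yx.
Qed.

Lemma acy_triv2 e : e \in N -> ~~ cyclic E N e -> triv H e.2.
Proof.
move=> eN ec y xy yx; apply/eqP/negPn/negP=> ne.
case: (conn_lastE yx ne) => p yp; rewrite inE => /orP[|px].
  by case/andP: (exss exN eN) => _ /forallP/(_ p)/negPf ->.
rewrite (acy_head (t1 := e.1) (s := e.2) _ _ px) -?surjective_pairing // in yp.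
by case/negP: ec; apply: connect_trans xy yp.
Qed.

End Extremal2.

Lemma cardsU_disjoint (T : finType) (A B : {set T}) :
  (forall x, x \in A -> x \in B -> False) -> #|A :|: B| = #|A| + #|B|.
Proof.
move=> dis; rewrite cardsU (_ : A :&: B = set0) ?cards0 ?subn0 //.
apply/setP=> x; rewrite !inE; apply/negP=> /andP[]; exact: dis.
Qed.

(** * The gain of an edge that closes a cycle *)

Section Gain.
Variable V : finType.
Implicit Types (F K N : {set V * V}) (u v x y : V) (e : V * V).

(** With a strict ancestor and a strict descendant at [x], the closing edge of [gain] is itself one
    further new pair; [acy_inner] depends on this extra unit. *)
Definition inner F x : bool :=
  [exists y, conn F y x && ~~ conn F x y] && [exists y, conn F x y && ~~ conn F y x].

(** For positive a and b, a + b is at most a b + 1. If the second factor is empty, then [d] reaches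
    [x], and triviality of [x] leaves only [x] itself. *)
Lemma des_min_prod F x d : conn F x d -> (forall y, conn F d y -> conn F y d) ->
  triv F x -> #|des F x| <= #|des F d| * #|des F x :\: des F d| + 1.
Proof.
move=> xd dmin tx.
have sub : des F d \subset des F x.
  by apply/subsetP=> w; rewrite !inE; apply: connect_trans xd.
rewrite -(cardsID (des F d) (des F x)) (setIidPr sub).
have d0 : 0 < #|des F d| by apply/card_gt0P; exists d; rewrite inE connect0.
have [dx|ndx] := boolP (conn F d x).
  suff -> : des F d = [set d] by rewrite cards1 mul1n addnC.
  have dE : d = x by apply: tx.
  apply/setP=> y; rewrite !inE; apply/idP/eqP => [dy|->]; last exact: connect0.
  by rewrite dE; apply: tx; rewrite -dE // dmin.
have : 0 < #|des F x :\: des F d|.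
  by apply/card_gt0P; exists x; rewrite !inE connect0 ndx.
move: d0; move: #|_| #|_| => a b; nia.
Qed.

Lemma anc_conv F x : anc F x = des (converse F) x.
Proof. by apply/setP=> y; rewrite !inE conn_conv. Qed.

Lemma triv_conv F x : triv F x -> triv (converse F) x.
Proof. by move=> h y; rewrite !conn_conv => h1 h2; apply: h. Qed.

(** The edge from the terminal [d] to the initial [a] closes a cycle through [x]. It joins the
    ancestors of [x] outside the component of [a] to that component, and the component of [d] to the
    descendants of [x] outside it. Each product falls short of its share by at most one, whence the
    2. *)
Lemma gain F x a d : triv F x ->
  conn F a x -> (forall y, conn F y a -> conn F a y) ->
  conn F x d -> (forall y, conn F d y -> conn F y d) ->
  reach_count F + #|anc F x| + #|des F x| + inner F x <= reach_count ((d, a) |: F) + 2.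
Proof.
move=> tx ax amin xd dmin.
pose S1 := setX (anc F x :\: anc F a) (anc F a).
pose S2 := setX (des F d) (des F x :\: des F d).
pose S3 := if inner F x then [set (d, a)] else set0.
have c1 : #|anc F x| <= #|S1| + 1.
  rewrite cardsX mulnC !anc_conv; apply: des_min_prod (triv_conv tx).
    by rewrite conn_conv.
  by move=> y; rewrite !conn_conv; apply: amin.
have c2 : #|des F x| <= #|S2| + 1 by rewrite cardsX; apply: des_min_prod.
have c3 : #|S3| = inner F x by rewrite /S3; case: inner; rewrite ?cards1 ?cards0.
have iP : inner F x -> ~~ conn F x a && ~~ conn F d x.
  case/andP=> /existsP[y /andP[yx nxy]] /existsP[z /andP[xz nzx]].
  apply/andP; split; apply/negP=> h.
    have ea : a = x by apply: tx.
    by case/negP: nxy; rewrite -ea; apply: amin; rewrite ea.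
  have ed : d = x by apply: tx.
  by case/negP: nzx; rewrite -ed; apply: dmin; rewrite ed.
have F1 u v : conn F u v -> conn ((d, a) |: F) u v.
  by apply: connS; apply: subsetUr.
have F2 u v : conn F u d -> conn F a v -> conn ((d, a) |: F) u v.
  by move=> h1 h2; rewrite conn_setU1 h1 h2 orbT.
have sub : reach_set F :|: S1 :|: S2 :|: S3 \subset reach_set ((d, a) |: F).
  apply/subsetP=> -[u v]; rewrite 3!in_setU /S3 !inE /= -!orbA.
  case/or4P=> [/F1 //|/andP[/andP[_ ux] va]|/andP[du /andP[_ xv]]|].
  - by apply: F2 (amin _ va); apply: connect_trans xd.
  - by apply: F2 (dmin _ du) _; apply: connect_trans xv.
  - by case: ifP => // _; rewrite ?inE // => /eqP[-> ->]; apply: F2; apply: connect0.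
have := subset_leq_card sub; rewrite -reach_countE.
rewrite !cardsU_disjoint -?reach_countE; first last.
- move=> [u v]; rewrite 2!in_setU !inE /= /S3; case: ifP; rewrite ?inE // => /iP.
  case/andP=> /negP n1 /negP n2 uv /eqP[ud va]; move: uv; rewrite ud va.
  case/orP=> [/orP[da|/andP[/andP[_ dx] _]]|/andP[_ /andP[_ xa]]] //.
  by apply: n1; apply: connect_trans xd da.
- move=> [u v]; rewrite in_setU !inE /= => uv /andP[du /andP[/negP nv xv]].
  case/orP: uv => [uv|/andP[/andP[_ ux] _]].
    by apply: nv; apply: connect_trans du uv.
  have ue : u = x by apply: tx ux; apply: connect_trans du.
  by apply: nv; rewrite ue in du; apply: connect_trans du xv.
- move=> [u v]; rewrite !inE /= => uv /andP[/andP[/negP nua _] va].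
  by apply: nua; apply: connect_trans uv va.
rewrite c3; move: c1 c2; move: (reach_count F) #|S1| #|S2| #|anc F x| #|des F x|.
move: (nat_of_bool _) (reach_count _); clear; lia.
Qed.

End Gain.

Section Trade.
Variable V : finType.
Implicit Types (F K : {set V * V}) (u v x y : V) (e : V * V).
Variables (E : {set V * V}) (B : nat) (N : {set V * V}).
Hypotheses (dE : dag E) (exN : extremal E B N).
Local Notation H := (E :|: N).

(** A source of [E] above a vertex of an initial component belongs to that component, so the closing
    edge of [gain] can be taken from [ss E]. *)
Lemma min_source F x : E \subset F -> exists a, [/\ source E a, conn F a x &
  forall y, conn F y a -> conn F a y].
Proof.
move=> /connS EF; case: (min_des (converse F) x) => a.
rewrite conn_conv => ax amin.
case: (dag_source a dE) => s /EF sa ss; exists s; split=> //.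
  exact: connect_trans sa ax.
move=> y ys; apply: (connect_trans sa); rewrite -conn_conv; apply: amin.
by rewrite conn_conv; apply: connect_trans ys sa.
Qed.

Lemma min_sink F x : E \subset F -> exists d, [/\ sink E d, conn F x d &
  forall y, conn F d y -> conn F y d].
Proof.
move=> /connS EF; case: (min_des F x) => a xa amin.
case: (dag_sink a dE) => s /EF sa ss; exists s; split=> //.
  exact: connect_trans xa sa.
move=> y ys; apply: (fun h => connect_trans h sa); apply: amin.
exact: connect_trans sa ys.
Qed.

(** The common end of all exchanges. [N'] has an edge to spare; if the gain at [x] covers what [N']
    lost, adding the closing edge, which is cyclic, contradicts the tie-breaker. *)
Lemma trade (N' : {set V * V}) x : N' \subset ss E -> #|N'| < #|N| -> #|acy E N'| < #|acy E N| ->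
  triv (E :|: N') x ->
  reach_count H + 2 <= reach_count (E :|: N') + #|anc (E :|: N') x|
    + #|des (E :|: N') x| + inner (E :|: N') x -> False.
Proof.
move=> N's N'N acN tx le.
case: (min_source x (subsetUl E N')) => a [sa ax amin].
case: (min_sink x (subsetUl E N')) => d [sd xd dmin].
have := gain tx ax amin xd dmin.
pose N2 := (d, a) |: N'; rewrite setUCA -/N2 => ga.
have N2s : N2 \subset ss E by rewrite subUset N's sub1set inE /= sd sa.
have N2N : #|N2| <= #|N|.
  by rewrite cardsU1; apply: leq_trans N'N; rewrite -add1n leq_add2r leq_b1.
case: exN => _ NB /(_ N2 N2s (leq_trans N2N NB)).
have le2 : reach_count H <= reach_count (E :|: N2).
  by rewrite -(leq_add2r 2); apply: leq_trans le ga.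
case=> [|[_]]; first by rewrite ltnNge le2.
suff ac : #|acy E N2| <= #|acy E N'|.
  rewrite leqNgt; case/negP; apply: leq_ltn_trans (leq_add ac N2N) _.
  by rewrite ltn_add2r.
apply/subset_leq_card/subsetP=> e; rewrite !inE => /andP[/orP[/eqP->|eN] nc].
  case/negP: nc; rewrite /cyclic /=; apply: connS (connect_trans ax xd).
  by rewrite /N2 setUCA subsetUr.
rewrite eN /=; apply: contra nc; apply: connS.
by rewrite /N2 setUCA subsetUr.
Qed.

Definition twin u v : bool :=
  [forall w, ((u, w) \in E) == ((v, w) \in E)] &&
  [forall w, ((w, u) \in E) == ((w, v) \in E)].

Lemma twin_out u v w : twin u v -> ((u, w) \in E) = ((v, w) \in E).
Proof. by case/andP=> /forallP/(_ w)/eqP. Qed.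

Lemma twin_in u v w : twin u v -> ((w, u) \in E) = ((w, v) \in E).
Proof. by case/andP=> _ /forallP/(_ w)/eqP. Qed.

Lemma twin_source u v : twin u v -> source E u = source E v.
Proof. by move=> uv; apply: eq_forallb => w; rewrite (twin_in _ uv). Qed.

Lemma twin_sink u v : twin u v -> sink E u = sink E v.
Proof. by move=> uv; apply: eq_forallb => w; rewrite (twin_out _ uv). Qed.

(* Heads of N-edges are sources, so only E-edges enter a non-source. *)
Lemma anc_twin (N' : {set V * V}) t1 t2 u : N' \subset ss E -> twin t1 t2 -> ~~ source E t1 ->
  conn (E :|: N') u t1 -> u != t1 -> conn (E :|: N') u t2.
Proof.
move=> N's tw ns ut ne; case: (conn_lastE ut ne) => p up.
rewrite inE => /orP[pt|/(subsetP N's)]; last by rewrite inE /= (negPf ns) andbF.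
by apply: connect_trans up (conn_edge _); rewrite inE -(twin_in _ tw) pt.
Qed.

Lemma des_twin (N' : {set V * V}) t1 t2 u : N' \subset ss E -> twin t1 t2 -> ~~ sink E t1 ->
  conn (E :|: N') t1 u -> u != t1 -> conn (E :|: N') t2 u.
Proof.
move=> N's tw ns ut ne; rewrite eq_sym in ne; case: (conn_firstE ut ne) => p.
rewrite inE => /orP[pt|/(subsetP N's)]; last by rewrite inE /= (negPf ns).
move=> pu; apply: connect_trans (conn_edge _) pu.
by rewrite inE -(twin_out _ tw) pt.
Qed.

(** Delete [e2]. Strict ancestors of [t2] are ancestors of [t1], and dually for [s2] and [s1], so a
    lost pair starts at [t2] or ends at [s2]. The gain at [t1] covers them. *)
Lemma acy_twin e1 e2 : e1 \in acy E N -> e2 \in acy E N ->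
  twin e1.1 e2.1 -> twin e1.2 e2.2 -> ~~ source E e1.1 -> ~~ sink E e1.2 -> e1 = e2.
Proof.
rewrite !inE; case: e1 e2 => [t1 s1] [t2 s2] /= /andP[e1N c1] /andP[e2N c2] twt tws nt ns.
apply/eqP/negPn/negP=> ne.
have nt2 : ~~ source E t2 by rewrite -(twin_source twt).
have ns2 : ~~ sink E s2 by rewrite -(twin_sink tws).
have net : t1 != t2.
  apply: contra ne => /eqP tE; move: e2N c2; rewrite -tE => e2N c2.
  by rewrite (acy_tail dE exN e1N c1 e2N).
have nes : s1 != s2.
  apply: contra ne => /eqP tE; move: e2N c2; rewrite -tE => e2N c2.
  by rewrite (acy_head dE exN e1N c1 e2N).
pose N1 := N :\ (t2, s2); pose F := E :|: N1.
have HE : H = (t2, s2) |: F.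
  by apply/setP=> e; rewrite !inE; have [->|] := eqVneq e (t2, s2); rewrite ?e2N ?orbT.
have FH u v : conn F u v -> conn H u v.
  by rewrite HE; apply: connS; apply: subsetUr.
have N1s : N1 \subset ss E.
  by apply: subset_trans (subsetDl _ _) _; case: exN.
have e1F : (t1, s1) \in F by rewrite !inE e1N ne !orbT.
have trt : triv F t1.
  move=> y h1 h2; apply: (acy_triv1 dE exN e1N c1); exact: FH.
have trs : triv F s1.
  move=> y h1 h2; apply: (acy_triv2 dE exN e1N c1); exact: FH.
apply: (trade N1s _ _ trt); rewrite -/F.
- by rewrite [#|N|](cardsD1 (t2, s2)) e2N.
- rewrite [#|acy E N|](cardsD1 (t2, s2)) inE e2N c2 add1n ltnS.
  apply/subset_leq_card/subsetP=> -[a b]; rewrite !inE => /andP[/andP[ne1 abN] nc].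
  rewrite ne1 abN /=; apply: contra nc; rewrite /cyclic /= HE conn_setU1.
  case/orP=> [//|/andP[/= /FH h1 /FH h2]]; case/negP: c2; rewrite /cyclic /=.
  apply: connect_trans h2 (connect_trans _ h1); apply: conn_edge.
  by rewrite inE abN orbT.
have sub : reach_set H \subset
    reach_set F :|: setX [set t2] (des F s2) :|: setX (anc F t2 :\ t2) [set s2].
  apply/subsetP=> -[u v]; rewrite !inE /= HE conn_setU1 /=.
  case/orP=> [-> //|/andP[ut sv]].
  have [->|nut] := eqVneq u t2; first by rewrite sv !orbT.
  have [->|nvs] := eqVneq v s2; first by rewrite ut !orbT.
  have twt' : twin t2 t1 by case/andP: twt => h1 h2; apply/andP; split;
    apply/forallP=> w; rewrite eq_sym; [apply: (forallP h1) | apply: (forallP h2)].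
  have tws' : twin s2 s1 by case/andP: tws => h1 h2; apply/andP; split;
    apply/forallP=> w; rewrite eq_sym; [apply: (forallP h1) | apply: (forallP h2)].
  rewrite (connect_trans (anc_twin N1s twt' nt2 ut nut)) //.
  apply: connect_trans (conn_edge e1F) _.
  exact: (des_twin N1s tws' ns2 sv nvs).
have t2F y : conn F t2 y -> y = t2.
  move=> h; apply/eqP/negPn/negP=> n; rewrite eq_sym in n.
  case: (conn_firstE h n) => p; rewrite !inE => /orP[|/andP[ne2 pN]].
    by case/andP: (exss exN e2N) => /= /forallP/(_ p)/negPf ->.
  by case/negP: ne2; rewrite (acy_tail dE exN e2N c2 pN).
have cA : #|anc F t2 :\ t2| <= #|anc F t1 :\ t1|.
  apply/subset_leq_card/subsetP=> y; rewrite !inE => /andP[n yt].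
  have twt' : twin t2 t1 by case/andP: twt => h1 h2; apply/andP; split;
    apply/forallP=> w; rewrite eq_sym; [apply: (forallP h1) | apply: (forallP h2)].
  rewrite (anc_twin N1s twt' nt2 yt n) andbT; apply: contra n => /eqP yE.
  rewrite yE in yt *.
  case: (conn_lastE yt net) => p tp; rewrite inE => /orP[pt|].
    have pt1 : (p, t1) \in E by rewrite (twin_in _ twt).
    have pE : p = t1.
      by apply: trt => //; apply: conn_edge; rewrite inE pt1.
    by case: dE => _ /(_ t1); rewrite -{1}pE pt1.
  by rewrite inE => /andP[_ /(exss exN)] /andP[_ /= ]; rewrite (negPf nt2).
have cS : #|des F s2 :\ s2| <= #|des F s1 :\ s1|.
  apply/subset_leq_card/subsetP=> y; rewrite !inE => /andP[n yt].
  have tws' : twin s2 s1 by case/andP: tws => h1 h2; apply/andP; split;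
    apply/forallP=> w; rewrite eq_sym; [apply: (forallP h1) | apply: (forallP h2)].
  rewrite (des_twin N1s tws' ns2 yt n) andbT; apply: contra n => /eqP yE.
  rewrite yE in yt *.
  rewrite eq_sym in nes; case: (conn_firstE yt nes) => p; rewrite inE => /orP[pt|].
    have pt1 : (s1, p) \in E by rewrite (twin_out _ tws).
    move=> ps; have pE : p = s1.
      by apply: trs => //; apply: conn_edge; rewrite inE pt1.
    by case: dE => _ /(_ s1); rewrite -{2}pE pt1.
  by rewrite inE => /andP[_ /(exss exN)] /andP[/=]; rewrite (negPf ns2).
(* This strictness, and not counting the pair [(t2, s2)] twice, pay for the 2 in [gain]. *)
have cD : #|des F s1| < #|des F t1|.
  apply/proper_card/properP; split.
    by apply/subsetP=> y; rewrite !inE; apply: connect_trans; apply: conn_edge.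
  exists t1; rewrite !inE ?connect0 //; apply: contra c1; exact: FH.
have := subset_leq_card sub; rewrite -reach_countE => /leq_trans le.
have le1 : #|reach_set F :|: setX [set t2] (des F s2) :|: setX (anc F t2 :\ t2) [set s2]|
   <= reach_count F + #|des F s2| + #|anc F t2 :\ t2|.
  apply: leq_trans (leq_card_setU _ _) _; rewrite cardsX cards1 muln1 leq_add2r.
  by apply: leq_trans (leq_card_setU _ _) _; rewrite cardsX cards1 mul1n reach_countE.
have := le _ le1.
have := cardsD1 t1 (anc F t1); have := cardsD1 s1 (des F s1); have := cardsD1 s2 (des F s2).
rewrite !inE !connect0 !add1n.
move: cA cS cD; move: #|anc F t2 :\ t2| #|anc F t1 :\ t1| #|des F s2 :\ s2| #|des F s1 :\ s1|.
move: #|anc F t1| #|des F t1| #|des F s1| #|des F s2| (reach_count F) (reach_count H).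
move: (nat_of_bool _); clear; lia.
Qed.

End Trade.

(** * Acyclic edges at isolated vertices *)

Section Isolated.
Variable V : finType.
Implicit Types (F K : {set V * V}) (u v x y : V) (e : V * V).
Variables (E : {set V * V}) (B : nat) (N : {set V * V}).
Hypotheses (dE : dag E) (exN : extremal E B N).
Local Notation H := (E :|: N).

Definition isolated u : bool := sink E u && source E u.
Definition entered u : bool := [exists p, (p, u) \in N].

(** Only [z'] reaches [z'], so deleting [(z', q')] loses just the strict descendants of [z'], no
    more than the gain at [z] brings. *)
Lemma acy_start z q z' q' : (z, q) \in acy E N -> (z', q') \in acy E N -> z != z' ->
  isolated z -> isolated z' -> ~~ entered z -> ~~ entered z' ->
  #|des H z'| <= #|des H z| -> False.
Proof.
rewrite !inE => /andP[eN c] /andP[eN' c'] ne /andP[_ so] /andP[_ so'] en en' le.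
pose N1 := N :\ (z', q'); pose F := E :|: N1.
have HE : H = (z', q') |: F.
  by apply/setP=> e; rewrite !inE; have [->|] := eqVneq e (z', q'); rewrite ?eN' ?orbT.
have FH u v : conn F u v -> conn H u v.
  by rewrite HE; apply: connS; apply: subsetUr.
have N1s : N1 \subset ss E.
  by apply: subset_trans (subsetDl _ _) _; case: exN.
have trz : triv F z.
  move=> y h1 h2; apply: (acy_triv1 dE exN eN c); exact: FH.
have Fz' y : conn F y z' -> y = z'.
  move=> h; apply/eqP/negPn/negP=> n; case: (conn_lastE h n) => p _.
  rewrite !inE => /orP[|/andP[_ pN]]; first by rewrite (negPf (forallP so' p)).
  by case/existsP: en'; exists p.
apply: (trade dE exN N1s _ _ trz); rewrite -/F.
- by rewrite [#|N|](cardsD1 (z', q')) eN'.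
- rewrite [#|acy E N|](cardsD1 (z', q')) inE eN' c' add1n ltnS.
  apply/subset_leq_card/subsetP=> -[a b]; rewrite !inE => /andP[/andP[ne1 abN] nc].
  rewrite ne1 abN /=; apply: contra nc; rewrite /cyclic /= HE conn_setU1.
  case/orP=> [//|/andP[/= /FH h1 /FH h2]]; case/negP: c'; rewrite /cyclic /=.
  apply: connect_trans h2 (connect_trans _ h1); apply: conn_edge.
  by rewrite inE abN orbT.
have sub : reach_set H \subset reach_set F :|: setX [set z'] (des H z' :\ z').
  apply/subsetP=> -[u v]; rewrite !inE /=.
  have [->|nv] := eqVneq v z'.
    by rewrite HE conn_setU1 /= => /orP[-> //|/andP[-> ]].
  move=> h; have := h; rewrite {1}HE conn_setU1 /= => /orP[-> //|/andP[/Fz' uE _]].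
  by rewrite uE -uE h eqxx orbT.
have ca : 0 < #|anc F z| by apply/card_gt0P; exists z; rewrite inE connect0.
have cd : #|des H z| <= #|des F z|.
  apply/subset_leq_card/subsetP=> y; rewrite !inE HE conn_setU1 /=.
  by case/orP=> [//|/andP[/Fz' zE _]]; rewrite zE eqxx in ne.
have := subset_leq_card sub; rewrite -reach_countE => le1.
have le2 := leq_trans le1 (leq_card_setU _ _).
move: le2; rewrite cardsX cards1 mul1n -reach_countE.
have := cardsD1 z' (des H z'); rewrite inE connect0 add1n.
move: le ca cd; move: #|des H z'| #|des H z'  :\ z'| #|des H z| #|anc F z| #|des F z|.
move: (nat_of_bool _) (reach_count _) (reach_count _); clear; lia.
Qed.

(** Bypass [z']: its two edges become the single edge [(p, q')], and only pairs at [z'] are lost. As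
    [z'] cannot be both above and below [z], at most one vertex disappears from the ancestors and
    descendants of [z], and the bonus of [inner] makes up for it. *)
Lemma acy_inner z q z' q' : (z, q) \in acy E N -> (z', q') \in acy E N -> z != z' ->
  isolated z -> isolated z' -> entered z -> entered z' ->
  #|anc H z'| + #|des H z'| <= #|anc H z| + #|des H z| -> False.
Proof.
rewrite !inE => /andP[eN c] /andP[eN' c'] ne /andP[si so] /andP[si' so'].
move=> /existsP[p1 pN1] /existsP[p pN] le.
(* A return path from [w] has to leave by its only edge [(w, r)], which would then be cyclic too. *)
have into w t r : (t, w) \in N -> ~~ cyclic E N (w, r) -> sink E w -> (w, r) \in N ->
    ~~ cyclic E N (t, w).
  move=> twN cw sw wrN; apply: contraNN (cw); rewrite /cyclic /= => wt.
  have [tE|n] := eqVneq t w.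
    by rewrite -(acy_tail dE exN wrN cw (s2 := w)) ?connect0 // -{1}tE.
  rewrite eq_sym in n; case: (conn_firstE wt n) => r2; rewrite inE => /orP[|wr2].
    by rewrite (negPf (forallP sw r2)).
  rewrite (acy_tail dE exN wrN cw wr2) => /connect_trans; apply; apply: conn_edge.
  by rewrite inE twN orbT.
have cp := into _ _ _ pN c' si' eN'.
have cp1 := into _ _ _ pN1 c si eN.
have tz : triv H z by apply: (acy_triv1 dE exN eN c).
have tz' : triv H z' by apply: (acy_triv1 dE exN eN' c').
have npz : p != z'.
  by apply: contra cp => /eqP ->; rewrite /cyclic connect0.
have nqz : q' != z'.
  by apply: contra c' => /eqP ->; rewrite /cyclic connect0.
pose N0 := N :\ (p, z') :\ (z', q'); pose F := E :|: N0.
pose N1 := (p, q') |: N0; pose G := E :|: N1.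
have pz_ne : (z', q') != (p, z') by rewrite xpair_eqE (negPf nqz) andbF.
have HE : H = (p, z') |: ((z', q') |: F).
  apply/setP=> e; rewrite !inE; have [->|] := eqVneq e (p, z'); first by rewrite pN orbT.
  by have [->|] := eqVneq e (z', q'); rewrite ?eN' ?orbT.
have GE : G = (p, q') |: F by rewrite /G /N1 setUCA.
have FG u v : conn F u v -> conn G u v.
  by rewrite GE; apply: connS; apply: subsetUr.
have Hpz : conn H p z' by apply: conn_edge; rewrite inE pN orbT.
have Hzq : conn H z' q' by apply: conn_edge; rewrite inE eN' orbT.
have GH u v : conn G u v -> conn H u v.
  apply: conn_sub => a b; rewrite GE in_setU1 => /orP[/eqP[-> ->]|ab].
    exact: connect_trans Hpz Hzq.
  by apply: conn_edge; rewrite HE 2!in_setU1 ab !orbT.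
have toz y : (y, z') \in N -> y = p.
  by move=> yN; apply: (acy_head dE exN pN cp yN).
have ofz y : (z', y) \in N -> y = q'.
  by move=> yN; apply: (acy_tail dE exN eN' c' yN).
have Fto y : conn F y z' -> y = z'.
  move=> h; apply/eqP/negPn/negP=> n; case: (conn_lastE h n) => r _.
  rewrite !inE => /orP[|/and3P[_ ner rN]]; first by rewrite (negPf (forallP so' r)).
  by rewrite (toz _ rN) eqxx in ner.
have Fof y : conn F z' y -> y = z'.
  move=> h; apply/eqP/negPn/negP=> n; rewrite eq_sym in n.
  case: (conn_firstE h n) => r; rewrite !inE => /orP[|/and3P[ner _ rN]].
    by rewrite (negPf (forallP si' r)).
  by rewrite (ofz _ rN) eqxx in ner.
have keep u v : u != z' -> v != z' -> conn H u v -> conn G u v.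
  move=> /eqP nu /eqP nv.
  have F' a b : a <> z' -> conn ((z', q') |: F) a b -> conn F a b.
    by move=> na; rewrite conn_setU1 /= => /orP[//|/andP[/Fto]].
  rewrite HE conn_setU1 /= => /orP[/(F' _ _ nu)/FG //|/andP[/(F' _ _ nu)/FG up]].
  rewrite conn_setU1 /= => /orP[/Fof//|/andP[_ /FG qv]].
  apply: connect_trans up (connect_trans _ qv); apply: conn_edge.
  by rewrite GE setU11.
have N1s : N1 \subset ss E.
  have /andP[/= k1 _] := exss exN pN; have /andP[/= _ k2] := exss exN eN'.
  apply/subsetP=> e; rewrite in_setU1 => /orP[/eqP ->|]; first by rewrite inE k1.
  by case/setD1P=> _ /setD1P[_ /(exss exN)]; rewrite inE.
have trz : triv G z.
  by move=> y h1 h2; apply: tz; exact: GH.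
have cN : #|N| = 2 + #|N0|.
  rewrite (cardsD1 (p, z') N) pN (cardsD1 (z', q') (N :\ _)) in_setD1.
  by rewrite pz_ne eN'.
apply: (trade dE exN N1s _ _ trz); rewrite -/G.
- rewrite cN /N1 cardsU1; case: (_ \notin _); [exact: leqnn | exact: leqW].
- have acE : #|acy E N| = 2 + #|acy E N :\ (p, z') :\ (z', q')|.
    rewrite (cardsD1 (p, z') (acy E N)) inE pN cp (cardsD1 (z', q') (_ :\ _)) in_setD1.
    by rewrite pz_ne inE eN' c'.
  have sub : acy E N1 \subset (p, q') |: (acy E N :\ (p, z') :\ (z', q')).
    apply/subsetP=> -[a b]; rewrite inE !in_setU1 => /andP[/orP[-> //|abN0] nc].
    move: abN0; rewrite !inE => /and3P[n1 n2 abN]; rewrite n1 n2 abN /=.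
    apply/orP; right; apply: contra nc; rewrite /cyclic /= -/G; apply: keep.
      by apply: contra n2 => /eqP bz; rewrite bz in abN *; rewrite (toz _ abN).
    by apply: contra n1 => /eqP bz; rewrite bz in abN *; rewrite (ofz _ abN).
  apply: leq_ltn_trans (subset_leq_card sub) _; rewrite acE cardsU1.
  by case: (_ \notin _); [exact: leqnn | exact: leqW].
have in1 : inner G z.
  apply/andP; split.
    have [pE|np] := eqVneq p1 z'.
      have qE : z = q' by apply: ofz; rewrite -pE.
      apply/existsP; exists p; apply/andP; split.
        by apply: conn_edge; rewrite GE qE setU11.
      apply: contra c' => /GH; rewrite qE => h; rewrite /cyclic /=; apply: connect_trans h Hpz.
    apply/existsP; exists p1; apply/andP; split.
      apply: conn_edge; rewrite GE !inE pN1 !xpair_eqE (negPf ne) andbF.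
      by rewrite (negPf np) /= !orbT.
    by apply: contra cp1 => /GH.
  have [qE|nq] := eqVneq q z'.
    have pE : z = p by apply: toz; rewrite -qE.
    apply/existsP; exists q'; apply/andP; split.
      by apply: conn_edge; rewrite GE pE setU11.
    apply: contra cp => /GH; rewrite pE => h; rewrite /cyclic /=; apply: connect_trans Hzq h.
  apply/existsP; exists q; apply/andP; split.
    apply: conn_edge; rewrite GE !inE eN !xpair_eqE (negPf ne) (negPf nq) andbF /=.
    by rewrite !orbT.
  by apply: contra c => /GH.
rewrite in1.
have sub : reach_set H \subset reach_set G :|: setX [set z'] (des H z' :\ z')
    :|: setX (anc H z' :\ z') [set z'].
  apply/subsetP=> -[u v]; rewrite !inE /=.
  have [->|nu] := eqVneq u z'; have [->|nv] := eqVneq v z'; rewrite ?connect0 //.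
  - by move=> ->; rewrite !orbT.
  - by move=> ->; rewrite !orbT.
  - by move/(keep _ _ nu nv) => ->.
have cA : #|anc H z :\ z'| <= #|anc G z|.
  apply/subset_leq_card/subsetP=> y; rewrite !inE => /andP[n]; exact: keep.
have cD : #|des H z :\ z'| <= #|des G z|.
  apply/subset_leq_card/subsetP=> y; rewrite !inE => /andP[n]; exact: keep.
have nboth : (z' \in anc H z) + (z' \in des H z) <= 1.
  rewrite !inE; case h1: (conn H z' z); case h2: (conn H z z') => //.
  by rewrite (tz' _ h1 h2) eqxx in ne.
have := subset_leq_card sub; rewrite -reach_countE => le1.
have le2 := leq_trans le1 (leq_trans (leq_card_setU _ _) (leq_add (leq_card_setU _ _) (leqnn _))).
move: le2; rewrite !cardsX cards1 mul1n muln1 -reach_countE.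
have := cardsD1 z' (des H z'); have := cardsD1 z' (anc H z').
have := cardsD1 z' (des H z); have := cardsD1 z' (anc H z).
rewrite ![z' \in des _ z']inE ![z' \in anc _ z']inE !connect0.
move: le cA cD nboth; move: (nat_of_bool (_ \in _)) (nat_of_bool (_ \in _)).
move: #|des H z'| #|des H z'  :\ z'| #|des H z| #|des H z  :\ z'| #|anc G z| #|des G z|.
move: #|anc H z'| #|anc H z'  :\ z'| #|anc H z| #|anc H z  :\ z'|.
move: (reach_count _) (reach_count _); clear; rewrite /=; lia.
Qed.

Lemma acy_isolated e1 e2 : e1 \in acy E N -> e2 \in acy E N ->
  isolated e1.1 -> isolated e2.1 -> entered e1.1 = entered e2.1 -> e1 = e2.
Proof.
case: e1 e2 => [z q] [z' q'] /= a a' iz iz' en.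
have [zE|ne] := eqVneq z z'.
  move: a a'; rewrite -zE !inE => /andP[h1 h2] /andP[h3 _].
  by rewrite (acy_tail dE exN h1 h2 h3).
have ne' := ne; rewrite eq_sym in ne'.
exfalso; case: (boolP (entered z)) => en1; have en2 := en1; rewrite en in en2.
  case/orP: (leq_total (#|anc H z'| + #|des H z'|) (#|anc H z| + #|des H z|)).
    exact: (acy_inner a a').
  exact: (acy_inner a' a).
case/orP: (leq_total #|des H z'| #|des H z|).
  exact: (acy_start a a').
exact: (acy_start a' a).
Qed.

End Isolated.

Section Twins.
Variable V : finType.
Variable E : {set V * V}.
Implicit Types (u v w : V).

Lemma twin_refl u : twin E u u.
Proof. by apply/andP; split; apply/forallP=> w. Qed.

Lemma twin_sym u v : twin E u v = twin E v u.
Proof. by congr (_ && _); apply: eq_forallb => w; rewrite eq_sym. Qed.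

Lemma twin_trans u v w : twin E u v -> twin E v w -> twin E u w.
Proof.
move=> uv vw; apply/andP; split; apply/forallP=> x.
  by rewrite (twin_out _ uv) (twin_out _ vw).
by rewrite (twin_in _ uv) (twin_in _ vw).
Qed.

Definition twins u : {set V} := [set v | twin E u v].
Definition ntwins : nat := #|[set twins u | u : V]|.

Lemma twinsP u v : reflect (twins u = twins v) (twin E u v).
Proof.
apply: (iffP idP) => [uv|/setP/(_ v)]; last by rewrite !inE twin_refl => ->.
apply/setP=> w; rewrite !inE; apply/idP/idP; apply: twin_trans => //.
by rewrite twin_sym.
Qed.

End Twins.

Section AcyclicBound.
Variable V : finType.
Variables (E : {set V * V}) (B : nat) (N : {set V * V}).
Hypotheses (dE : dag E) (exN : extremal E B N).

(** The tail of an added edge is a sink, so it is a source only if isolated; [acy_twin] therefore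
    handles all edges with two non-isolated ends. Isolated tails contribute one edge for each value
    of [entered], and isolated heads the same by reversal. *)
Lemma acy_bound : #|acy E N| <= ntwins E ^ 2 + 4.
Proof.
have inA (P : pred (V * V)) e : (e \in [set e in acy E N | P e]) = (e \in acy E N) && P e.
  by rewrite inE.
pose A1 := [set e in acy E N | isolated E e.1].
pose A2 := [set e in acy E N | isolated E e.2].
pose A3 := [set e in acy E N | ~~ isolated E e.1 && ~~ isolated E e.2].
have sub : acy E N \subset A3 :|: A1 :|: A2.
  apply/subsetP=> e eA; rewrite !in_setU !inA eA.
  by case: (isolated E e.1); case: (isolated E e.2).
have c1 : #|A1| <= 2.
  rewrite -(card_in_imset (f := fun e => entered N e.1)) -?card_bool ?max_card //.
  move=> e1 e2; rewrite !inA => /andP[a1 i1] /andP[a2 i2].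
  exact: (acy_isolated dE exN a1 a2 i1 i2).
have c2 : #|A2| <= 2.
  rewrite -(card_in_imset (f := fun e => entered (converse N) e.2)) -?card_bool ?max_card //.
  move=> e1 e2; rewrite !inA => /andP[a1 i1] /andP[a2 i2] en.
  have ic u : isolated E u -> isolated (converse E) u.
    by rewrite /isolated sink_conv source_conv andbC.
  have := acy_isolated (dag_conv dE) (extremal_conv exN) (e1 := (e1.2, e1.1)) (e2 := (e2.2, e2.1)).
  rewrite acy_conv ![_ \in converse _]inE /= -!surjective_pairing.
  move=> /(_ a1 a2 (ic _ i1) (ic _ i2) en) [h1 h2].
  by rewrite (surjective_pairing e1) h1 h2 -surjective_pairing.
have c3 : #|A3| <= ntwins E ^ 2.
  rewrite -(card_in_imset (f := fun e => (twins E e.1, twins E e.2))).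
    rewrite -mulnn /ntwins -cardsX; apply/subset_leq_card/subsetP=> _ /imsetP[e _ ->].
    by rewrite inE /= !imset_f.
  move=> e1 e2; rewrite !inA => /andP[a1 /andP[i1 i2]] /andP[a2 _].
  case=> /twinsP h1 /twinsP h2; apply: (acy_twin dE exN a1 a2 h1 h2).
    apply: contra i1 => so; rewrite /isolated so andbT.
    by move: a1; rewrite inE => /andP[/(exss exN)/andP[]].
  apply: contra i2 => so; rewrite /isolated so /=.
  by move: a1; rewrite inE => /andP[/(exss exN)/andP[]].
apply: leq_trans (subset_leq_card sub) _.
apply: leq_trans (leq_card_setU _ _) _; rewrite -[4]/(2 + 2) addnA.
by apply: leq_add c2; apply: leq_trans (leq_card_setU _ _) _; apply: leq_add.
Qed.

End AcyclicBound.

(** * Replacing the cyclic edges by a core *)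

Section EswaranTarjan.
Variable V : finType.
Implicit Types (E F M : {set V * V}) (ps : seq (V * V)).

Fixpoint links (x : V) ps : seq (V * V) :=
  if ps is p :: ps' then (x, p.1) :: links p.2 ps' else [::].

Lemma size_links x ps : size (links x ps) = size ps.
Proof. by elim: ps x => //= p ps IH x; rewrite IH. Qed.

Lemma links_sub x ps e : e \in links x ps ->
  e.1 \in x :: map snd ps /\ e.2 \in map fst ps.
Proof.
elim: ps x => //= p ps IH x; rewrite inE => /orP[/eqP -> /=|/IH[h1 h2]].
  by rewrite !inE !eqxx.
by rewrite in_cons h1 orbT in_cons h2 orbT.
Qed.

Lemma links_conn F x ps : (forall e, e \in links x ps -> conn F e.1 e.2) ->
  (forall p, p \in ps -> conn F p.1 p.2) ->
  conn F x (last x (map snd ps)) /\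
  forall p, p \in ps -> conn F x p.1 /\ conn F p.2 (last x (map snd ps)).
Proof.
elim: ps x => [|p ps IH] x hl hp /=; first by rewrite connect0.
have xp : conn F x p.1 by apply: (hl (x, p.1)); rewrite inE eqxx.
have pp : conn F p.1 p.2 by apply: hp; rewrite inE eqxx.
case: (IH p.2) => [e el|q ql|h1 h2]; [by apply: hl; rewrite inE el orbT| |].
  by apply: hp; rewrite inE ql orbT.
have xp2 := connect_trans xp pp.
split=> [|q]; first exact: connect_trans xp2 h1.
rewrite inE => /orP[/eqP -> //|/h2[k1 k2]]; split=> //.
exact: connect_trans xp2 k1.
Qed.

(* The construction of Eswaran and Tarjan: a maximal matching of sources with
   reachable sinks is closed up to a cycle, to which every unmatched sink leads
   and from which every unmatched source is reached; unmatched sinks and sources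
   are then joined in pairs. *)
Lemma strong_augmentation E (A S : {set V}) a : a \in A ->
  (forall a, a \in A -> exists2 b, b \in S & conn E b a) ->
  (forall b, b \in S -> exists2 a, a \in A & conn E b a) ->
  exists M : {set V * V}, [/\ M \subset setX A S, M != set0, #|M| <= maxn #|A| #|S| &
    forall x y, x \in A :|: S -> y \in A :|: S -> conn (E :|: M) x y].
Proof.
move=> aA AS SA.
pose ok (p : V * V) := [&& p.1 \in S, p.2 \in A & conn E p.1 p.2].
pose P (Mt : {set V * V}) := (Mt \subset [set p | ok p]) &&
  [forall p in Mt, forall q in Mt, (p != q) ==> (p.1 != q.1) && (p.2 != q.2)].
have P0 : P set0 by rewrite /P sub0set; apply/forallP=> p; rewrite inE.
case: (@arg_maxnP _ set0 P (fun Mt : {set V * V} => #|Mt|) P0) => Mt PMt Mtmax.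
case/andP: (PMt) => Mtok Mtinj.
have okP p : p \in Mt -> ok p by move/(subsetP Mtok); rewrite inE.
have inj p q : p \in Mt -> q \in Mt -> p != q -> (p.1 != q.1) && (p.2 != q.2).
  by move=> pM qM; move/forall_inP/(_ p pM)/forall_inP/(_ q qM)/implyP: Mtinj.
have inj1 : {in Mt &, injective (@fst V V)}.
  move=> p q pM qM e; apply/eqP/negPn/negP=> /(inj _ _ pM qM).
  by rewrite e eqxx.
have inj2 : {in Mt &, injective (@snd V V)}.
  move=> p q pM qM e; apply/eqP/negPn/negP=> /(inj _ _ pM qM).
  by rewrite e eqxx andbF.
pose S1 := [set p.1 | p in Mt]; pose A1 := [set p.2 | p in Mt].
have S1S : S1 \subset S by apply/subsetP=> _ /imsetP[p /okP/and3P[h _ _] ->].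
have A1A : A1 \subset A by apply/subsetP=> _ /imsetP[p /okP/and3P[_ h _] ->].
have maxi b c : b \in S -> c \in A -> conn E b c -> (b \in S1) || (c \in A1).
  move=> bS cA bc; apply/norP=> -[nb nc].
  have nM : (b, c) \notin Mt by apply: contra nb => h; apply/imsetP; exists (b, c).
  have nb' p : p \in Mt -> b != p.1.
    by move=> pM; apply: contra nb => /eqP ->; apply: imset_f.
  have nc' p : p \in Mt -> c != p.2.
    by move=> pM; apply: contra nc => /eqP ->; apply: (imset_f snd).
  suff /Mtmax : P ((b, c) |: Mt) by rewrite /= cardsU1 nM add1n ltnn.
  rewrite /P; apply/andP; split.
    by rewrite subUset Mtok sub1set inE /ok /= bS cA bc.
  apply/forall_inP=> p; rewrite in_setU1 => /orP[/eqP -> /=|pM];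
    apply/forall_inP=> q; rewrite in_setU1 => /orP[/eqP -> /=|qM]; apply/implyP.
  - by rewrite eqxx.
  - by rewrite nb' ?nc'.
  - by rewrite (eq_sym p.1) (eq_sym p.2) nb' ?nc'.
  - exact: inj.
case: (AS a aA) => b bS ba.
have [p0 p0M] : exists p, p \in Mt.
  by case/orP: (maxi b a bS aA ba) => /imsetP[p pM _]; exists p.
case ME : (enum Mt) p0M => [|[b0 a0] ps]; first by rewrite -mem_enum ME.
move=> _; have psM p : p \in (b0, a0) :: ps -> p \in Mt by rewrite -ME mem_enum.
have p0M : (b0, a0) \in Mt by apply: psM; rewrite inE eqxx.
pose U := enum (A :\: A1); pose W := enum (S :\: S1).
pose al := last a0 (map snd ps).
(* [(al, b0)] closes the chain of matched pairs to a cycle. The shorter of [U] and [W] is padded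
   with [a0] or [b0], which lie on this cycle. *)
pose L := (al, b0) :: links a0 ps ++
  mkseq (fun i => (nth a0 U i, nth b0 W i)) (maxn (size U) (size W)).
pose M := [set e in L]; exists M.
have a0A : a0 \in A by case/okP/and3P: p0M.
have b0S : b0 \in S by case/okP/and3P: p0M.
have alA : al \in A.
  have : al \in a0 :: map snd ps by apply: mem_last.
  rewrite inE => /orP[/eqP -> //|/mapP[p pps ->]].
  by have /psM/okP/and3P[] : p \in (b0, a0) :: ps by rewrite inE pps orbT.
have LP e : e \in L -> conn (E :|: M) e.1 e.2.
  by move=> eL; apply: conn_edge; rewrite -surjective_pairing inE [e \in M]inE eL orbT.
have EF := connS (subsetUl E M).
split.
- apply/subsetP=> e; rewrite inE inE => /orP[/eqP -> /=|]; first by rewrite inE alA.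
  rewrite mem_cat => /orP[/links_sub[h1 h2]|/mapP[i _ -> /=]].
    rewrite inE; apply/andP; split.
      move: h1; rewrite inE => /orP[/eqP -> //|/mapP[p pps ->]].
      by have /psM/okP/and3P[] : p \in (b0, a0) :: ps by rewrite inE pps orbT.
    case/mapP: h2 => p pps ->.
    by have /psM/okP/and3P[] : p \in (b0, a0) :: ps by rewrite inE pps orbT.
  rewrite inE /=; apply/andP; split.
    have [lt|ge] := ltnP i (size U); last by rewrite nth_default.
    by have := mem_nth a0 lt; rewrite mem_enum inE => /andP[].
  have [lt|ge] := ltnP i (size W); last by rewrite nth_default.
  by have := mem_nth b0 lt; rewrite mem_enum inE => /andP[].
- by apply/set0Pn; exists (al, b0); rewrite inE inE eqxx.
- have le : #|M| <= size L by rewrite cardsE card_size.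
  apply: leq_trans le _; rewrite /= size_cat size_links size_mkseq.
  have cU : #|A| = #|Mt| + size U.
    by rewrite -cardE cardsD (setIidPr A1A) (card_in_imset inj2) subnKC // -(card_in_imset inj2) subset_leq_card.
  have cW : #|S| = #|Mt| + size W.
    by rewrite -cardE cardsD (setIidPr S1S) (card_in_imset inj1) subnKC // -(card_in_imset inj1) subset_leq_card.
  (* The closing edge and the links together are as many as the matched pairs. *)
  have cM : #|Mt| = (size ps).+1 by rewrite cardE ME.
  by rewrite cU cW cM -addn_maxr addSn.
have Eps p : p \in ps -> conn (E :|: M) p.1 p.2.
  move=> pps; have /psM/okP/and3P[_ _ h] : p \in (b0, a0) :: ps by rewrite inE pps orbT.
  exact: EF.
case: (@links_conn (E :|: M) a0 ps) => [e el|p pps|h1 h2].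
- by apply: LP; rewrite inE mem_cat el orbT.
- exact: Eps.
have alb0 : conn (E :|: M) al b0 by apply: (LP (al, b0)); rewrite inE eqxx.
have b0a0 : conn (E :|: M) b0 a0 by apply: EF; case/okP/and3P: p0M.
have hub p : p \in Mt -> conn (E :|: M) b0 p.1 /\ conn (E :|: M) p.2 b0.
  rewrite -mem_enum ME inE => /orP[/eqP -> /=|/h2[k1 k2]].
    by split; [apply: connect0 | apply: connect_trans h1 alb0].
  by split; [apply: connect_trans b0a0 k1 | apply: connect_trans k2 alb0].
have hubA1 c : c \in A1 -> conn (E :|: M) c b0 by case/imsetP=> p /hub[_ h] ->.
have hubS1 c : c \in S1 -> conn (E :|: M) b0 c by case/imsetP=> p /hub[h _] ->.
(* By maximality of [Mt], an unmatched source reaches only matched sinks. *)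
have toS c : c \in S -> conn (E :|: M) c b0.
  move=> cS; case: (boolP (c \in S1)) => [/imsetP[p pM ->]|nc].
    case: (hub _ pM) => _; apply: connect_trans; apply: EF.
    by case/okP/and3P: pM.
  case: (SA c cS) => d dA cd; have := maxi _ _ cS dA cd; rewrite (negPf nc) /=.
  by move/hubA1; apply: connect_trans; apply: EF.
have ofA c : c \in A -> conn (E :|: M) b0 c.
  move=> cA; case: (boolP (c \in A1)) => [/imsetP[p pM ->]|nc].
    case: (hub _ pM) => h _; apply: connect_trans h _; apply: EF.
    by case/okP/and3P: pM.
  case: (AS c cA) => d dS dc; have := maxi _ _ dS cA dc; rewrite (negPf nc) orbF.
  by move/hubS1/connect_trans; apply; apply: EF.
have toA c : c \in A -> conn (E :|: M) c b0.
  move=> cA; case: (boolP (c \in A1)) => [/hubA1 //|nc].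
  have cU : c \in U by rewrite mem_enum inE nc cA.
  have lt : index c U < size U by rewrite index_mem.
  have : (c, nth b0 W (index c U)) \in L.
    rewrite inE mem_cat; apply/orP; right; apply/orP; right; apply/mapP.
    exists (index c U); first by rewrite mem_iota /= add0n leq_max lt.
    by rewrite nth_index.
  move/LP => /= h; apply: connect_trans h _.
  have [lt'|ge] := ltnP (index c U) (size W); last by rewrite nth_default.
  by have := mem_nth b0 lt'; rewrite mem_enum inE => /andP[_ /toS].
have ofS c : c \in S -> conn (E :|: M) b0 c.
  move=> cS; case: (boolP (c \in S1)) => [/hubS1 //|nc].
  have cW : c \in W by rewrite mem_enum inE nc cS.
  have lt : index c W < size W by rewrite index_mem.
  have : (nth a0 U (index c W), c) \in L.
    rewrite inE mem_cat; apply/orP; right; apply/orP; right; apply/mapP.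
    exists (index c W); first by rewrite mem_iota /= add0n leq_max lt orbT.
    by rewrite [in RHS]nth_index.
  move/LP => /= h; apply: connect_trans h.
  have [lt'|ge] := ltnP (index c W) (size U); last by rewrite nth_default.
  by have := mem_nth a0 lt'; rewrite mem_enum inE => /andP[_ /ofA].
move=> x y; rewrite !inE => hx hy; apply: (@connect_trans _ _ b0).
  by case/orP: hx => [/toA|/toS].
by case/orP: hy => [/ofA|/ofS].
Qed.

End EswaranTarjan.

(** * Counting the pairs connected by a core *)

Section Bulk.
Variable V : finType.
Implicit Types (E F M : {set V * V}).

(* Attached to a core, [Z] goes into the core, the sinks [T] below the core and
   the sources [S] above it get joined to the core. *)
Definition bulk_pairs F t0 (Z T S : {set V}) : {set V * V} :=
  reach_set F :|: setX (anc F t0 :|: Z :|: T) (des F t0 :|: Z :|: S).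

Definition loose F : {set V} := [set v | isolated F v].
Definition low F t0 : {set V} := [set v | sink F v && conn F t0 v].
Definition high F t0 : {set V} := [set v | source F v && conn F v t0].

(** Inclusion and exclusion. Attached tails are sinks and attached heads are sources, so a pair of
    the rectangle that [F] already connects is in the old rectangle [anc] times [des] or on the
    diagonal of the attached vertices. The additive form avoids truncated subtraction. *)
Lemma card_bulk F t0 (Z T S : {set V}) : ~~ sink F t0 -> ~~ source F t0 ->
  Z \subset loose F -> T \subset low F t0 -> S \subset high F t0 ->
  #|bulk_pairs F t0 Z T S| + (#|anc F t0| * #|des F t0| + (#|Z| + #|T| + #|S|)) =
  reach_count F + (#|anc F t0| + #|Z| + #|T|) * (#|des F t0| + #|Z| + #|S|).
Proof.
move=> nsi nso ZF TF SF.
have ZP z : z \in Z -> sink F z /\ source F z.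
  by move/(subsetP ZF); rewrite inE => /andP[].
have TP t : t \in T -> sink F t /\ conn F t0 t.
  by move/(subsetP TF); rewrite inE => /andP[].
have SP s : s \in S -> source F s /\ conn F s t0.
  by move/(subsetP SF); rewrite inE => /andP[].
have sinkN x : sink F x -> conn F x t0 -> False.
  by move=> sx h; have xE := sink_conn sx h; rewrite xE sx in nsi.
have sourceN x : source F x -> conn F t0 x -> False.
  by move=> sx h; have xE := source_conn sx h; rewrite xE sx in nso.
have cI : #|anc F t0 :|: Z :|: T| = #|anc F t0| + #|Z| + #|T|.
  rewrite cardsU_disjoint ?cardsU_disjoint // => x; rewrite !inE.
    by move=> h /ZP[/sinkN].
  move=> /orP[h|/ZP[_ so]] /TP[si h']; first exact: sinkN si h.
  exact: sourceN so h'.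
have cO : #|des F t0 :|: Z :|: S| = #|des F t0| + #|Z| + #|S|.
  rewrite cardsU_disjoint ?cardsU_disjoint // => x; rewrite !inE.
    by move=> h /ZP[_ /sourceN].
  move=> /orP[h|/ZP[si _]] /SP[so h']; first exact: sourceN so h.
  exact: sinkN si h'.
pose D := Z :|: T :|: S.
have cD : #|D| = #|Z| + #|T| + #|S|.
  rewrite cardsU_disjoint ?cardsU_disjoint // => x; rewrite ?inE.
    by move=> /ZP[_ so] /TP[_ /(sourceN _ so)].
  by move=> /orP[/ZP[si _]|/TP[si _]] /SP[_ /(sinkN _ si)].
pose DD := [set (x, x) | x in D].
have cDD : #|DD| = #|D| by apply: card_imset => x y [].
have iE : reach_set F :&: setX (anc F t0 :|: Z :|: T) (des F t0 :|: Z :|: S) =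
   setX (anc F t0) (des F t0) :|: DD.
  apply/setP=> -[u v]; rewrite !inE /=; apply/idP/idP.
    case/and3P=> uv hu hv; apply/orP.
    have [uE|ne] := eqVneq u v.
      rewrite -uE in hv *.
      have [uD|] := boolP (u \in D); first by right; apply/imsetP; exists u.
      rewrite !inE => /norP[/norP[nz nt] ns]; left.
      by move: hu hv; rewrite (negPf nz) (negPf nt) (negPf ns) !orbF => -> ->.
    left; apply/andP; split.
      case/orP: hu => [/orP[//|/ZP[si _]]|/TP[si _]];
        by rewrite (sink_conn si uv) eqxx in ne.
    case/orP: hv => [/orP[//|/ZP[_ si]]|/SP[si _]];
        by rewrite (source_conn si uv) eqxx in ne.
  case/orP=> [/andP[h1 h2]|/imsetP[x xD [-> ->]]].
    by rewrite h1 h2 (connect_trans h1 h2).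
  rewrite connect0; move: xD; rewrite !inE => /orP[/orP[xZ|xT]|xS].
  - by rewrite xZ !orbT.
  - by case: (TP _ xT) => _ ->; rewrite xT !orbT.
  - by case: (SP _ xS) => _ ->; rewrite xS !orbT.
have cIE : #|setX (anc F t0) (des F t0) :|: DD| = #|anc F t0| * #|des F t0| + #|D|.
  rewrite cardsU_disjoint ?cardsX ?cDD // => -[u v]; rewrite !inE /= => /andP[h1 h2].
  case/imsetP=> x xD [uE vE]; move: h1 h2 xD; rewrite uE vE !inE => h1 h2.
  case/orP=> [/orP[/ZP[si _]|/TP[si _]]|/SP[so _]].
  - exact: sinkN si h1.
  - exact: sinkN si h1.
  - exact: sourceN so h2.
by rewrite -cD -cIE -iE /bulk_pairs cardsUI cardsX cI cO reach_countE.
Qed.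

Lemma subset_between (A0 A : {set V}) k : A0 \subset A -> #|A0| <= k -> k <= #|A| ->
  exists A1 : {set V}, [/\ A0 \subset A1, A1 \subset A & #|A1| = k].
Proof.
move=> sA; elim: k => [|k IH].
  by rewrite leqn0 cards_eq0 => /eqP -> _; exists set0; rewrite cards0 !sub0set.
rewrite leq_eqVlt ltnS => /orP[/eqP e _|h lt]; first by exists A0.
case: (IH h (ltnW lt)) => A1 [h1 h2 h3].
have /properP[_ [x xA nx]] : A1 \proper A by rewrite properEcard h2 h3.
exists (x |: A1); rewrite cardsU1 nx h3; split=> //.
  by apply: subset_trans h1 (subsetUr _ _).
by rewrite subUset sub1set xA.
Qed.

Lemma twin_representatives E (A : {set V}) : exists A0 : {set V},
  [/\ A0 \subset A, #|A0| <= ntwins E & forall x, x \in A -> exists2 y, y \in A0 & twin E y x].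
Proof.
pose r x := odflt x [pick y in A | twin E y x].
have rP x : x \in A -> (r x \in A) && twin E (r x) x.
  by move=> xA; rewrite /r; case: pickP => [//|/(_ x)]; rewrite /= xA twin_refl.
exists (r @: A); split.
- by apply/subsetP=> _ /imsetP[x /rP/andP[h _] ->].
- rewrite -(@card_in_imset _ _ (twins E)).
    by apply/subset_leq_card/subsetP=> _ /imsetP[x _ ->]; apply: imset_f.
  move=> _ _ /imsetP[x xA ->] /imsetP[y yA ->] /twinsP h.
  have /andP[_ h1] := rP _ xA; have /andP[_ h2] := rP _ yA.
  have xy : twin E x y.
    by apply: twin_trans (twin_trans h h2); rewrite twin_sym.
  (* [pick] depends only on the predicate, so twins receive the same representative. *)
  rewrite /r; have eqP : [pred z in A | twin E z x] =1 [pred z in A | twin E z y].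
    move=> z /=; congr (_ && _); apply/idP/idP => h3; apply: twin_trans h3 _ => //.
    by rewrite twin_sym.
  rewrite (eq_pick eqP); case: pickP => [//|/(_ y)].
  by rewrite /= yA twin_refl.
move=> x xA; exists (r x); first exact: imset_f.
by case/andP: (rP _ xA).
Qed.

(** Both sides are padded to the common size [j] where possible. This makes the two maxima add up,
    so that core and bulk share one budget; unpadded sets of representatives would exceed it when
    the sides are unbalanced in opposite ways. *)
Lemma balanced_representatives E (A C : {set V}) : exists A0 C0 : {set V},
  [/\ A0 \subset A /\ C0 \subset C, #|A0| <= ntwins E /\ #|C0| <= ntwins E,
   forall x, x \in A -> exists2 y, y \in A0 & twin E y x,
   forall x, x \in C -> exists2 y, y \in C0 & twin E y x &
   maxn #|A0| #|C0| + maxn #|A :\: A0| #|C :\: C0| = maxn #|A| #|C|].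
Proof.
case: (twin_representatives E A) => A1 [A1s A1c A1r].
case: (twin_representatives E C) => C1 [C1s C1c C1r].
pose j := maxn #|A1| #|C1|.
have jq : j <= ntwins E by rewrite geq_max A1c.
have hA : #|A1| <= minn j #|A| by rewrite leq_min leq_maxl subset_leq_card.
have hC : #|C1| <= minn j #|C| by rewrite leq_min leq_maxr subset_leq_card.
case: (subset_between A1s hA (geq_minr _ _)) => A0 [sA1 sA cA].
case: (subset_between C1s hC (geq_minr _ _)) => C0 [sC1 sC cC].
exists A0, C0; split; rewrite ?cA ?cC.
- by [].
- by split; apply: leq_trans (geq_minl _ _) jq.
- by move=> x /A1r[y yA xy]; exists y => //; apply: (subsetP sA1).
- by move=> x /C1r[y yA xy]; exists y => //; apply: (subsetP sC1).
rewrite !cardsD (setIidPr sA) (setIidPr sC) cA cC.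
have : j <= maxn #|A| #|C|.
  rewrite /j geq_max !leq_max.
  by rewrite (subset_leq_card A1s) (subset_leq_card C1s) orbT.
by move: (j) #|A| #|C|; clear; lia.
Qed.

End Bulk.

Section Core.
Variable V : finType.
Variables (E : {set V * V}) (B : nat) (N : {set V * V}).
Hypotheses (dE : dag E) (exN : extremal E B N).
Local Notation H := (E :|: N).
Implicit Types (u v t s : V).

Definition cyc_edges : {set V * V} := [set e in N | cyclic E N e].
Definition cyc_tails : {set V} := [set e.1 | e in cyc_edges].
Definition cyc_heads : {set V} := [set e.2 | e in cyc_edges].
Local Notation F := (E :|: acy E N).

Lemma splitN : H = F :|: cyc_edges.
Proof.
by apply/setP=> e; rewrite !inE; case: (e \in E); case: (e \in N); case: cyclic.
Qed.

Lemma cyc_tailP t : reflect (exists2 s, (t, s) \in N & conn H s t) (t \in cyc_tails).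
Proof.
apply: (iffP imsetP) => [[[a b]]|[s tsN st]].
  by rewrite inE /cyclic /= => /andP[abN c] ->; exists b.
by exists (t, s); rewrite // inE tsN.
Qed.

Lemma cyc_headP s : reflect (exists2 t, (t, s) \in N & conn H s t) (s \in cyc_heads).
Proof.
apply: (iffP imsetP) => [[[a b]]|[t tsN st]].
  by rewrite inE /cyclic /= => /andP[abN c] ->; exists a.
by exists (t, s); rewrite // inE tsN.
Qed.

Lemma cyc_tail_sink t : t \in cyc_tails -> sink E t.
Proof. by case/cyc_tailP=> s /(exss exN)/andP[]. Qed.

Lemma cyc_head_source t : t \in cyc_heads -> source E t.
Proof. by case/cyc_headP=> s /(exss exN)/andP[]. Qed.

(** An acyclic edge leaving [t] would be its only edge. One entering [t] has a trivial head, whereas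
    [t] lies on a cycle; the remaining case of a loop at [t] is excluded by [acy_head]. *)
Lemma cyc_tail_acy t : t \in cyc_tails -> sink (acy E N) t /\ source (acy E N) t.
Proof.
case/cyc_tailP=> s tsN st; split; apply/forallP=> p; rewrite inE.
  apply/negP=> /andP[tpN c]; move: (c); rewrite /cyclic /=.
  by rewrite -(acy_tail dE exN tpN c tsN) st.
apply/negP=> /andP[ptN c].
have ts : conn H t s by apply: conn_edge; rewrite inE tsN orbT.
have sE : s = t := acy_triv2 dE exN ptN c ts st.
move: tsN; rewrite sE => ttN; move: (c); rewrite /cyclic /=.
by rewrite -(acy_head dE exN ptN c ttN) connect0.
Qed.

Lemma cyc_head_acy t : t \in cyc_heads -> sink (acy E N) t /\ source (acy E N) t.
Proof.
case/cyc_headP=> s tsN st; split; apply/forallP=> p; rewrite inE.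
  apply/negP=> /andP[ptN c].
  have ts : conn H s t by apply: conn_edge; rewrite inE tsN orbT.
  have sE : s = t := acy_triv1 dE exN ptN c st ts.
  move: tsN; rewrite sE => ttN; move: (c); rewrite /cyclic /=.
  by rewrite -(acy_tail dE exN ptN c ttN) connect0.
apply/negP=> /andP[ptN c]; move: (c); rewrite /cyclic /=.
by rewrite -(acy_head dE exN ptN c tsN) st.
Qed.

(** A cycle through [z] both enters and leaves it by added edges. *)
Lemma isolated_tail_head z : isolated E z -> (z \in cyc_tails) = (z \in cyc_heads).
Proof.
case/andP=> si so; apply/cyc_tailP/cyc_headP => [[s zsN sz]|[t tzN zt]].
  have [sE|ne] := eqVneq s z; first by exists z; [rewrite -{2}sE | apply: connect0].
  case: (conn_lastE sz ne) => p sp; rewrite inE (negPf (forallP so p)) /= => pz.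
  exists p => //; apply: connect_trans sp; apply: conn_edge.
  by rewrite inE zsN orbT.
have [sE|ne] := eqVneq z t; first by exists z; [rewrite {1}sE | apply: connect0].
case: (conn_firstE zt ne) => p; rewrite inE (negPf (forallP si p)) /= => zp pt.
exists p => //; apply: connect_trans pt _; apply: conn_edge.
by rewrite inE tzN orbT.
Qed.

(** Follow the cycle from [s] to its next added edge. The tail found there is not isolated, since a
    source below [s] can only be [s]. *)
Lemma head_to_tail s : s \in cyc_heads -> ~~ isolated E s ->
  exists2 t, t \in cyc_tails :\: loose E & conn E s t.
Proof.
move=> sC ni; have so := cyc_head_source sC.
have fin t : conn E s t -> t \in cyc_tails -> t \in cyc_tails :\: loose E.
  move=> st tC; rewrite !inE tC andbT; apply: contra ni => /andP[_ so'].
  by rewrite (source_conn so' st) /isolated so' (cyc_tail_sink tC).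
case/cyc_headP: (sC) => y ysN sy.
case: (conn_first sy) => [h|[[t1 s1] eN /= /andP[h1 h2]]].
  by exists y => //; apply: fin => //; apply/cyc_tailP; exists s.
exists t1 => //; apply: fin => //; apply/cyc_tailP; exists s1 => //.
apply: connect_trans h2 (connect_trans (conn_edge _) (connS (subsetUl _ _) h1)).
by rewrite inE ysN orbT.
Qed.

Lemma tail_from_head t : t \in cyc_tails -> ~~ isolated E t ->
  exists2 s, s \in cyc_heads :\: loose E & conn E s t.
Proof.
move=> sC ni; have so := cyc_tail_sink sC.
have fin s : conn E s t -> s \in cyc_heads -> s \in cyc_heads :\: loose E.
  move=> st tC; rewrite !inE tC andbT; apply: contra ni => /andP[so' _].
  by rewrite (sink_conn so' st) /isolated so' (cyc_head_source tC).
case/cyc_tailP: (sC) => y ysN sy.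
case: (conn_last sy) => [h|[[t1 s1] eN /= /andP[h1 h2]]].
  by exists y => //; apply: fin => //; apply/cyc_headP; exists t.
exists s1 => //; apply: fin => //; apply/cyc_headP; exists t1 => //.
apply: connect_trans (connS (subsetUl _ _) h2) (connect_trans (conn_edge _) h1).
by rewrite inE ysN orbT.
Qed.

End Core.

Section CoreSeed.
Variable V : finType.
Variables (E : {set V * V}) (B : nat) (N : {set V * V}).
Hypotheses (dE : dag E) (exN : extremal E B N).
Local Notation H := (E :|: N).
Implicit Types (u v t s : V).
(** [A0] and [C0] are the tails and heads of cyclic edges kept in the core, which [M] makes strongly
    connected. The others are isolated ([Zb]), or tails ([Tb]) and heads ([Sb]) with a twin in the
    core. *)
Variables (A0 C0 Zb Tb Sb : {set V}) (M : {set V * V}) (t0 s0 : V).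
Local Notation tails := (cyc_tails E N).
Local Notation heads := (cyc_heads E N).
Hypotheses (A0s : A0 \subset tails) (C0s : C0 \subset heads).
Hypotheses (Ms : M \subset setX A0 C0) (M0 : (t0, s0) \in M).
Hypothesis Mstrong : forall x y, x \in A0 :|: C0 -> y \in A0 :|: C0 -> conn (E :|: M) x y.
Hypotheses (tailsS : tails \subset A0 :|: Zb :|: Tb) (headsS : heads \subset C0 :|: Zb :|: Sb).
Hypothesis ZbP : forall z, z \in Zb ->
  [/\ z \in tails, z \in heads, isolated E z, z \notin A0 & z \notin C0].
Hypothesis TbP : forall t, t \in Tb ->
  [/\ t \in tails, ~~ isolated E t, t \notin A0 & exists2 y, y \in A0 & twin E y t].
Hypothesis SbP : forall s, s \in Sb ->
  [/\ s \in heads, ~~ isolated E s, s \notin C0 & exists2 y, y \in C0 & twin E y s].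

Local Notation N0 := (acy E N :|: M).
Local Notation H0 := (E :|: N0).
Local Notation F := (E :|: acy E N).

Let t0A : t0 \in A0. Proof. by have := subsetP Ms _ M0; rewrite inE => /andP[]. Qed.
Let s0C : s0 \in C0. Proof. by have := subsetP Ms _ M0; rewrite inE => /andP[]. Qed.

Lemma seed_ss : N0 \subset ss E.
Proof.
rewrite subUset; apply/andP; split; apply/subsetP=> e.
  by rewrite inE => /andP[/(exss exN) h _]; rewrite inE.
move/(subsetP Ms); rewrite !inE => /andP[/(subsetP A0s) h1 /(subsetP C0s) h2].
by rewrite (cyc_tail_sink exN h1) (cyc_head_source exN h2).
Qed.

Let strong x y : x \in A0 :|: C0 -> y \in A0 :|: C0 -> conn H0 x y.
Proof.
move=> hx hy; apply: connS (Mstrong hx hy).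
by apply: setUS; apply: subsetUr.
Qed.

Let acy_ss : acy E N \subset ss E.
Proof. by apply: subset_trans seed_ss; apply: subsetUl. Qed.

Let FH0 u v : conn F u v -> conn H0 u v.
Proof. by apply: connS; apply: setUS; apply: subsetUl. Qed.

Lemma seed_conn : conn H0 s0 t0.
Proof. by apply: strong; rewrite inE ?t0A ?s0C ?orbT. Qed.

Lemma seed_edge : (t0, s0) \in H0.
Proof. by rewrite !in_setU M0 !orbT. Qed.

Lemma seed_not_sink : ~~ sink H0 t0.
Proof. by apply/negP=> /forallP/(_ s0); rewrite seed_edge. Qed.

Lemma seed_not_source : ~~ source H0 t0.
Proof.
apply/negP=> /forallP h; have [e|ne] := eqVneq s0 t0.
  by have := h t0; rewrite -{2}e seed_edge.
by case: (conn_lastE seed_conn ne) => p _; rewrite (negPf (h p)).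
Qed.

Let sinkH0 t : t \in tails -> t \notin A0 -> sink H0 t.
Proof.
move=> tt tA; apply/forallP=> p; rewrite !in_setU !negb_or.
rewrite (forallP (cyc_tail_sink exN tt) p).
case: (cyc_tail_acy dE exN tt) => /forallP/(_ p) -> _ /=.
by apply: contra tA => /(subsetP Ms); rewrite inE => /andP[].
Qed.

Let sourceH0 t : t \in heads -> t \notin C0 -> source H0 t.
Proof.
move=> tt tA; apply/forallP=> p; rewrite !in_setU !negb_or.
rewrite (forallP (cyc_head_source exN tt) p).
case: (cyc_head_acy dE exN tt) => _ /forallP/(_ p) -> /=.
by apply: contra tA => /(subsetP Ms); rewrite inE => /andP[].
Qed.

Let tail_ns t : t \in tails -> ~~ isolated E t -> ~~ source E t.
Proof. by move=> tt; rewrite /isolated (cyc_tail_sink exN tt). Qed.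

Let head_ns t : t \in heads -> ~~ isolated E t -> ~~ sink E t.
Proof. by move=> tt; rewrite /isolated (cyc_head_source exN tt) andbT. Qed.

Lemma seed_loose : Zb \subset loose H0.
Proof.
apply/subsetP=> z /ZbP[zt zh _ zA zC].
by rewrite inE /isolated sinkH0 ?sourceH0.
Qed.

Lemma seed_low : Tb \subset low H0 t0.
Proof.
apply/subsetP=> t /TbP[tt ni tA [y yA yt]]; rewrite inE sinkH0 //=.
have nsy : ~~ source E y by rewrite (twin_source yt) tail_ns.
have ne : s0 != y.
  by apply: contra nsy => /eqP <-; apply: (cyc_head_source exN (subsetP C0s _ s0C)).
have s0y : conn H0 s0 y by apply: strong; rewrite inE ?yA ?s0C ?orbT.
apply: connect_trans (conn_edge seed_edge) _.
exact: (anc_twin seed_ss yt nsy s0y ne).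
Qed.

Lemma seed_high : Sb \subset high H0 t0.
Proof.
apply/subsetP=> t /SbP[tt ni tA [y yA yt]]; rewrite inE sourceH0 //=.
have nsy : ~~ sink E y by rewrite (twin_sink yt) head_ns.
have ne : t0 != y.
  by apply: contra nsy => /eqP <-; apply: (cyc_tail_sink exN (subsetP A0s _ t0A)).
have s0y : conn H0 y t0 by apply: strong; rewrite inE ?yA ?t0A ?orbT.
exact: (des_twin seed_ss yt nsy s0y ne).
Qed.

(** A tail outside the core is isolated in [F], with nothing else above it, or shares its strict
    ancestors with a twin in [A0]. *)
Let toward u t : t \in tails -> conn F u t -> u \in anc H0 t0 :|: Zb :|: Tb.
Proof.
move=> tt ut; have := subsetP tailsS _ tt; rewrite !in_setU => /orP[/orP[tA|tZ]|tT].
- rewrite inE (connect_trans (FH0 ut)) //.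
  by apply: strong; rewrite inE ?tA ?t0A ?orbT.
- case: (ZbP tZ) => _ _ /andP[_ so] _ _; case: (cyc_tail_acy dE exN tt) => _ so'.
  have soF : source F t.
    by apply/forallP=> p; rewrite in_setU negb_or (forallP so p) (forallP so' p).
  by rewrite (source_conn soF ut) tZ orbT.
have [-> |ne] := eqVneq u t; first by rewrite tT orbT.
case: (TbP tT) => _ ni _ [y yA yt]; rewrite twin_sym in yt.
have := anc_twin acy_ss yt (tail_ns tt ni) ut ne => /FH0 uy.
rewrite inE (connect_trans uy) //.
by apply: strong; rewrite inE ?yA ?t0A ?orbT.
Qed.

Let onward v s : s \in heads -> conn F s v -> v \in des H0 t0 :|: Zb :|: Sb.
Proof.
move=> tt ut; have := subsetP headsS _ tt; rewrite !in_setU => /orP[/orP[tA|tZ]|tT].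
- rewrite inE (connect_trans _ (FH0 ut)) //.
  by apply: strong; rewrite inE ?tA ?t0A ?orbT.
- case: (ZbP tZ) => _ _ /andP[so _] _ _; case: (cyc_head_acy dE exN tt) => so' _.
  have soF : sink F s.
    by apply/forallP=> p; rewrite in_setU negb_or (forallP so p) (forallP so' p).
  by rewrite (sink_conn soF ut) tZ orbT.
have [-> |ne] := eqVneq v s; first by rewrite tT orbT.
case: (SbP tT) => _ ni _ [y yA yt]; rewrite twin_sym in yt.
have := des_twin acy_ss yt (head_ns tt ni) ut ne => /FH0 uy.
rewrite inE (connect_trans _ uy) //.
by apply: strong; rewrite inE ?yA ?t0A ?orbT.
Qed.

(** Before its first and after its last cyclic edge, a path stays in [F]. *)
Lemma seed_pairs : reach_count H <= #|bulk_pairs H0 t0 Zb Tb Sb|.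
Proof.
rewrite reach_countE; apply/subset_leq_card/subsetP=> -[u v].
rewrite inE /= splitN => uv; rewrite in_setU inE /=.
case: (conn_first uv) => [/FH0 -> //|[e eC /andP[h1 _]]].
case: (conn_last uv) => [/FH0 -> //|[e' eC' /andP[_ h2]]].
apply/orP; right; rewrite inE /= (toward _ h1) ?(onward _ h2) //; exact: imset_f.
Qed.

End CoreSeed.

Section CorePlan.
Variable V : finType.
Implicit Types (E N : {set V * V}).

(* A core plan consists of few edges [N0] with a cycle through the edge
   [(t0, s0)], and of the numbers [z], [t] and [s] of isolated vertices, sinks
   and sources to be joined to the core by further edges.  By [card_bulk] the
   number of connected pairs only depends on these numbers. *)
Definition core_plan E B N0 t0 s0 z t s w : Prop :=
  let H0 := E :|: N0 in
  [/\ N0 \subset ss E, (t0, s0) \in N0 /\ conn H0 s0 t0,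
      #|N0| + z + maxn t s <= B,
      [/\ z <= #|loose H0|, t <= #|low H0 t0| & s <= #|high H0 t0|] &
      w + (#|anc H0 t0| * #|des H0 t0| + (z + t + s)) <=
      reach_count H0 + (#|anc H0 t0| + z + t) * (#|des H0 t0| + z + s)].

Lemma core_plan_exists E B N : dag E -> extremal E B N ->
  #|acy E N| < #|N| -> exists N0 t0 s0 z t s,
    core_plan E B N0 t0 s0 z t s (reach_count (E :|: N)) /\
    #|N0| <= ntwins E ^ 2 + 4 + (ntwins E).+1.
Proof.
move=> dE exN nacy.
pose Nc := cyc_edges E N; pose TC := cyc_tails E N; pose SC := cyc_heads E N.
have NB : #|N| <= B by case: exN.
have cN : #|N| = #|acy E N| + #|Nc|.
  rewrite -cardsU_disjoint; last by move=> e; rewrite !inE => /andP[_ /negPf ->]; rewrite andbF.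
  by apply: eq_card => e; rewrite !inE; case: (e \in N); case: cyclic.
have acB := acy_bound dE exN.
have cTC : #|TC| <= #|Nc| by apply: leq_imset_card.
have cSC : #|SC| <= #|Nc| by apply: leq_imset_card.
have fin (A0 C0 Zb Tb Sb : {set V}) (M : {set V * V}) t0 s0 :
    A0 \subset TC -> C0 \subset SC -> M \subset setX A0 C0 -> (t0, s0) \in M ->
    (forall x y, x \in A0 :|: C0 -> y \in A0 :|: C0 -> conn (E :|: M) x y) ->
    TC \subset A0 :|: Zb :|: Tb -> SC \subset C0 :|: Zb :|: Sb ->
    (forall z, z \in Zb -> [/\ z \in TC, z \in SC, isolated E z, z \notin A0 & z \notin C0]) ->
    (forall t, t \in Tb -> [/\ t \in TC, ~~ isolated E t, t \notin A0 & exists2 y, y \in A0 & twin E y t]) ->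
    (forall s, s \in Sb -> [/\ s \in SC, ~~ isolated E s, s \notin C0 & exists2 y, y \in C0 & twin E y s]) ->
    #|M| <= (ntwins E).+1 -> #|M| + #|Zb| + maxn #|Tb| #|Sb| <= #|Nc| ->
    exists N0 t0 s0 z t s, core_plan E B N0 t0 s0 z t s (reach_count (E :|: N)) /\
    #|N0| <= ntwins E ^ 2 + 4 + (ntwins E).+1.
  move=> h1 h2 h3 h4 h5 h6 h7 h8 h9 h10 h11 h12.
  have lo := seed_loose dE exN h3 h8.
  have hT := seed_low dE exN h1 h2 h3 h4 h5 h9.
  have hS := seed_high dE exN h1 h2 h3 h4 h5 h10.
  exists (acy E N :|: M), t0, s0, #|Zb|, #|Tb|, #|Sb|; split; last first.
    by apply: leq_trans (leq_card_setU _ _) _; apply: leq_add.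
  split.
  - exact: (seed_ss exN h1 h2 h3).
  - by split; [rewrite in_setU h4 orbT | apply: (seed_conn N h3 h4 h5)].
  - apply: leq_trans NB; rewrite cN -addnA.
    apply: leq_trans (leq_add (leq_card_setU _ _) (leqnn _)) _.
    by rewrite -addnA leq_add2l addnA.
  - by split; apply: subset_leq_card.
  rewrite -card_bulk ?leq_add2r //.
  - exact: (seed_pairs dE exN h1 h2 h3 h4 h5 h6 h7 h8 h9 h10).
  - exact: (seed_not_sink E N h4).
  - exact: (seed_not_source N h3 h4 h5).
have [e0 e0N] : exists e, e \in Nc.
  by apply/set0Pn; rewrite -card_gt0 -(ltn_add2l #|acy E N|) addn0 -cN.
pose T1 := TC :\: loose E; pose S1 := SC :\: loose E.
have ZE : TC :&: loose E = SC :&: loose E.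
  apply/setP=> z; rewrite !in_setI; case: (boolP (z \in loose E)); rewrite ?andbF // inE => iz.
  by rewrite !andbT; apply: isolated_tail_head.
have cT : #|TC| = #|TC :&: loose E| + #|T1| by rewrite cardsID.
have cS : #|SC| = #|TC :&: loose E| + #|S1| by rewrite ZE cardsID.
have T1P t : t \in T1 -> t \in TC /\ ~~ isolated E t by rewrite in_setD inE => /andP[].
have S1P t : t \in S1 -> t \in SC /\ ~~ isolated E t by rewrite in_setD inE => /andP[].
(* If cyclic edges only meet isolated vertices, the core is a single loop, later subdivided by the
   other vertices. *)
case: (set_0Vmem T1) => [T10|[t tT1]].
  have S10 : S1 = set0.
    apply/eqP; rewrite -subset0; apply/subsetP=> s /S1P[h1 h2].
    by case: (head_to_tail exN h1 h2) => t; rewrite -/TC -/T1 T10 inE.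
  have e0T : e0.1 \in TC by apply: imset_f.
  have sT : TC \subset loose E by rewrite -setD_eq0 -/T1 T10.
  have sS : SC \subset loose E by rewrite -setD_eq0 -/S1 S10.
  have TS : TC = SC by rewrite -(setIidPl sT) ZE (setIidPl sS).
  pose z0 := e0.1.
  apply: (fin [set z0] [set z0] (TC :\ z0) set0 set0 [set (z0, z0)] z0 z0).
  - by rewrite sub1set.
  - by rewrite sub1set -TS.
  - by rewrite sub1set inE /= inE eqxx.
  - by rewrite inE.
  - by move=> x y; rewrite !inE !orbb => /eqP -> /eqP ->; apply: connect0.
  - by rewrite setU0; apply/subsetP=> x xT; rewrite !inE xT andbT orbN.
  - by rewrite -TS setU0; apply/subsetP=> x xT; rewrite !inE xT andbT orbN.
  - move=> z; rewrite !inE => /andP[-> zT]; rewrite -TS zT; split=> //.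
    by have := subsetP sT _ zT; rewrite inE.
  - by move=> x; rewrite in_set0.
  - by move=> x; rewrite in_set0.
  - by rewrite cards1.
  - apply: leq_trans cTC; rewrite cards0 maxnn addn0 cards1.
    by rewrite (cardsD1 z0 TC) e0T.
case: (balanced_representatives E T1 S1) => A0 [C0 [[A0s C0s] [cA0 cC0] A0r C0r cE]].
case: (A0r _ tT1) => a aA0 _.
have T1iso u v : twin E u v -> isolated E u = isolated E v.
  by move=> uv; rewrite /isolated (twin_sink uv) (twin_source uv).
case: (@strong_augmentation _ E A0 C0 a aA0).
- move=> c /(subsetP A0s) cT1; case: (T1P _ cT1) => h1 h2.
  case: (tail_from_head exN h1 h2) => s sS1 sc; case: (C0r _ sS1) => y yC ys.
  exists y => //; case: (S1P _ sS1) => k1 k2.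
  have ns : ~~ sink E s by move: k2; rewrite /isolated (cyc_head_source exN k1) andbT.
  have ne : c != s by apply: contra ns => /eqP <-; apply: (cyc_tail_sink exN h1).
  have sc' : conn (E :|: set0) s c by rewrite setU0.
  rewrite twin_sym in ys.
  by have := des_twin (sub0set _) ys ns sc' ne; rewrite setU0.
- move=> c /(subsetP C0s) cT1; case: (S1P _ cT1) => h1 h2.
  case: (head_to_tail exN h1 h2) => s sS1 sc; case: (A0r _ sS1) => y yC ys.
  exists y => //; case: (T1P _ sS1) => k1 k2.
  have ns : ~~ source E s by move: k2; rewrite /isolated (cyc_tail_sink exN k1).
  have ne : c != s by apply: contra ns => /eqP <-; apply: (cyc_head_source exN h1).
  have sc' : conn (E :|: set0) c s by rewrite setU0.
  rewrite twin_sym in ys.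
  by have := anc_twin (sub0set _) ys ns sc' ne; rewrite setU0.
move=> M [Ms /set0Pn[[t0 s0] M0] cM Mstr].
apply: (fin A0 C0 (TC :&: loose E) (T1 :\: A0) (S1 :\: C0) M t0 s0) => //.
- by apply: subset_trans A0s (subsetDl _ _).
- by apply: subset_trans C0s (subsetDl _ _).
- apply/subsetP=> x xT; rewrite !in_setU in_setI in_setD [x \in T1]in_setD xT.
  by case: (x \in A0); case: (x \in loose E).
- apply/subsetP=> x xT; rewrite ZE !in_setU in_setI in_setD [x \in S1]in_setD xT.
  by case: (x \in C0); case: (x \in loose E).
- move=> z zT; have zS := zT; rewrite ZE in zS; move: zT zS.
  rewrite !in_setI => /andP[h1 h2] /andP[h3 _]; rewrite h1 h3; split=> //.
  + by move: h2; rewrite inE.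
  + by apply/negP=> /(subsetP A0s); rewrite in_setD h2.
  + by apply/negP=> /(subsetP C0s); rewrite in_setD h2.
- move=> c; rewrite in_setD => /andP[nc cT1]; case: (T1P _ cT1) => k1 k2; split=> //.
  exact: A0r.
- move=> c; rewrite in_setD => /andP[nc cT1]; case: (S1P _ cT1) => k1 k2; split=> //.
  exact: C0r.
- by apply: leq_trans cM _; rewrite geq_max !leqW.
(* By the balance [cE], core and bulk together use at most the larger of [#|TC|] and [#|SC|]. *)
move: cTC cSC; rewrite cT cS; move: cE cM.
move: #|T1 :\: A0| #|S1 :\: C0| #|T1| #|S1| #|A0| #|C0| #|M| #|Nc| #|TC :&: loose E|.
by clear; lia.
Qed.

End CorePlan.

(** * Candidates over few representatives *)

Section Candidate.
Variable V : finType.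
Implicit Types (E N : {set V * V}).

Definition cand_tails E N0 t0 z : seq V :=
  t0 :: take z (enum (loose (E :|: N0))) ++ enum (low (E :|: N0) t0).
Definition cand_heads E N0 t0 s0 z : seq V :=
  take z (enum (loose (E :|: N0))) ++ s0 :: enum (high (E :|: N0) t0).

(* The edge [(t0, s0)] is subdivided by [z] isolated vertices, after which the
   remaining tails and heads are joined in pairs. *)
Definition candidate E N0 t0 s0 z m : {set V * V} :=
  N0 :\ (t0, s0) :|:
  [set e in mkseq (fun j => (nth t0 (cand_tails E N0 t0 z) j,
                             nth s0 (cand_heads E N0 t0 s0 z) j)) (z + m).+1].

Lemma ss_feasible E N : N \subset ss E -> N \subset ~: E.
Proof.
move=> /subsetP sN; apply/subsetP=> e /sN; rewrite !inE => /andP[/forallP/(_ e.2)].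
by rewrite -surjective_pairing.
Qed.

(** Thanks to this, the same search covers solutions without cyclic edges. *)
Lemma candidate0 E N0 t0 s0 : (t0, s0) \in N0 -> candidate E N0 t0 s0 0 0 = N0.
Proof.
move=> h; apply/setP=> e; rewrite /candidate /cand_tails /cand_heads take0 /= !inE /=.
by have [->|] := eqVneq e (t0, s0); rewrite ?h ?orbF.
Qed.

Lemma core_plan_candidate E B N0 t0 s0 z t s w :
  core_plan E B N0 t0 s0 z t s w ->
  let N := candidate E N0 t0 s0 z (maxn t s) in
  [/\ N \subset ~: E, #|N| <= B & w <= reach_count (E :|: N)].
Proof.
move=> [N0s [ts0 st0] szB [zl tl sl] wle] N.
pose H0 := E :|: N0; pose G := E :|: N; pose m := maxn t s.
pose Zl := take z (enum (loose H0)); pose Ts := enum (low H0 t0); pose Ss := enum (high H0 t0).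
have sZ : size Zl = z by rewrite size_takel // -cardE.
pose LT := cand_tails E N0 t0 z; pose LH := cand_heads E N0 t0 s0 z.
have LTE : LT = t0 :: Zl ++ Ts by [].
have LHE : LH = Zl ++ s0 :: Ss by [].
have ZlP x : x \in Zl -> x \in loose H0 by move/mem_take; rewrite mem_enum.
have EH x : sink H0 x -> sink E x.
  by move/forallP=> h; apply/forallP=> y; have := h y; rewrite in_setU negb_or => /andP[].
have EH' x : source H0 x -> source E x.
  by move/forallP=> h; apply/forallP=> y; have := h y; rewrite in_setU negb_or => /andP[].
have link j : j <= z + m -> (nth t0 LT j, nth s0 LH j) \in N.
  move=> jm; rewrite in_setU; apply/orP; right; rewrite inE; apply/mapP.
  by exists j; rewrite // mem_iota /= add0n.
have glink j : j <= z + m -> conn G (nth t0 LT j) (nth s0 LH j).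
  by move=> jm; apply: conn_edge; rewrite in_setU link ?orbT.
(* The heads are the tails shifted by one place, so the first links form a path from [t0] through
   [Zl] to [s0]. *)
have stepZ j : j < z -> nth s0 LH j = nth t0 LT j.+1.
  by move=> jz; rewrite LTE LHE /= !nth_cat sZ jz; apply: set_nth_default; rewrite sZ.
have fromt0 j : j <= z -> conn G t0 (nth t0 LT j).
  elim: j => [_|j IH jz]; first exact: connect0.
  apply: connect_trans (IH (ltnW jz)) _; rewrite -stepZ //.
  by apply: glink; apply: leq_trans (ltnW jz) (leq_addr _ _).
have LHz : nth s0 LH z = s0 by rewrite LHE nth_cat sZ ltnn subnn.
have tos0 k j : j + k = z -> conn G (nth t0 LT j) s0.
  elim: k j => [|k IH] j.
    by rewrite addn0 => ->; rewrite -{1}LHz; apply: glink; apply: leq_addr.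
  rewrite addnS -addSn => e; have jz : j < z by rewrite -e leq_addr.
  apply: connect_trans (glink _ _) _; first exact: leq_trans (ltnW jz) (leq_addr _ _).
  by rewrite stepZ //; apply: IH.
have Gts : conn G t0 s0 by apply: (tos0 z 0).
have Zpos x : x \in Zl -> conn G t0 x /\ conn G x s0.
  move=> xZ; have lt : index x Zl < z by rewrite -sZ index_mem.
  have e : nth t0 LT (index x Zl).+1 = x by rewrite LTE /= nth_cat sZ lt nth_index.
  split; first by rewrite -{1}e; apply: fromt0.
  by rewrite -{1}e; apply: (tos0 (z - (index x Zl).+1)); rewrite subnKC.
have H0G : forall u v, conn H0 u v -> conn G u v.
  apply: conn_sub => u v; rewrite in_setU => /orP[uv|uv].
    by apply: conn_edge; rewrite in_setU uv.
  have [[-> ->] //|ne] := eqVneq (u, v) (t0, s0).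
  by apply: conn_edge; rewrite !in_setU in_setD1 ne uv orbT.
have Gst : conn G s0 t0 by apply: H0G.
(* Past the path both lists are aligned: sinks are linked to sources, and the shorter list is
   continued by [t0] or [s0]. *)
have LTt i : nth t0 LT (z.+1 + i) = nth t0 Ts i.
  by rewrite LTE addSn /= nth_cat sZ ltnNge leq_addr addKn.
have LHs i : nth s0 LH (z.+1 + i) = nth s0 Ss i.
  by rewrite LHE nth_cat sZ addSn ltnNge -addnS leq_addr /= addKn.
have TsP x : x \in Ts -> sink H0 x /\ conn H0 t0 x by rewrite mem_enum inE => /andP[].
have SsP x : x \in Ss -> source H0 x /\ conn H0 x t0 by rewrite mem_enum inE => /andP[].
have Tpos i : i < m -> i < size Ts -> conn G (nth t0 Ts i) t0.
  move=> im iT; have := @glink (z.+1 + i); rewrite addSn -addnS leq_add2l => /(_ im).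
  rewrite addnS -addSn LTt LHs => h; apply: connect_trans h _.
  have [lt|ge] := ltnP i (size Ss); last by rewrite nth_default.
  by case: (SsP _ (mem_nth s0 lt)) => _ /H0G.
have Spos i : i < m -> i < size Ss -> conn G t0 (nth s0 Ss i).
  move=> im iT; have := @glink (z.+1 + i); rewrite addSn -addnS leq_add2l => /(_ im).
  rewrite addnS -addSn LTt LHs => h; apply: connect_trans h.
  have [lt|ge] := ltnP i (size Ts); last by rewrite nth_default // connect0.
  by case: (TsP _ (mem_nth t0 lt)) => _ /H0G.
have nsi : ~~ sink H0 t0.
  by apply/negP=> /forallP/(_ s0); rewrite in_setU ts0 orbT.
have nso : ~~ source H0 t0.
  apply/negP=> /forallP h; have [e|ne] := eqVneq s0 t0.
    by have := h t0; rewrite -{2}e in_setU ts0 orbT.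
  by case: (conn_lastE st0 ne) => p _; rewrite (negPf (h p)).
pose Zb := [set x in Zl]; pose Tb := [set x in take t Ts]; pose Sb := [set x in take s Ss].
have cZ : #|Zb| = z by rewrite cardsE (card_uniqP _) ?take_uniq ?enum_uniq.
have cT : #|Tb| = t.
  by rewrite cardsE (card_uniqP _) ?take_uniq ?enum_uniq // size_takel // -cardE.
have cS : #|Sb| = s.
  by rewrite cardsE (card_uniqP _) ?take_uniq ?enum_uniq // size_takel // -cardE.
have takeP (l : seq V) k x : x \in take k l -> exists2 i, (i < k) && (i < size l) & forall y, nth y l i = x.
  move=> xl; have lt : index x (take k l) < size (take k l) by rewrite index_mem.
  exists (index x (take k l)).
    by move: lt; rewrite size_take_min leq_min.
  move=> y; rewrite -{2}(nth_index y xl) nth_take //.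
  by move: lt; rewrite size_take_min leq_min => /andP[].
split.
- apply: ss_feasible; apply/subsetP=> e; rewrite in_setU => /orP[/setD1P[_ /(subsetP N0s)] //|].
  have := subsetP N0s _ ts0; rewrite inE /= => /andP[kt ks].
  rewrite inE => /mapP[j _ ->]; rewrite inE /=; apply/andP; split.
    have [lt|ge] := ltnP j (size LT); last by rewrite nth_default.
    have := mem_nth t0 lt; rewrite {2}LTE inE mem_cat => /or3P[/eqP -> //|/ZlP|/TsP[/EH] //].
    by rewrite inE => /andP[/EH].
  have [lt|ge] := ltnP j (size LH); last by rewrite nth_default.
  have := mem_nth s0 lt; rewrite {2}LHE mem_cat inE => /or3P[/ZlP|/eqP -> //|/SsP[/EH'] //].
  by rewrite inE => /andP[_ /EH'].
- apply: leq_trans szB; apply: leq_trans (leq_card_setU _ _) _.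
  (* Deleting [(t0, s0)] pays for one of the [(z + m).+1] links. *)
  rewrite (cardsD1 (t0, s0) N0) ts0 -addnA add1n addSnnS leq_add2l.
  by rewrite cardsE; apply: leq_trans (card_size _) _; rewrite size_mkseq.
have := card_bulk nsi nso (_ : Zb \subset loose H0) (_ : Tb \subset low H0 t0) (_ : Sb \subset high H0 t0).
rewrite cZ cT cS => cb; rewrite -cb in wle.
- move: wle; rewrite leq_add2r => /leq_trans; apply; rewrite reach_countE.
  apply/subset_leq_card/subsetP=> -[u v]; rewrite in_setU => /orP[|].
    by rewrite !inE; apply: H0G.
  rewrite in_setX /= !in_setU ![_ \in anc _ _]inE ![_ \in des _ _]inE => /andP[hu hv].
  rewrite inE /=; apply: (@connect_trans _ _ t0).
    case/orP: hu => [/orP[/H0G //|]|].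
      by rewrite inE => /Zpos[_ h]; apply: connect_trans h Gst.
    rewrite inE => /takeP[i /andP[it iT] h]; rewrite -(h t0); apply: Tpos => //.
    by apply: leq_trans it (leq_maxl _ _).
  case/orP: hv => [/orP[/H0G //|]|].
    by rewrite inE => /Zpos[].
  rewrite inE => /takeP[i /andP[it iT] h]; rewrite -(h s0); apply: Spos => //.
  by apply: leq_trans it (leq_maxr _ _).
- by apply/subsetP=> x; rewrite [x \in Zb]inE; apply: ZlP.
- by apply/subsetP=> x; rewrite [x \in Tb]inE => /mem_take; rewrite mem_enum.
- by apply/subsetP=> x; rewrite [x \in Sb]inE => /mem_take; rewrite mem_enum.
Qed.

End Candidate.

(** * Moving plans by swapping twins *)

Section Relabel.
Variable V : finType.
Variable f : V -> V.
Hypothesis ff : involutive f.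
Implicit Types (E F : {set V * V}).

Definition relabel F : {set V * V} := [set e | (f e.1, f e.2) \in F].

Lemma relabelE F u v : ((u, v) \in relabel F) = ((f u, f v) \in F).
Proof. by rewrite inE. Qed.

Lemma relabelK : involutive relabel.
Proof. by move=> F; apply/setP=> -[a b]; rewrite !relabelE !ff. Qed.

Lemma card_relabel F : #|relabel F| = #|F|.
Proof.
rewrite -(card_imset F (f := fun e : V * V => (f e.1, f e.2))); last first.
  by move=> [a b] [c d] [/(inv_inj ff) -> /(inv_inj ff) ->].
apply: eq_card => -[a b]; rewrite relabelE; apply/idP/imsetP => [h|[[c d] h [-> ->]]].
  by exists (f a, f b); rewrite //= !ff.
by rewrite /= !ff.
Qed.

Lemma card_relabel_set (A : {set V}) : #|[set x | f x \in A]| = #|A|.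
Proof.
rewrite -(card_imset A (inv_inj ff)); apply: eq_card => a; rewrite inE.
apply/idP/imsetP => [h|[c h ->]]; last by rewrite ff.
by exists (f a); rewrite ?ff.
Qed.

Lemma conn_relabel F u v : conn (relabel F) u v = conn F (f u) (f v).
Proof.
have half G a b : conn G a b -> conn (relabel G) (f a) (f b).
  move=> /connectP[p]; elim: p a => [a _ ->|c p IH a /= /andP[ac cp] bE].
    exact: connect0.
  apply: connect_trans (IH _ cp bE); apply: conn_edge.
  by rewrite relabelE !ff.
apply/idP/idP => [/half|/half]; first by rewrite relabelK.
by rewrite !ff.
Qed.

Lemma reach_relabel F : reach_count (relabel F) = reach_count F.
Proof.
rewrite !reach_countE -[RHS]card_relabel; apply: eq_card => -[a b].
by rewrite relabelE !inE /= conn_relabel.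
Qed.

Lemma relabelU E F : relabel (E :|: F) = relabel E :|: relabel F.
Proof. by apply/setP=> e; rewrite !inE. Qed.

Lemma sink_relabel F v : sink (relabel F) v = sink F (f v).
Proof.
apply/forallP/forallP => h y; last by rewrite relabelE.
by have := h (f y); rewrite relabelE ff.
Qed.

Lemma source_relabel F v : source (relabel F) v = source F (f v).
Proof.
apply/forallP/forallP => h y; last by rewrite relabelE.
by have := h (f y); rewrite relabelE ff.
Qed.

Lemma core_plan_relabel E B N0 t0 s0 z t s w : relabel E = E ->
  core_plan E B N0 t0 s0 z t s w ->
  core_plan E B (relabel N0) (f t0) (f s0) z t s w.
Proof.
move=> fE [N0s [ts st] szB [zl tl sl] wle]; rewrite /core_plan.
have -> : E :|: relabel N0 = relabel (E :|: N0) by rewrite relabelU fE.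
set H0 := E :|: N0 in st zl tl sl wle *.
have -> : anc (relabel H0) (f t0) = [set x | f x \in anc H0 t0].
  by apply/setP=> x; rewrite !inE conn_relabel ff.
have -> : des (relabel H0) (f t0) = [set x | f x \in des H0 t0].
  by apply/setP=> x; rewrite !inE conn_relabel ff.
have -> : loose (relabel H0) = [set x | f x \in loose H0].
  by apply/setP=> x; rewrite !inE /isolated sink_relabel source_relabel.
have -> : low (relabel H0) (f t0) = [set x | f x \in low H0 t0].
  by apply/setP=> x; rewrite !inE conn_relabel ff sink_relabel.
have -> : high (relabel H0) (f t0) = [set x | f x \in high H0 t0].
  by apply/setP=> x; rewrite !inE conn_relabel ff source_relabel.
rewrite !card_relabel_set card_relabel reach_relabel conn_relabel !ff relabelE !ff.
split=> //; apply/subsetP=> -[a b]; rewrite relabelE => /(subsetP N0s).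
by rewrite !inE /= -sink_relabel -source_relabel fE.
Qed.

End Relabel.

Lemma tpermV_invol (T : finType) (x y : T) : involutive (tperm x y).
Proof. by move=> z; rewrite tpermK. Qed.

Lemma twin_relabel (V : finType) (E : {set V * V}) u v : twin E u v ->
  relabel (tperm u v) E = E.
Proof.
move=> uv; have t1 a b : ((tperm u v a, b) \in E) = ((a, b) \in E).
  by case: tpermP => [->|->|//]; rewrite (twin_out _ uv).
have t2 a b : ((a, tperm u v b) \in E) = ((a, b) \in E).
  by case: tpermP => [->|->|//]; rewrite (twin_in _ uv).
by apply/setP=> -[a b]; rewrite relabelE t1 t2.
Qed.

Section Representatives.
Variable n : nat.
Variable E : {set 'I_n * 'I_n}.
Implicit Types (N F : {set 'I_n * 'I_n}) (u v : 'I_n).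

(** Numbers each twin class from 0, so an upper bound on it selects the first few members of every
    class. *)
Definition trank v : nat := #|[set u : 'I_n | (u < v) && twin E u v]|.
Definition touched N : {set 'I_n} := [set e.1 | e in N] :|: [set e.2 | e in N].

Lemma card_touched N : #|touched N| <= #|N| + #|N|.
Proof.
by apply: leq_trans (leq_card_setU _ _) _; apply: leq_add; apply: leq_imset_card.
Qed.

Lemma touchedP N v : reflect (exists w, ((v, w) \in N) || ((w, v) \in N)) (v \in touched N).
Proof.
rewrite in_setU; apply: (iffP orP) => [[|] /imsetP[[a b] h ->]|[w /orP[h|h]]].
- by exists b; rewrite h.
- by exists a; rewrite h orbT.
- by left; apply/imsetP; exists (v, w).
- by right; apply/imsetP; exists (w, v).
Qed.

(** The second alternative is for extremal solutions that have no cyclic edge and hence no core. *)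
Definition solution_plan B w N0 : Prop :=
  (exists t0 s0 z t s, core_plan E B N0 t0 s0 z t s w) \/
  [/\ N0 \subset ss E, #|N0| <= B & w <= reach_count (E :|: N0)].

Lemma solution_plan_relabel B w N0 u v : twin E u v -> solution_plan B w N0 ->
  solution_plan B w (relabel (tperm u v) N0).
Proof.
move=> uv; have fE := twin_relabel uv; have ff := tpermV_invol u v.
case=> [[t0 [s0 [z [t [s h]]]]]|[h1 h2 h3]]; [left|right].
  by exists (tperm u v t0), (tperm u v s0), z, t, s; apply: core_plan_relabel.
rewrite (card_relabel ff) -{2}fE -relabelU (reach_relabel ff); split=> //.
apply/subsetP=> -[a b]; rewrite relabelE => /(subsetP h1).
by rewrite !inE /= -(sink_relabel ff) -(source_relabel ff) fE.
Qed.

Lemma touched_relabel N u v x :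
  (x \in touched (relabel (tperm u v) N)) = (tperm u v x \in touched N).
Proof.
apply/touchedP/touchedP => -[w h]; exists (tperm u v w); first by rewrite !relabelE in h.
by rewrite !relabelE !tpermK.
Qed.

(** Induction on the sum of the touched vertices. A touched vertex of rank at least [R] has more
    smaller twins than [N0] touches; swapping it with an untouched one lowers the sum. *)
Lemma solution_plan_reps B w N0 R : solution_plan B w N0 -> #|N0| + #|N0| < R ->
  exists N1, [/\ solution_plan B w N1, #|N1| = #|N0| &
    forall v, v \in touched N1 -> trank v < R].
Proof.
have [k] := ubnP (\sum_(v in touched N0) v); elim: k N0 => // k IH N0 lek pl lR.
have [/forall_inP h|] := boolP [forall v in touched N0, trank v < R].
  by exists N0.
rewrite negb_forall => /existsP[v]; rewrite negb_imply -leqNgt => /andP[vT Rv].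
have : ~~ ([set u : 'I_n | (u < v) && twin E u v] \subset touched N0).
  apply/negP=> /subset_leq_card; rewrite -/(trank v) leqNgt; case/negP.
  by apply: leq_ltn_trans (card_touched N0) (leq_trans lR Rv).
case/subsetPn=> u; rewrite inE => /andP[uv tw] uT.
have ff := tpermV_invol u v.
case: (IH (relabel (tperm u v) N0)).
- suff lt : \sum_(x in touched (relabel (tperm u v) N0)) x < \sum_(x in touched N0) x.
    by apply: leq_trans lt _; rewrite -ltnS.
  have -> : \sum_(x in touched (relabel (tperm u v) N0)) x = \sum_(x in touched N0) tperm u v x.
    rewrite (reindex_inj (inv_inj ff)) /=; apply: eq_bigl => x.
    by rewrite touched_relabel ff.
  rewrite (bigD1 v vT) [X in _ < X](bigD1 v vT) /= tpermR -addSn leq_add //.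
  apply: leq_sum => x /andP[xT xv]; case: tpermP xv => [xu|->|//]; last by rewrite eqxx.
  by case/negP: uT; rewrite -xu.
- exact: solution_plan_relabel.
- by rewrite (card_relabel ff).
by move=> N1 [h1 h2 h3]; exists N1; split; rewrite // h2 (card_relabel ff).
Qed.

(* Exceeds the number of vertices touched by the edges of a core plan. *)
Definition rep_bound q : nat := 2 * (q ^ 2 + q + 5) + 1.

Lemma solution_plan_exists B q : dag E -> ntwins E <= q ->
  exists2 N0, (forall v, v \in touched N0 -> trank v < rep_bound q) &
  exists2 w, solution_plan B w N0 &
  forall N, mci_feasible E B N -> reach_count (E :|: N) <= w.
Proof.
move=> dE hq; case: (extremal_exists E B) => N exN.
pose w := reach_count (E :|: N).
have wmax N' : mci_feasible E B N' -> reach_count (E :|: N') <= w.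
  case/andP=> _ cN'; case: (to_ss N' dE) => N2 [h1 h2 h3].
  apply: leq_trans h3 _; case: exN => _ _ /(_ N2 h1 (leq_trans h2 cN')).
  by case=> [/ltnW|[->]].
have [N0 [pl cN0]] : exists N0, solution_plan B w N0 /\ #|N0| <= ntwins E ^ 2 + ntwins E + 5.
  have e5 : ntwins E ^ 2 + 4 + (ntwins E).+1 = ntwins E ^ 2 + ntwins E + 5.
    by rewrite -!addnA; congr (_ + _); rewrite addnC addSn -addnS.
  have [lt|ge] := ltnP #|acy E N| #|N|.
    case: (core_plan_exists dE exN lt) => N0 [t0 [s0 [z [t [s [h1 h2]]]]]].
    by exists N0; split; [left; exists t0, s0, z, t, s | rewrite -e5].
  exists N; split; first by right; case: exN.
  apply: leq_trans ge (leq_trans (acy_bound dE exN) _).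
  by rewrite -e5 leq_addr.
have lt : #|N0| + #|N0| < rep_bound q.
  rewrite /rep_bound addn1 ltnS addnn -mul2n leq_mul2l /=.
  apply: leq_trans cN0 _; rewrite leq_add2r leq_add //.
  by rewrite leq_exp2r.
case: (solution_plan_reps pl lt) => N1 [h1 h2 h3]; exists N1 => //; exists w => //.
Qed.

End Representatives.

(** * Twin classes and the matching number *)

Section TwinClasses.
Variable n : nat.
Variable E : {set 'I_n * 'I_n}.
Implicit Types (u v : 'I_n).

(** The number of twin classes in the form in which the program counts it. *)
Definition nfirst : nat := #|[set v | trank E v == 0]|.

Lemma trank_lt u v : twin E u v -> u < v -> trank E u < trank E v.
Proof.
move=> tw uv; apply/proper_card/properP; split.
  apply/subsetP=> w; rewrite !inE => /andP[wu tw'].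
  by rewrite (ltn_trans wu uv) (twin_trans tw' tw).
by exists u; rewrite !inE ?uv ?tw // ltnn.
Qed.

Lemma trank_inj u v : twin E u v -> trank E u = trank E v -> u = v.
Proof.
move=> tw e; apply: val_inj => /=; case: (ltngtP u v) => // lt.
  by have := trank_lt tw lt; rewrite e ltnn.
by rewrite twin_sym in tw; have := trank_lt tw lt; rewrite e ltnn.
Qed.

Lemma ntwins_nfirst : ntwins E = nfirst.
Proof.
rewrite /nfirst -(@card_in_imset _ _ (twins E)); last first.
  move=> u v; rewrite !inE => /eqP hu /eqP hv /twinsP tw.
  by apply: trank_inj tw _; rewrite hu hv.
apply: eq_card => c; apply/imsetP/imsetP => [[u _ ->]|[u _ ->]]; last by exists u.
case: (@arg_minnP _ u (fun v => twin E u v) (fun v => v : nat) (twin_refl E u)) => v uv vmin.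
exists v; last exact/twinsP.
rewrite inE cards_eq0 -subset0; apply/subsetP=> w; rewrite !inE => /andP[wv tw].
by rewrite ltnNge vmin // in wv; apply: twin_trans uv _; rewrite twin_sym.
Qed.

Lemma card_reps R : #|[set v | trank E v < R]| <= nfirst * R.
Proof.
case: R => [|R].
  by rewrite muln0 leqn0 cards_eq0 -subset0; apply/subsetP=> v; rewrite inE.
rewrite -(card_in_imset (f := fun v => (twins E v, inord (trank E v) : 'I_R.+1))).
  rewrite -ntwins_nfirst -[X in _ * X]card_ord -cardsT -cardsX.
  apply/subset_leq_card/subsetP=> _ /imsetP[v _ ->].
  by rewrite inE /= imset_f ?inE.
move=> u v; rewrite !inE => hu hv [/twinsP tw /(congr1 val)]; rewrite /= !inordK // => e.
exact: trank_inj.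
Qed.

(** The ends [X] of a maximal matching meet every edge, so a vertex outside [X] is determined up to
    twins by its out-neighbours and its in-neighbours in [X]: one power of two for each. *)
Lemma nfirst_matching : dag E ->
  nfirst <= (matching_number E).*2 + 2 ^ (matching_number E).*2 * 2 ^ (matching_number E).*2.
Proof.
move=> [_ irr]; set nu := matching_number E.
pose P (M : {set 'I_n * 'I_n}) := (M \subset E) && matching M.
have P0 : P set0 by rewrite /P sub0set; apply/forallP=> p; rewrite inE.
case: (@arg_maxnP _ set0 P (fun M : {set 'I_n * 'I_n} => #|M|) P0) => M PM Mmax.
case/andP: (PM) => ME Mm.
have [X XE] : {X | X = touched M} by exists (touched M).
have cX : #|X| <= nu.*2.
  rewrite XE; apply: leq_trans (card_touched M) _; rewrite addnn leq_double.
  by rewrite /nu /matching_number (bigmax_sup M).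
have cover u v : (u, v) \in E -> (u \in X) || (v \in X).
  move=> uvE; apply/norP=> -[uX vX].
  have uM p : p \in M -> [/\ p.1 != u, p.2 != u, p.1 != v & p.2 != v].
    case: p => a b pM /=; split.
    - by apply: contra uX => /eqP <-; rewrite XE; apply/touchedP; exists b; rewrite pM.
    - by apply: contra uX => /eqP <-; rewrite XE; apply/touchedP; exists a; rewrite pM orbT.
    - by apply: contra vX => /eqP <-; rewrite XE; apply/touchedP; exists b; rewrite pM.
    - by apply: contra vX => /eqP <-; rewrite XE; apply/touchedP; exists a; rewrite pM orbT.
  have nM : (u, v) \notin M by apply/negP=> /uM[]; rewrite eqxx.
  suff /Mmax : P ((u, v) |: M) by rewrite /= cardsU1 nM add1n ltnn.
  have dis p : p \in M -> [disjoint [set p.1; p.2] & [set u; v]].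
    move=> /uM[h1 h2 h3 h4]; rewrite -setI_eq0 -subset0; apply/subsetP=> x.
    rewrite !inE => /andP[/orP[|] /eqP ->];
    by rewrite ?(negPf h1) ?(negPf h2) ?(negPf h3) ?(negPf h4).
  rewrite /P subUset ME sub1set uvE /=; apply/forall_inP=> p pM; apply/forall_inP=> q qM.
  move: pM qM; rewrite !in_setU1 => /orP[/eqP -> /=|pM] /orP[/eqP -> /=|qM].
  - by rewrite eqxx.
  - by rewrite disjoint_sym dis ?implybT.
  - by rewrite dis ?implybT.
  - by move/forall_inP: Mm => /(_ p pM)/forall_inP/(_ q qM).
pose A := [set v | trank E v == 0].
rewrite /nfirst -/A -(cardsID X A) leq_add //.
  by apply: leq_trans cX; apply: subset_leq_card; apply: subsetIr.
rewrite -(card_in_imset (f := fun v => ([set w in X | (v, w) \in E], [set w in X | (w, v) \in E]))).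
  have le : 2 ^ #|X| * 2 ^ #|X| <= 2 ^ nu.*2 * 2 ^ nu.*2 by rewrite leq_mul // leq_exp2l.
  apply: leq_trans le; rewrite -!card_powerset -cardsX.
  apply/subset_leq_card/subsetP=> _ /imsetP[v _ ->]; rewrite !inE /=.
  by apply/andP; split; apply/subsetP=> w; rewrite inE => /andP[].
move=> u v; rewrite !inE => /andP[uX /eqP ru] /andP[vX /eqP rv] [h1 h2].
apply: trank_inj; last by rewrite ru rv.
apply/andP; split; apply/forallP=> w.
  have [wX|nwX] := boolP (w \in X).
    by have /setP/(_ w) := h1; rewrite !inE wX /= => ->.
  have nE x : x \notin X -> (x, w) \notin E.
    by move=> xX; apply/negP=> /cover; rewrite (negPf xX) (negPf nwX).
  by rewrite (negPf (nE u uX)) (negPf (nE v vX)).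
have [wX|nwX] := boolP (w \in X).
  by have /setP/(_ w) := h2; rewrite !inE wX /= => ->.
have nE x : x \notin X -> (w, x) \notin E.
  by move=> xX; apply/negP=> /cover; rewrite (negPf xX) (negPf nwX).
by rewrite (negPf (nE u uX)) (negPf (nE v vX)).
Qed.

End TwinClasses.

(** * Programs with bounded loops *)

Inductive cmd :=
| CSkip
| CPut of nat & expr & expr
| CSeq of cmd & cmd
| CIf of expr & cmd & cmd
| CFor of nat & expr & cmd.

Notation Var x := (EGet x (ECst 0)).
Notation Inc x := (Put x (ECst 0) (EAdd (Var x) (ECst 1))).

Fixpoint compile c : prog :=
  match c with
  | CSkip => Skip
  | CPut a i e => Put a i e
  | CSeq c1 c2 => Seq (compile c1) (compile c2)
  | CIf e c1 c2 => If e (compile c1) (compile c2)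
  | CFor x b c =>
      Seq (Put x (ECst 0) (ECst 0)) (While (ESub b (Var x)) (Seq (compile c) (Inc x)))
  end.

(* Unlike in the compiled [While], the bound of a loop is evaluated once. *)
Fixpoint run c (m : memory) : memory :=
  match c with
  | CSkip => m
  | CPut a i e => upd m a (eval m i) (eval m e)
  | CSeq c1 c2 => run c2 (run c1 m)
  | CIf e c1 c2 => if eval m e != 0 then run c1 m else run c2 m
  | CFor x b c => iteri (eval m b) (fun i m' => upd (run c m') x 0 i.+1) (upd m x 0 0)
  end.

Lemma run_seq c1 c2 m : run (CSeq c1 c2) m = run c2 (run c1 m).
Proof. by []. Qed.

Lemma run_put a i e m : run (CPut a i e) m = upd m a (eval m i) (eval m e).
Proof. by []. Qed.

Lemma run_if e c1 c2 m :
  run (CIf e c1 c2) m = if eval m e != 0 then run c1 m else run c2 m.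
Proof. by []. Qed.

Fixpoint reads e : seq nat :=
  match e with
  | ECst _ => [::]
  | EGet a i => a :: reads i
  | EAdd e1 e2 | ESub e1 e2 => reads e1 ++ reads e2
  | EHalf e1 => reads e1
  end.

Fixpoint writes c : seq nat :=
  match c with
  | CSkip => [::]
  | CPut a _ _ => [:: a]
  | CSeq c1 c2 | CIf _ c1 c2 => writes c1 ++ writes c2
  | CFor x _ c => x :: writes c
  end.

Fixpoint bounds c : seq expr :=
  match c with
  | CSkip | CPut _ _ _ => [::]
  | CSeq c1 c2 | CIf _ c1 c2 => bounds c1 ++ bounds c2
  | CFor _ b c => b :: bounds c
  end.

Fixpoint counters_ok c : bool :=
  match c with
  | CSkip | CPut _ _ _ => true
  | CSeq c1 c2 | CIf _ c1 c2 => counters_ok c1 && counters_ok c2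
  | CFor x _ c => (x \notin writes c) && counters_ok c
  end.

(** Loop bounds read only arrays that the command never writes, so testing a bound anew in each
    round changes nothing. As the condition concerns the whole command, a program that first
    computes a bound must be cut before the loop using it. *)
Definition well_formed c : bool :=
  counters_ok c && all (all (fun a => a \notin writes c)) (map reads (bounds c)).

Lemma upd_other m a i x b j : b != a -> upd m a i x b j = m b j.
Proof. by rewrite /upd => /negPf ->. Qed.

Lemma eval_agree m m' e : (forall a, a \in reads e -> forall j, m a j = m' a j) ->
  eval m e = eval m' e.
Proof.
elim: e => //= [a e IH|e1 IH1 e2 IH2|e1 IH1 e2 IH2|e IH] h.
- by rewrite IH => [|b bi j]; apply: h; rewrite ?mem_head // inE bi orbT.
- by rewrite IH1 ?IH2 // => a ai j; apply: h; rewrite mem_cat ai ?orbT.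
- by rewrite IH1 ?IH2 // => a ai j; apply: h; rewrite mem_cat ai ?orbT.
- by rewrite IH.
Qed.

Lemma run_frame c m a j : a \notin writes c -> run c m a j = m a j.
Proof.
elim: c m => //= [b i e|c1 IH1 c2 IH2|e c1 IH1 c2 IH2|x b c IH] m.
- by rewrite inE => /upd_other ->.
- by rewrite mem_cat negb_or => /andP[h1 h2]; rewrite IH2 ?IH1.
- by rewrite mem_cat negb_or => /andP[h1 h2]; case: ifP => _; rewrite ?IH2 ?IH1.
rewrite inE negb_or => /andP[ax ac].
by elim: (eval m b) => [|k IHk] /=; rewrite upd_other // IH.
Qed.

Lemma run_for x b c m (I : nat -> memory -> Prop) : x \notin writes c ->
  I 0 (upd m x 0 0) ->
  (forall i m', i < eval m b ->
     (forall a j, a \notin x :: writes c -> m' a j = m a j) -> m' x 0 = i ->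
     I i m' -> I i.+1 (upd (run c m') x 0 i.+1)) ->
  I (eval m b) (run (CFor x b c) m).
Proof.
move=> xc I0 IS /=; pose f i m' := upd (run c m') x 0 i.+1.
suff h i : i <= eval m b -> [/\ I i (iteri i f (upd m x 0 0)),
    iteri i f (upd m x 0 0) x 0 = i &
    forall a j, a \notin x :: writes c -> iteri i f (upd m x 0 0) a j = m a j].
  by case: (h _ (leqnn _)).
elim: i => [_|i IH lt].
  split=> //; first by rewrite /= /upd !eqxx.
  by move=> a j; rewrite inE negb_or => /andP[ax _]; rewrite /= upd_other.
case: (IH (ltnW lt)) => h1 h2 h3; split; first exact: IS.
  by rewrite /= /f /upd !eqxx.
move=> a j na /=; move: (na); rewrite inE negb_or => /andP[ax ac].
by rewrite /f upd_other // run_frame // h3.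
Qed.

(** For invariants that do not look at the counter. *)
Lemma run_for1 x b c m N (I : nat -> memory -> Prop) : x \notin writes c ->
  eval m b = N -> (forall i m' k, I i m' -> I i (upd m' x 0 k)) -> I 0 m ->
  (forall i m', i < N -> (forall a j, a \notin x :: writes c -> m' a j = m a j) ->
     m' x 0 = i -> I i m' -> I i.+1 (run c m')) ->
  I N (run (CFor x b c) m).
Proof.
move=> xc <- st I0 IS; apply: run_for => //; first exact: st.
by move=> i m' lt fr xi Ii; apply: st; apply: IS.
Qed.

(* A double loop visits the cells of a matrix in the order of their positions. *)
Lemma run_for2 n x y b c m (I : nat -> memory -> Prop) :
  x \notin y :: writes c -> y \notin writes c ->
  (forall m', (forall a j, a \notin x :: y :: writes c -> m' a j = m a j) -> eval m' b = n) ->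
  (forall i m' k, I i m' -> I i (upd m' x 0 k)) ->
  (forall i m' k, I i m' -> I i (upd m' y 0 k)) -> I 0 m ->
  (forall (u v : 'I_n) m',
     (forall a j, a \notin x :: y :: writes c -> m' a j = m a j) ->
     m' x 0 = u -> m' y 0 = v -> I (u * n + v) m' -> I (u * n + v).+1 (run c m')) ->
  I (n * n) (run (CFor x b (CFor y b c)) m).
Proof.
move=> xc yc bn stx sty I0 IS.
apply: (@run_for1 x b _ m n (fun i => I (i * n))) => //; first exact: bn.
  by move=> *; apply: stx.
move=> i m1 lt fr1 xi Ii; rewrite mulSn addnC.
apply: (@run_for1 y b c m1 n (fun j => I (i * n + j))); rewrite ?addn0 //.
- exact: bn.
- by move=> *; apply: sty.
move=> j m2 ltj fr2 yj Ij; rewrite addnS.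
apply: (IS (Ordinal lt) (Ordinal ltj)) => // [a k na|].
  move: (na); rewrite inE negb_or => /andP[_ na'].
  by rewrite fr2 // fr1.
by rewrite fr2 // inE negb_or; move: xc; rewrite inE negb_or.
Qed.

(** In a loop, 3 is the cost of resetting the counter, [(cost b + 2).+2] that of a test, with one
    more for the final failing test, and 6 that of the increment. A conditional is charged both
    branches. *)
Fixpoint time_bound K c : nat :=
  match c with
  | CSkip => 1
  | CPut a i e => (cost i + cost e).+1
  | CSeq c1 c2 => time_bound K c1 + time_bound K c2
  | CIf e c1 c2 => (cost e).+1 + (time_bound K c1 + time_bound K c2)
  | CFor x b c => 3 + (K * ((cost b + 2).+2 + (time_bound K c + 6)) + (cost b + 2).+2)
  end.

(** [W] stays fixed in the induction because the bounds of a subcommand must be safe from everything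
    run before it. *)
Lemma exec_run_aux c K (W : seq nat) m : counters_ok c -> {subset writes c <= W} ->
  (forall b, b \in map reads (bounds c) -> forall a, a \in b -> a \notin W) ->
  (forall k, k \in map (eval m) (bounds c) -> k <= K) ->
  exists2 t, exec (compile c) m t (run c m) & t <= time_bound K c.
Proof.
elim: c m => [|a i e|c1 IH1 c2 IH2|e c1 IH1 c2 IH2|x b c IH] m.
- by move=> _ _ _ _; exists 1; [constructor|].
- by move=> _ _ _ _; exists (cost i + cost e).+1; [constructor|].
- move=> /= /andP[k1 k2] sW bW bK.
  case: (IH1 m k1) => [a aw|b bb|k kb|t1 e1 l1].
  + by apply: sW; rewrite mem_cat aw.
  + by apply: bW; rewrite map_cat mem_cat bb.
  + by apply: bK; rewrite map_cat mem_cat kb.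
  case: (IH2 (run c1 m) k2) => [a aw|b bb|k kb|t2 e2 l2].
  + by apply: sW; rewrite mem_cat aw orbT.
  + by apply: bW; rewrite map_cat mem_cat bb orbT.
  + apply: bK; rewrite map_cat mem_cat; apply/orP; right.
    suff <- : map (eval (run c1 m)) (bounds c2) = map (eval m) (bounds c2) by [].
    elim: (bounds c2) bW {kb} => //= b bs IHb bW; congr (_ :: _); last first.
      apply: IHb => b' hb; apply: bW; move: hb; rewrite !map_cat !mem_cat /= inE.
      by case/orP=> ->; rewrite ?orbT.
    apply: eval_agree => a ab j; apply: run_frame; apply/negP=> aw.
    have /negP : a \notin W.
      by apply: (bW (reads b)) => //; rewrite map_cat mem_cat /= inE eqxx orbT.
    by case; apply: sW; rewrite mem_cat aw.
  exists (t1 + t2); last exact: leq_add.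
  by apply: ExecSeq e1 e2.
- move=> /= /andP[k1 k2] sW bW bK.
  case: (IH1 m k1) => [a aw|b bb|k kb|t1 e1 l1].
  + by apply: sW; rewrite mem_cat aw.
  + by apply: bW; rewrite map_cat mem_cat bb.
  + by apply: bK; rewrite map_cat mem_cat kb.
  case: (IH2 m k2) => [a aw|b bb|k kb|t2 e2 l2].
  + by apply: sW; rewrite mem_cat aw orbT.
  + by apply: bW; rewrite map_cat mem_cat bb orbT.
  + by apply: bK; rewrite map_cat mem_cat kb orbT.
  case: eqP => [e0|/eqP e0].
    exists ((cost e).+1 + t2); first by apply: ExecIfFalse.
    by rewrite leq_add2l; apply: leq_trans l2 (leq_addl _ _).
  exists ((cost e).+1 + t1); first by apply: ExecIfTrue.
  by rewrite leq_add2l; apply: leq_trans l1 (leq_addr _ _).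
move=> /= /andP[xc kc] sW bW bK.
pose f i m' := upd (run c m') x 0 i.+1; pose M i := iteri i f (upd m x 0 0).
have frame i a j : a \notin x :: writes c -> M i a j = m a j.
  rewrite inE negb_or => /andP[ax ac].
  by elim: i => [|i IHi]; rewrite /M /= ?/f upd_other // run_frame.
have Mx i : M i x 0 = i by case: i => [|i]; rewrite /M /= /f /upd !eqxx.
have nW a : a \notin W -> a \notin x :: writes c.
  by apply: contra; apply: sW.
have Mb i : eval (M i) b = eval m b.
  apply: eval_agree => a ab j; apply: frame; apply: nW.
  by apply: (bW (reads b)); rewrite ?mem_head.
have bodies i : exists2 t, exec (compile c) (M i) t (run c (M i)) & t <= time_bound K c.
  apply: IH kc _ _ _.
  + by move=> a aw; apply: sW; rewrite inE aw orbT.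
  + by move=> b' hb; apply: bW; rewrite inE hb orbT.
  suff -> : map (eval (M i)) (bounds c) = map (eval m) (bounds c).
    by move=> k kb; apply: bK; rewrite inE kb orbT.
  have {}bW : forall b', b' \in map reads (bounds c) -> forall a, a \in b' -> a \notin W.
    by move=> b' hb; apply: bW; rewrite inE hb orbT.
  elim: (bounds c) bW => //= b' bs IHb bW; congr (_ :: _); last first.
    by apply: IHb => b2 hb; apply: bW; rewrite inE hb orbT.
  apply: eval_agree => a ab j; apply: frame; apply: nW.
  by apply: (bW (reads b')); rewrite ?mem_head.
pose w := (cost b + 2).+2; pose N := eval m b.
have loop k i : i + k = N -> exists2 t,
    exec (While (ESub b (Var x)) (Seq (compile c) (Inc x))) (M i) t (M N) &
    t <= k * (w + (time_bound K c + 6)) + w.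
  elim: k i => [|k IHk] i.
    rewrite addn0 => ->; exists w; last by rewrite mul0n.
    by apply: ExecWhileFalse; rewrite /= Mx Mb subnn.
  move=> iN; case: (bodies i) => t1 ex1 l1.
  case: (IHk i.+1) => [|t2 ex2 l2]; first by rewrite addSn -addnS.
  exists (w + (t1 + 6) + t2); last first.
    apply: leq_trans (leq_add (leq_add (leqnn w) (leq_add l1 (leqnn 6))) l2) _.
    by rewrite mulSn addnA.
  apply: ExecWhileTrue ex2.
    by rewrite /= Mx Mb -/N -iN addKn.
  apply: ExecSeq ex1 _.
  have -> : M i.+1 = upd (run c (M i)) x (eval (run c (M i)) (ECst 0))
      (eval (run c (M i)) (EAdd (Var x) (ECst 1))).
    by rewrite /M /= /f -/(M i) run_frame // Mx addn1.
  exact: ExecPut.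
case: (loop N 0 (add0n _)) => t ex l.
exists (3 + t); first by apply: ExecSeq ex; apply: ExecPut.
rewrite leq_add2l; apply: leq_trans l _; rewrite leq_add2r leq_mul2r.
by rewrite bK ?orbT // inE eqxx.
Qed.

Lemma exec_run c K m : well_formed c ->
  (forall b, b \in map (eval m) (bounds c) -> b <= K) ->
  exists2 t, exec (compile c) m t (run c m) & t <= time_bound K c.
Proof.
case/andP=> k1 /allP h bK; apply: (@exec_run_aux c K (writes c)) => //.
by move=> bs /h /allP.
Qed.

(** The value of [time_bound] at 1; each level of nesting then costs a factor [K]. *)
Fixpoint weight c : nat :=
  match c with
  | CSkip => 1
  | CPut a i e => (cost i + cost e).+1
  | CSeq c1 c2 => weight c1 + weight c2
  | CIf e c1 c2 => (cost e).+1 + (weight c1 + weight c2)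
  | CFor x b c => 3 + (((cost b + 2).+2 + (weight c + 6)) + (cost b + 2).+2)
  end.

Fixpoint depth c : nat :=
  match c with
  | CSkip | CPut _ _ _ => 0
  | CSeq c1 c2 | CIf _ c1 c2 => maxn (depth c1) (depth c2)
  | CFor _ _ c => (depth c).+1
  end.

Lemma time_boundP K c : 0 < K -> time_bound K c <= weight c * K ^ depth c.
Proof.
move=> K0; have mono w d d' : d <= d' -> w * K ^ d <= w * K ^ d'.
  by move=> dd; rewrite leq_mul2l leq_pexp2l ?orbT.
have lift w d : w <= w * K ^ d by rewrite leq_pmulr // expn_gt0 K0.
elim: c => [|a i e|c1 IH1 c2 IH2|e c1 IH1 c2 IH2|x b c IH].
- by [].
- by rewrite muln1.
- rewrite [weight _]/= mulnDl; apply: leq_add.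
    by apply: leq_trans IH1 (mono _ _ _ _); apply: leq_maxl.
  by apply: leq_trans IH2 (mono _ _ _ _); apply: leq_maxr.
- rewrite [weight _]/= !mulnDl; apply: leq_add; first exact: lift.
  apply: leq_add.
    by apply: leq_trans IH1 (mono _ _ _ _); apply: leq_maxl.
  by apply: leq_trans IH2 (mono _ _ _ _); apply: leq_maxr.
rewrite [weight _]/= [time_bound _ _]/= [depth _]/=.
set w := (cost b + 2).+2; rewrite !mulnDl; apply: leq_add; first exact: lift.
apply: leq_add; last exact: lift.
rewrite mulnDr mulnDr; apply: leq_add; first by rewrite expnS mulnCA leq_mul2l lift orbT.
apply: leq_add; first by rewrite expnS mulnCA leq_mul2l IH orbT.
by rewrite expnS mulnCA leq_mul2l lift orbT.
Qed.

(* Reading another array than the updated one is convertible to no update. *)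
Ltac stable := solve [let H := fresh in move=> ? ? ? H; exact H].

(* Array 3 holds the offsets [u * n] of the rows. *)
Notation Cell a u v := (EGet a (EAdd (EGet 3 u) v)).
Notation PutCell a u v e := (CPut a (EAdd (EGet 3 u) v) e).
Notation nE := (EGet 0 (ECst 0)).

(** * Programs that rank twins and mark representative pairs *)

Definition row_cmd : cmd := CFor 10 nE (CPut 3 (EAdd (Var 10) (ECst 1)) (EAdd (EGet 3 (Var 10)) nE)).

(** Truncated subtraction in both directions gives absolute differences; their sum over all [w]
    vanishes exactly for twins. *)
Definition diff_cmd : cmd :=
  CFor 10 nE (CFor 11 nE (CFor 12 nE
    (PutCell 4 (Var 10) (Var 11)
      (EAdd (Cell 4 (Var 10) (Var 11))
        (EAdd
          (EAdd (ESub (Cell 1 (Var 10) (Var 12)) (Cell 1 (Var 11) (Var 12)))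
                (ESub (Cell 1 (Var 11) (Var 12)) (Cell 1 (Var 10) (Var 12))))
          (EAdd (ESub (Cell 1 (Var 12) (Var 10)) (Cell 1 (Var 12) (Var 11)))
                (ESub (Cell 1 (Var 12) (Var 11)) (Cell 1 (Var 12) (Var 10))))))))).

Definition rank_cmd : cmd :=
  CFor 10 nE (CFor 11 nE
    (CIf (ESub (Var 10) (Var 11))
      (CIf (Cell 4 (Var 11) (Var 10)) CSkip
        (CPut 5 (Var 10) (EAdd (EGet 5 (Var 10)) (ECst 1)))) CSkip)).

Definition first_cmd : cmd :=
  CFor 10 nE (CIf (EGet 5 (Var 10)) CSkip (CPut 6 (ECst 0) (EAdd (Var 6) (ECst 1)))).

(** [rep_bound q] is twice q (q + 1), plus 11. The loops add 2 in each of q (q + 1) rounds, and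
    [rep_cmd] supplies the 11. *)
Definition threshold_cmd : cmd :=
  CFor 10 (Var 6) (CFor 11 (EAdd (Var 6) (ECst 1))
    (CPut 7 (ECst 0) (EAdd (Var 7) (ECst 2)))).

(** Each marked pair doubles array 9, which thus becomes the number of sets of marked pairs. *)
Definition rep_cmd : cmd :=
  CSeq (CPut 9 (ECst 0) (ECst 1))
  (CFor 10 nE (CFor 11 nE
    (CIf (ESub (EAdd (Var 7) (ECst 11)) (EGet 5 (Var 10)))
      (CIf (ESub (EAdd (Var 7) (ECst 11)) (EGet 5 (Var 11)))
        (CSeq (PutCell 8 (Var 10) (Var 11) (ECst 1)) (CPut 9 (ECst 0) (EAdd (Var 9) (Var 9))))
        CSkip) CSkip))).

Section Stages.
Variables (n B : nat) (E : {set 'I_n * 'I_n}).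
Implicit Types (u v w : 'I_n) (m : memory).

Definition input_ok m : Prop :=
  [/\ m 0 0 = n, m 0 1 = B & forall u v, m 1 (u * n + v) = ((u, v) \in E)].
Definition rows_ok m : Prop := forall k, k <= n -> m 3 k = k * n.

Lemma cell_inj u v u' v' : (u * n + v == u' * n + v') = (u == u') && (v == v').
Proof.
have n0 : 0 < n by apply: leq_ltn_trans (ltn_ord u).
apply/eqP/andP => [e|[/eqP -> /eqP ->] //].
have eu := congr1 (fun k => k %/ n) e; have ev := congr1 (fun k => k %% n) e.
rewrite /= !divnMDl // !divn_small // !addn0 in eu.
by rewrite /= !modnMDl !modn_small // in ev; rewrite -!val_eqE /= eu ev !eqxx.
Qed.

Lemma pos_lt u v u' v' : (u * n + v < (u' * n + v').+1) =
  (u * n + v < u' * n + v') || (u == u') && (v == v').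
Proof. by rewrite ltnS leq_eqVlt orbC cell_inj. Qed.

Lemma pos_max u v : u * n + v < n * n.
Proof.
apply: leq_trans (_ : u * n + n <= _); first by rewrite ltn_add2l.
by rewrite addnC -mulSn leq_mul2r ltn_ord orbT.
Qed.

Lemma row_spec m : m 0 0 = n -> m 3 0 = 0 -> rows_ok (run row_cmd m).
Proof.
move=> mn m3; apply: (@run_for1 10 nE _ m n (fun i m => forall k, k <= i -> m 3 k = k * n)) => //.
  by move=> k; rewrite leqn0 => /eqP ->.
move=> i m' _ fr xi IH k ki; rewrite /= xi (fr 0) // mn /upd /= addn1.
case: eqP => [->|ne]; first by rewrite IH // mulSn addnC.
by apply: IH; move: ki; rewrite leq_eqVlt => /orP[/eqP /ne|].
Qed.

Lemma diff_spec m : input_ok m -> rows_ok m ->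
  (forall u v, m 4 (u * n + v) = 0) ->
  forall u v, (run diff_cmd m 4 (u * n + v) == 0) = twin E u v.
Proof.
move=> [mn mB mA] mr m4.
pose d a b c e := ((a - b) + (b - a) + ((c - e) + (e - c)))%N.
pose T u v w := d ((u, w) \in E : nat) ((v, w) \in E : nat) ((w, u) \in E : nat) ((w, v) \in E : nat).
pose S (k : nat) u v := \sum_(w < n | w < k) T u v w.
have ST u v : (S n u v == 0) = twin E u v.
  rewrite sum_nat_eq0 /twin; apply/forall_inP/andP => [h0|[h1 h2] w _].
    split; apply/forallP=> w; have := h0 w (ltn_ord w); rewrite /T /d;
    by case: (_ \in _); case: (_ \in _); case: (_ \in _); case: (_ \in _).
  by rewrite /T /d (eqP (forallP h1 w)) (eqP (forallP h2 w)) !subnn.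
pose I p m' := forall u v, m' 4 (u * n + v) = if u * n + v < p then S n u v else 0.
suff h : I (n * n) (run diff_cmd m) by move=> u v; rewrite h pos_max ST.
apply: run_for2; try stable; rewrite //; first by move=> m' fr; rewrite /= fr.
move=> u v m1 fr1 x1 y1 H1.
pose I2 k m' := forall u' v', m' 4 (u' * n + v') =
  m1 4 (u' * n + v') + (if (u' == u) && (v' == v) then S k u v else 0).
set inner := CFor 12 _ _; suff H2 : I2 n (run inner m1).
  move=> u' v'; rewrite H2 H1 pos_lt; case: (boolP (_ && _)) => [/andP[/eqP -> /eqP ->]|_].
    by rewrite ltnn /= add0n.
  by rewrite orbF addn0.
apply: (@run_for1 12 nE _ m1 n I2); try stable; rewrite //; first by rewrite /= fr1.
  by move=> u' v'; rewrite /S big_pred0 // if_same addn0.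
move=> k m2 ltk fr2 x2 H2 u' v'; pose w := Ordinal ltk.
have m23 a : a <= n -> m2 3 a = a * n by move=> an; rewrite fr2 // fr1 // mr.
have m21 (a b : 'I_n) : m2 1 (a * n + b) = ((a, b) \in E) by rewrite fr2 // fr1 // mA.
rewrite /= x2 (fr2 10) // (fr2 11) // x1 y1 !m23 ?(ltnW (ltn_ord _)) ?(ltnW ltk) //.
rewrite -[k]/(w : nat) !m21 /upd /= cell_inj.
case: (boolP (_ && _)) => [/andP[/eqP -> /eqP ->]|nuv]; last first.
  by rewrite H2 (negPf nuv).
rewrite H2 !eqxx /= -addnA; congr (_ + _).
rewrite /S [RHS](bigD1 w) //= addnC; congr (_ + _); apply: eq_bigl => w'.
by rewrite ltnS andbC ltn_neqAle.
Qed.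

Lemma rank_spec m : m 0 0 = n -> rows_ok m ->
  (forall u v, (m 4 (u * n + v) == 0) = twin E u v) -> (forall u, m 5 u = 0) ->
  forall u, run rank_cmd m 5 u = trank E u.
Proof.
move=> mn mr m4 m5.
pose S (k : nat) u := #|[set w : 'I_n | (w < k) && ((w < u) && twin E w u)]|.
have SE u : S n u = trank E u by apply: eq_card => w; rewrite !inE ltn_ord.
pose I p m' := forall u, m' 5 u = if u < p then trank E u else 0.
suff h : I n (run rank_cmd m) by move=> u; rewrite h ltn_ord.
apply: (@run_for1 10 nE _ m n I); try stable; rewrite //.
move=> i m1 lti fr1 x1 H1; pose v := Ordinal lti.
pose I2 k m' := forall u, m' 5 u = if u == v then S k v else m1 5 u.
set inner := CFor 11 _ _; suff H2 : I2 n (run inner m1).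
  move=> u; rewrite H2 SE H1 -val_eqE /= ltnS.
  by case: (ltngtP (u : nat) i) => // e; congr (trank E _); apply/esym/val_inj.
apply: (@run_for1 11 nE _ m1 n I2); try stable; rewrite //; first by rewrite /= fr1.
  move=> u; case: eqP => // ->; rewrite H1 ltnn; apply/esym/eqP.
  by rewrite cards_eq0 -subset0; apply/subsetP=> w; rewrite inE.
move=> k m2 ltk fr2 x2 H2 u; pose w := Ordinal ltk.
have m2_10 : m2 10 0 = i by rewrite fr2.
have m2_3 : m2 3 k = k * n by rewrite fr2 // fr1 // mr // ltnW.
have m2_4 : m2 4 (k * n + i) == 0 = twin E w v by rewrite fr2 // fr1 // -m4.
have Sk : S k.+1 v = S k v + ((k < i) && twin E w v).
  rewrite /S [LHS](cardsD1 w) inE ltnSn /= addnC; congr (_ + _).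
  by apply: eq_card => a; rewrite !inE ltnS [a < k]ltn_neqAle -andbA.
rewrite /= m2_10 x2 m2_3 subn_eq0 -ltnNge -m2_4 in Sk *.
case: ltnP Sk => ki Sk /=; last by rewrite H2 Sk addn0.
case: eqP Sk => e Sk /=; last by rewrite H2 Sk addn0.
rewrite /upd /=; have := H2 u; rewrite -(val_eqE u v) /= => H2u.
case: eqP H2u => [_ _|_ ->] //; have := H2 v; rewrite eqxx /= => ->.
by rewrite Sk.
Qed.

Lemma first_spec m : m 0 0 = n -> (forall u, m 5 u = trank E u) -> m 6 0 = 0 ->
  run first_cmd m 6 0 = nfirst E.
Proof.
move=> mn m5 m6; pose S (k : nat) := #|[set u : 'I_n | (u < k) && (trank E u == 0)]|.
have SE : S n = nfirst E by apply: eq_card => w; rewrite !inE ltn_ord.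
rewrite -SE; apply: (@run_for1 10 nE _ m n (fun k m' => m' 6 0 = S k)); try stable; rewrite //.
  rewrite m6; apply/esym/eqP.
  by rewrite cards_eq0 -subset0; apply/subsetP=> w; rewrite inE.
move=> k m1 ltk fr1 x1 H1; pose w := Ordinal ltk.
have Sk : S k.+1 = S k + (trank E w == 0).
  rewrite /S [LHS](cardsD1 w) inE ltnSn /= addnC; congr (_ + _).
  by apply: eq_card => a; rewrite !inE ltnS [a < k]ltn_neqAle -andbA.
have m1_5 : m1 5 k = trank E w by rewrite fr1 // -m5.
rewrite /= x1 m1_5 Sk; case: eqP => _ /=; first by rewrite /upd /= H1.
by rewrite H1 addn0.
Qed.

Lemma threshold_spec m q : m 6 0 = q -> m 7 0 = 0 ->
  run threshold_cmd m 7 0 + 11 = rep_bound q.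
Proof.
move=> m6 m7; have -> : rep_bound q = q * (q.+1 * 2) + 11.
  by rewrite /rep_bound -mulnn; lia.
congr (_ + _).
apply: (@run_for1 10 _ _ m q (fun k m' => m' 7 0 = k * (q.+1 * 2))); try stable; rewrite //.
move=> i m1 lti fr1 x1 H1; rewrite mulSn addnC -H1.
apply: (@run_for1 11 _ _ m1 q.+1 (fun k m' => m' 7 0 = m1 7 0 + k * 2)); try stable; rewrite //.
- by rewrite /= fr1 // m6 addn1.
- by rewrite addn0.
move=> j m2 ltj fr2 x2 H2; rewrite /= /upd /= H2 mulSn; lia.
Qed.

End Stages.

(** Array 13 is a shift register loaded with the code of a set of marked pairs; subtracting twice
    its half leaves the lowest bit. *)
Definition decode_cmd : cmd :=
  CSeq (CPut 13 (ECst 0) (Var 20))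
  (CFor 10 nE (CFor 11 nE
    (CIf (Cell 8 (Var 10) (Var 11))
      (CSeq (PutCell 14 (Var 10) (Var 11) (ESub (Var 13) (EAdd (EHalf (Var 13)) (EHalf (Var 13)))))
            (CPut 13 (ECst 0) (EHalf (Var 13))))
      (PutCell 14 (Var 10) (Var 11) (ECst 0))))).

(** 1 - (1 - x) truncates x to a bit, and the last summand, 1 minus the distance of the indices,
    adds the diagonal. *)
Definition union_cmd : cmd :=
  CFor 10 nE (CFor 11 nE
    (PutCell 15 (Var 10) (Var 11)
      (ESub (ECst 1) (ESub (ECst 1)
        (EAdd (EAdd (Cell 1 (Var 10) (Var 11)) (Cell 14 (Var 10) (Var 11)))
              (ESub (ECst 1) (EAdd (ESub (Var 10) (Var 11)) (ESub (Var 11) (Var 10))))))))).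

Definition warshall_cmd : cmd :=
  CFor 12 nE (CFor 10 nE (CFor 11 nE
    (CIf (Cell 15 (Var 10) (Var 12))
      (CIf (Cell 15 (Var 12) (Var 11)) (PutCell 15 (Var 10) (Var 11) (ECst 1)) CSkip) CSkip))).

Definition closure_cmd : cmd := CSeq union_cmd warshall_cmd.

(** An edge present in both arrays counts twice, but only the vanishing of a degree matters. *)
Definition degree_cmd : cmd :=
  CFor 10 nE (CSeq (CPut 16 (Var 10) (ECst 0)) (CSeq (CPut 17 (Var 10) (ECst 0))
    (CFor 11 nE (CSeq
      (CPut 16 (Var 10) (EAdd (EGet 16 (Var 10))
         (EAdd (Cell 1 (Var 10) (Var 11)) (Cell 14 (Var 10) (Var 11)))))
      (CPut 17 (Var 10) (EAdd (EGet 17 (Var 10))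
         (EAdd (Cell 1 (Var 11) (Var 10)) (Cell 14 (Var 11) (Var 10))))))))).

(** * Evaluating a candidate *)

Section Pieces.
Variables (n B : nat) (E : {set 'I_n * 'I_n}).
Implicit Types (u v w : 'I_n) (m : memory) (X N : {set 'I_n * 'I_n}).

Definition pos (e : 'I_n * 'I_n) : nat := e.1 * n + e.2.

Lemma pos_inj : injective pos.
Proof. by move=> [a b] [c d] /eqP; rewrite /pos /= cell_inj => /andP[/eqP -> /eqP ->]. Qed.

Definition cnt X (p : nat) : nat := #|[set e in X | pos e < p]|.

Lemma cnt0 X : cnt X 0 = 0.
Proof. by apply/eqP; rewrite cards_eq0 -subset0; apply/subsetP=> e; rewrite !inE andbF. Qed.

Lemma cnt_step X u v : cnt X (u * n + v).+1 = cnt X (u * n + v) + ((u, v) \in X).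
Proof.
rewrite /cnt [LHS](cardsD1 (u, v)) inE /pos ltnSn andbT addnC; congr (_ + _).
apply: eq_card => -[a b]; rewrite !inE /= pos_lt xpair_eqE.
case: (boolP ((a == u) && (b == v))) => [/andP[/eqP -> /eqP ->]|_] /=; first by rewrite ltnn andbF.
by rewrite orbF.
Qed.

Lemma cnt_max X : cnt X (n * n) = #|X|.
Proof. by apply: eq_card => -[a b]; rewrite !inE /pos pos_max andbT. Qed.

Lemma cnt_mono X e e' : e \in X -> pos e < pos e' -> cnt X (pos e) < cnt X (pos e').
Proof.
move=> eX lt; apply/proper_card/properP; split.
  by apply/subsetP=> f; rewrite !inE => /andP[->]; move/ltn_trans; apply.
by exists e; rewrite !inE eX ?lt // ltnn.
Qed.

Lemma cnt_lt X e : e \in X -> cnt X (pos e) < #|X|.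
Proof.
move=> eX; rewrite -cnt_max; apply/proper_card/properP; split.
  by apply/subsetP=> -[a b]; rewrite !inE => /andP[-> _]; rewrite /pos pos_max.
by exists e; rewrite !inE eX ?ltnn //; case: (e) => a b; rewrite /pos pos_max.
Qed.

Lemma bits_exist (f : nat -> bool) K : exists2 c, c < 2 ^ K &
  forall k, k < K -> odd (c %/ 2 ^ k) = f k.
Proof.
elim: K f => [|K IH] f; first by exists 0.
case: (IH (fun k => f k.+1)) => c cK cP; exists (f 0 + c.*2).
  by rewrite expnS mul2n -addnn; case: (f 0); lia.
move=> [|k] kK; first by rewrite expn0 divn1 oddD odd_double addbF; case: (f 0).
by rewrite expnS divnMA divn2 half_bit_double cP.
Qed.

(** Bit i of the code decides on the i-th element of [X] in row order, the order in which
    [decode_cmd] shifts the bits out. *)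
Definition decoded X c := [set e in X | odd (c %/ 2 ^ cnt X (pos e))].

Lemma decoded_exists X N : N \subset X -> exists2 c, c < 2 ^ #|X| & decoded X c = N.
Proof.
move=> NX.
case: (bits_exist (fun k => [exists e in N, cnt X (pos e) == k]) #|X|) => c cX cP.
exists c => //; apply/setP=> e; rewrite inE; case: (boolP (e \in X)) => eX /=; last first.
  by apply/esym/negP=> /(subsetP NX); rewrite (negPf eX).
rewrite cP ?cnt_lt //; apply/existsP/idP => [[e' /andP[eN' /eqP h]]|eN]; last first.
  by exists e; rewrite eN eqxx.
suff -> : e = e' by []; apply: pos_inj; have eX' := subsetP NX _ eN'.
case: (ltngtP (pos e) (pos e')) => // lt.
  by have := cnt_mono eX lt; rewrite h ltnn.
by have := cnt_mono eX' lt; rewrite h ltnn.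
Qed.

Definition matrix_set m a : {set 'I_n * 'I_n} := [set e | m a (pos e) != 0].

Definition rep_pairs R := [set e | (trank E e.1 < R) && (trank E e.2 < R)].

Lemma rep_spec m R : m 0 0 = n -> rows_ok n m -> (forall u, m 5 u = trank E u) ->
  m 7 0 + 11 = R -> (forall u v, m 8 (u * n + v) = 0) ->
  (forall e, run rep_cmd m 8 (pos e) = (e \in rep_pairs R)) /\
  run rep_cmd m 9 0 = 2 ^ #|rep_pairs R|.
Proof.
move=> mn mr m5 m7 m8; set X := rep_pairs R; rewrite -(cnt_max X).
pose I p m' := (forall e, m' 8 (pos e) = (pos e < p) && (e \in X)) /\ m' 9 0 = 2 ^ cnt X p.
suff [h1 ->] : I (n * n) (run rep_cmd m).
  by split=> // -[u v]; rewrite h1 /pos /= pos_max.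
rewrite /rep_cmd run_seq run_put; set m0 := upd m 9 _ _.
have fr0 a j : a != 9 -> m0 a j = m a j by move=> h; rewrite /m0 upd_other.
apply: (@run_for2 n 10 11 nE _ m0 I); try stable; rewrite //.
- by move=> m' fr; rewrite /= fr // fr0.
- split; last by rewrite cnt0.
  by move=> [u v]; rewrite /m0 /upd /= m8.
move=> u v m1 fr1 x1 y1 [H1 H2].
have m13 : m1 3 u = u * n by rewrite fr1 // fr0 // mr // ltnW.
have m15 w : m1 5 w = trank E w by rewrite fr1 // fr0 // m5.
have m17 : m1 7 0 + 11 = R by rewrite fr1 // fr0.
have X1 : ((u, v) \in X) = (trank E u < R) && (trank E v < R) by rewrite inE.
rewrite /= x1 y1 m13 m17 !m15 !subn_eq0 -!ltnNge.
have other : (u, v) \notin X -> I (u * n + v).+1 m1.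
  move=> nX; split; last by rewrite cnt_step (negPf nX) addn0.
  move=> [a b]; rewrite H1 /pos pos_lt; case: (boolP ((a == u) && (b == v))) => [/andP[/eqP -> /eqP ->]|_]; last by rewrite orbF.
  by rewrite (negPf nX) !andbF.
case: ifP => ru; last by apply: other; rewrite X1 ru.
case: ifP => rv; last by apply: other; rewrite X1 rv andbF.
have uvX : (u, v) \in X by rewrite X1 ru rv.
split; last by rewrite /upd /= H2 cnt_step uvX addn1 expnS mul2n addnn.
move=> [a b]; rewrite /upd /= /pos cell_inj pos_lt H1 /pos /=.
case: (boolP ((a == u) && (b == v))) => [/andP[/eqP -> /eqP ->]|_]; last by rewrite orbF.
by rewrite ltnn uvX.
Qed.

Lemma decode_spec m X c : m 0 0 = n -> rows_ok n m -> m 20 0 = c ->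
  (forall e, m 8 (pos e) = (e \in X)) ->
  matrix_set (run decode_cmd m) 14 = decoded X c.
Proof.
move=> mn mr mc m8.
pose I p m' := (forall e, pos e < p -> m' 14 (pos e) = (e \in decoded X c)) /\
  m' 13 0 = c %/ 2 ^ cnt X p.
suff [h _] : I (n * n) (run decode_cmd m).
  apply/setP=> -[u v]; rewrite inE h; last by rewrite /pos pos_max.
  by case: (_ \in _).
rewrite /decode_cmd run_seq run_put; set m0 := upd m 13 _ _.
have fr0 a j : a != 13 -> m0 a j = m a j by move=> h; rewrite /m0 upd_other.
apply: (@run_for2 n 10 11 nE _ m0 I); try stable; rewrite //.
- by move=> m' fr; rewrite /= fr // fr0.
- by split=> //; rewrite cnt0 divn1 /m0 /upd.
move=> u v m1 fr1 x1 y1 [H1 H2].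
have m13 : m1 3 u = u * n by rewrite fr1 // fr0 // mr // ltnW.
have m18 : m1 8 (u * n + v) = ((u, v) \in X) by rewrite fr1 // fr0 // -m8.
have D1 : ((u, v) \in decoded X c) = ((u, v) \in X) && odd (c %/ 2 ^ cnt X (u * n + v)).
  by rewrite inE.
rewrite /= x1 y1 m13 m18 eqb0 negbK; case: (boolP ((u, v) \in X)) => uvX /=; split.
- move=> [a b]; rewrite /upd /= /pos cell_inj pos_lt /=.
  case: (boolP ((a == u) && (b == v))) => [/andP[/eqP -> /eqP ->] _|_]; last by rewrite orbF => /(H1 (a, b)).
  rewrite D1 uvX H2 /=; move: (c %/ _) => y.
  by rewrite -[X in X - _]odd_double_half addnn addnK.
- by rewrite /upd /= H2 cnt_step uvX addn1 expnSr divnMA divn2.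
- move=> [a b]; rewrite /upd /= /pos cell_inj pos_lt /=.
  case: (boolP ((a == u) && (b == v))) => [/andP[/eqP -> /eqP ->] _|_]; last by rewrite orbF => /(H1 (a, b)).
  by rewrite D1 (negPf uvX).
by rewrite /upd /= H2 cnt_step (negPf uvX) addn0.
Qed.

Lemma closure_spec m : input_ok B E m -> rows_ok n m ->
  forall u v, run closure_cmd m 15 (u * n + v) = conn (E :|: matrix_set m 14) u v.
Proof.
move=> [mn mB mA] mr; set N := matrix_set m 14; set H := E :|: N.
pose d0 u v := ((u, v) \in H) || (u == v).
have init : forall u v, run union_cmd m 15 (u * n + v) = d0 u v.
  pose I p m' := forall u v, u * n + v < p -> m' 15 (u * n + v) = d0 u v.
  suff h : I (n * n) (run union_cmd m) by move=> u v; apply: h; apply: pos_max.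
  apply: (@run_for2 n 10 11 nE _ m I); try stable; rewrite //.
    by move=> m' fr; rewrite /= fr.
  move=> u v m1 fr1 x1 y1 H1 a b; rewrite pos_lt.
  have m13 : m1 3 u = u * n by rewrite fr1 // mr // ltnW.
  have m11 : m1 1 (u * n + v) = ((u, v) \in E) by rewrite fr1.
  have m114 : m1 14 (u * n + v) = m 14 (u * n + v) by rewrite fr1.
  rewrite /= x1 y1 m13 m11 m114 /upd /= cell_inj.
  case: (boolP ((a == u) && (b == v))) => [/andP[/eqP -> /eqP ->] _|_]; last by rewrite orbF; apply: H1.
  rewrite /d0 in_setU [_ \in N]inE /pos /= -(val_eqE u v) /=.
  move: (m 14 _) => k; case: ((u, v) \in E); case: k => [|k]; rewrite ?add0n //=.
  by case: (ltngtP (u : nat) v) => [lt|lt|->]; rewrite ?subnn //; lia.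
rewrite /closure_cmd; set m0 := run union_cmd m.
have fr0 a j : a \notin writes union_cmd -> m0 a j = m a j by apply: run_frame.
(* Warshall's invariant: [d] lies between [H] and its closure and is transitive through every vertex
   below [k]. *)
pose good k (d : rel 'I_n) := [/\ forall u, d u u, forall u v, (u, v) \in H -> d u v,
  forall u v, d u v -> conn H u v &
  forall w, w < k -> forall u v, d u w -> d w v -> d u v].
pose I k m' := exists2 d : rel 'I_n, forall u v, m' 15 (u * n + v) = d u v & good k d.
suff [d dm [dr dE dc dt]] : I n (run warshall_cmd m0).
  move=> u v; rewrite run_seq dm; congr nat_of_bool; apply/idP/idP; first exact: dc.
  move=> /connectP[p]; elim: p u => [u _ -> //|x p IH u /= /andP[ux xp] vE].
  by apply: (dt x (ltn_ord x)); [apply: dE | apply: IH].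
apply: (@run_for1 12 nE _ m0 n I); try stable; rewrite //; first by rewrite /= fr0.
  exists d0; first exact: init.
  split=> [u|u v|u v|] //; rewrite /d0 ?eqxx ?orbT //; first by move=> ->.
  by case/orP=> [/conn_edge //|/eqP ->]; apply: connect0.
move=> k m1 ltk fr1 x1 [d dm [dr dE dc dt]]; pose w := Ordinal ltk.
pose d' u v := d u v || d u w && d w v.
pose J p m' := forall u v, m' 15 (u * n + v) = d u v || [&& u * n + v < p, d u w & d w v].
have d'P : J (n * n) (run (CFor 10 nE (CFor 11 nE
    (CIf (Cell 15 (Var 10) (Var 12))
      (CIf (Cell 15 (Var 12) (Var 11)) (PutCell 15 (Var 10) (Var 11) (ECst 1)) CSkip) CSkip))) m1).
  apply: (@run_for2 n 10 11 nE _ m1 J); try stable; rewrite //.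
  - by move=> m' fr; rewrite /= fr // fr1 // fr0.
  - by move=> u v; rewrite dm orbF.
  move=> u v m2 fr2 x2 y2 H2.
  have m23 a : a <= n -> m2 3 a = a * n by move=> an; rewrite fr2 // fr1 // fr0 // mr.
  have m2w : m2 12 0 = w by rewrite fr2.
  (* Updating in place is safe, since row and column [w] do not change in round [w]. *)
  have du : m2 15 (u * n + w) = d u w by rewrite H2 dr; case: (d u w); rewrite ?andbF.
  have dv : m2 15 (w * n + v) = d w v by rewrite H2 dr; case: (d w v); rewrite ?andbF.
  rewrite /= x2 y2 m2w !m23 ?(ltnW (ltn_ord _)) // du dv !eqb0 !negbK.
  case: (boolP (d u w)) => duw; last first.
    move=> a b; rewrite H2 pos_lt; case: (boolP ((a == u) && (b == v))) => [/andP[/eqP -> /eqP ->]|_]; last by rewrite orbF.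
    by rewrite (negPf duw) /= !andbF.
  case: (boolP (d w v)) => dwv; last first.
    move=> a b; rewrite H2 pos_lt; case: (boolP ((a == u) && (b == v))) => [/andP[/eqP -> /eqP ->]|_]; last by rewrite orbF.
    by rewrite (negPf dwv) /= !andbF.
  move=> a b; rewrite /upd /= cell_inj pos_lt.
  case: (boolP ((a == u) && (b == v))) => [/andP[/eqP -> /eqP ->]|_]; last by rewrite H2 orbF.
  by rewrite duw dwv orbT orbT.
exists d'; first by move=> u v; rewrite d'P pos_max.
split.
- by move=> u; rewrite /d' dr.
- by move=> u v /dE; rewrite /d' => ->.
- move=> u v; rewrite /d' => /orP[/dc //|/andP[/dc h1 /dc h2]].
  exact: connect_trans h1 h2.
move=> x; rewrite ltnS leq_eqVlt => /orP[/eqP xk|xk] u v.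
  have -> : x = w by apply: val_inj.
  by rewrite /d' dr andbT /= orbb => -> /orP[|] ->; rewrite ?orbT // dr.
rewrite /d' => /orP[h1|/andP[h1 h2]] /orP[h3|/andP[h3 h4]].
- by rewrite (dt x xk u v).
- by rewrite (dt x xk u w h1 h3) h4 orbT.
- by rewrite h1 (dt x xk w v h2 h3) orbT.
- by rewrite h1 h4 orbT.
Qed.

Lemma degree_spec m : input_ok B E m -> rows_ok n m -> forall u,
  (run degree_cmd m 16 u == 0) = sink (E :|: matrix_set m 14) u /\
  (run degree_cmd m 17 u == 0) = source (E :|: matrix_set m 14) u.
Proof.
move=> [mn mB mA] mr; set H := E :|: _.
have HE u v : (m 1 (u * n + v) + m 14 (u * n + v) == 0) = ((u, v) \notin H).
  by rewrite mA in_setU inE negb_or negbK addn_eq0; case: (_ \in E).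
pose I k m' := forall u, u < k -> (m' 16 u == 0) = sink H u /\ (m' 17 u == 0) = source H u.
suff h : I n (run degree_cmd m) by move=> u; apply: h.
apply: (@run_for1 10 nE _ m n I); try stable; rewrite //.
move=> k m1 ltk fr1 x1 H1; pose u := Ordinal ltk.
rewrite !run_seq !run_put; set m2 := upd (upd m1 _ _ _) _ _ _.
have m2x : m2 10 0 = k by rewrite /m2 /upd.
have fr2 a j : a \notin [:: 16; 17] -> m2 a j = m1 a j.
  by rewrite !inE negb_or => /andP[h1 h2]; rewrite /m2 !upd_other.
pose J l m' := [/\ (m' 16 k == 0) = [forall v : 'I_n, (v < l) ==> ((u, v) \notin H)],
  (m' 17 k == 0) = [forall v : 'I_n, (v < l) ==> ((v, u) \notin H)] &
  forall v, v < k -> m' 16 v = m1 16 v /\ m' 17 v = m1 17 v].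
set inner := CFor 11 _ _.
have [h1 h2 h3] : J n (run inner m2).
  apply: (@run_for1 11 nE _ m2 n J); try stable; rewrite //.
  - by rewrite /= fr2 // fr1.
  - rewrite /J /m2 /upd /= x1 eqxx; split.
    + by apply/esym/forallP=> v.
    + by apply/esym/forallP=> v.
    by move=> v vk; rewrite (ltn_eqF vk).
  move=> l m3 ltl fr3 x3 [g1 g2 g3]; pose v := Ordinal ltl.
  have m3x : m3 10 0 = k by rewrite fr3.
  have m33 a : a <= n -> m3 3 a = a * n by move=> an; rewrite fr3 // fr2 // fr1 // mr.
  have m3c a b : m3 1 (a * n + b) + m3 14 (a * n + b) = m 1 (a * n + b) + m 14 (a * n + b).
    by rewrite !fr3 // !fr2 // !fr1.
  have step (P : pred 'I_n) : [forall w : 'I_n, (w < l.+1) ==> P w] = [forall w : 'I_n, (w < l) ==> P w] && P v.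
    apply/forallP/andP => [h|[/forallP h Pv] w].
      split; last by have := h v; rewrite ltnSn.
      by apply/forallP=> w; apply/implyP=> wl; have := h w; rewrite (ltn_trans wl (ltnSn _)).
    rewrite ltnS leq_eqVlt; apply/implyP=> /orP[/eqP e|wl]; last by have := h w; rewrite wl.
    by rewrite (_ : w = v) //; apply: val_inj.
  rewrite /J /= !step -!HE -[v : nat]/l -[u : nat]/k -g1 -g2 /upd /= m3x x3 !eqxx /=.
  rewrite -?[nat_of_ord v]/l !m33 ?(ltnW ltk) ?(ltnW ltl) // !m3c; split.
  + by rewrite addn_eq0.
  + by rewrite addn_eq0.
  move=> w wk; rewrite (ltn_eqF wk); exact: g3.
move=> w; rewrite ltnS leq_eqVlt => /orP[/eqP e|wk].
  have -> : w = u by apply: val_inj.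
  rewrite -[u : nat]/k h1 h2; split; apply: eq_forallb => v; by rewrite ltn_ord.
by case: (h3 w wk) => -> ->; apply: H1.
Qed.

End Pieces.

Notation Push a k e := (CSeq (CPut a (Var k) e) (CPut k (ECst 0) (EAdd (Var k) (ECst 1)))).
Notation lenE := (EAdd (EAdd nE nE) (ECst 1)).

(** Prefilling with [t0] and [s0] imitates the defaults of [nth]; 2 n + 1 cells suffice for
    [(z + k).+1] links with [z] and [k] at most n. *)
Definition clear_cmd : cmd :=
  CFor 10 lenE (CSeq (CPut 18 (Var 10) (Var 21)) (CPut 19 (Var 10) (Var 22))).

Definition loose_cmd : cmd :=
  CFor 10 nE (CIf (EAdd (EGet 16 (Var 10)) (EGet 17 (Var 10))) CSkip
    (CIf (ESub (Var 23) (Var 26)) (CSeq (Push 18 25 (Var 10)) (Push 19 26 (Var 10))) CSkip)).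

Definition ends_cmd : cmd :=
  CFor 10 nE (CSeq
    (CIf (EGet 16 (Var 10)) CSkip (CIf (Cell 15 (Var 21) (Var 10)) (Push 18 25 (Var 10)) CSkip))
    (CIf (EGet 17 (Var 10)) CSkip (CIf (Cell 15 (Var 10) (Var 21)) (Push 19 26 (Var 10)) CSkip))).

(** The tails start at cell 1, as cell 0 keeps the prefilled [t0]. Skipping one cell of the heads
    after the isolated vertices likewise leaves [s0] in place. *)
Definition list_cmd : cmd :=
  CSeq clear_cmd (CSeq (CPut 25 (ECst 0) (ECst 1)) (CSeq (CPut 26 (ECst 0) (ECst 0))
  (CSeq loose_cmd (CSeq (CPut 26 (ECst 0) (EAdd (Var 26) (ECst 1))) ends_cmd)))).

(** The length of the list is tested inside a longer loop, since a bound reading 23 and 24, the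
    counters of [main_cmd], would not be well formed there. *)
Definition build_cmd : cmd :=
  CSeq (PutCell 14 (Var 21) (Var 22) (ECst 0))
  (CFor 10 lenE (CIf (ESub (EAdd (EAdd (Var 23) (Var 24)) (ECst 1)) (Var 10))
    (PutCell 14 (EGet 18 (Var 10)) (EGet 19 (Var 10)) (ECst 1)) CSkip)).

Definition count_cmd : cmd :=
  CSeq (CPut 27 (ECst 0) (ECst 0)) (CSeq (CPut 28 (ECst 0) (ECst 0)) (CSeq (CPut 29 (ECst 0) (ECst 0))
  (CFor 10 nE (CFor 11 nE
    (CSeq (CIf (Cell 14 (Var 10) (Var 11))
      (CSeq (CPut 27 (ECst 0) (EAdd (Var 27) (ECst 1)))
            (CPut 28 (ECst 0) (EAdd (Var 28) (Cell 1 (Var 10) (Var 11))))) CSkip)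
     (CPut 29 (ECst 0) (EAdd (Var 29) (Cell 15 (Var 10) (Var 11))))))))).

Definition copy_cmd : cmd :=
  CFor 10 nE (CFor 11 nE (PutCell 2 (Var 10) (Var 11) (Cell 14 (Var 10) (Var 11)))).

Definition keep_cmd : cmd :=
  CIf (EAdd (Var 28) (ESub (Var 27) (EGet 0 (ECst 1)))) CSkip
    (CIf (ESub (Var 29) (Var 30)) (CSeq (CPut 30 (ECst 0) (Var 29)) copy_cmd) CSkip).

Lemma filter_iota_step (f : pred nat) k n : k < n ->
  [seq i <- iota 0 n | f i && (i < k.+1)] = [seq i <- iota 0 n | f i && (i < k)] ++ nseq (f k) k.
Proof.
move=> kn.
have -> : iota 0 n = iota 0 k ++ k :: iota k.+1 (n - k.+1).
  by rewrite -[in LHS](subnKC (ltnW kn)) iotaD add0n -(subnSK kn).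
have low g : {in iota 0 k, (fun i => f i && (i < k.+1)) =1 g} ->
    [seq i <- iota 0 k | f i && (i < k.+1)] = [seq i <- iota 0 k | g i] by move/eq_in_filter.
have high g : {in iota k.+1 (n - k.+1), g =1 pred0} ->
    [seq i <- iota k.+1 (n - k.+1) | g i] = [::].
  by move/eq_in_filter => ->; rewrite filter_pred0.
rewrite !filter_cat /= ltnSn ltnn andbT andbF.
rewrite (low (fun i => f i && (i < k))); last first.
  by move=> i; rewrite mem_iota add0n => /andP[_ ik]; rewrite ik ltnS ltnW.
rewrite !high ?cats0; first by case: (f k).
  by move=> i; rewrite mem_iota => /andP[h _] /=; rewrite [i < k]ltnNge (ltnW h) andbF.
by move=> i; rewrite mem_iota => /andP[h _] /=; rewrite [i < k.+1]ltnNge h andbF.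
Qed.

Section Pieces2.
Variables (n B : nat) (E : {set 'I_n * 'I_n}).
Implicit Types (u v w t s : 'I_n) (m : memory) (X N : {set 'I_n * 'I_n}) (A : {set 'I_n}).
Local Notation pos := (@pos n).

Definition below A (k : nat) : seq 'I_n := [seq u <- enum 'I_n | (u \in A) && (u < k)].

Lemma below0 A : below A 0 = [::].
Proof. by rewrite /below (eq_filter (a2 := pred0)) ?filter_pred0 // => u; rewrite andbF. Qed.

Lemma below_all A : below A n = enum A.
Proof.
rewrite /below enumT /enum_mem; apply: eq_filter => u.
by rewrite ltn_ord andbT.
Qed.

Lemma below_step A u : below A u.+1 = below A u ++ nseq (u \in A) u.
Proof.
apply: (inj_map val_inj).
have H k : map val (below A k) = [seq i <- iota 0 n | [exists v in A, v == i :> nat] && (i < k)].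
  rewrite -val_enum_ord filter_map /below; congr map; apply: eq_filter => v /=.
  congr (_ && _); apply/idP/existsP => [vA|[w /andP[wA /eqP/val_inj <-]]] //.
  by exists v; rewrite vA eqxx.
rewrite map_cat !H (filter_iota_step _ (ltn_ord u)); congr (_ ++ _).
rewrite (_ : [exists v in A, v == u :> nat] = (u \in A)); first by case: (u \in A).
by apply/existsP/idP => [[w /andP[wA /eqP/val_inj <-]]|uA] //; exists u; rewrite uA eqxx.
Qed.

Definition list_at m a k (l : seq 'I_n) (d : 'I_n) : Prop :=
  m k 0 = size l /\ forall j, j < n + n + 1 -> m a j = nth d l j.

Lemma push_spec m a k (l : seq 'I_n) d e u : a != k -> eval m e = u ->
  list_at m a k l d -> list_at (run (Push a k e) m) a k (rcons l u) d.
Proof.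
move=> ak eu [h1 h2]; rewrite run_seq !run_put /= eu h1.
have -> : upd m a (size l) u k 0 = size l by rewrite upd_other // eq_sym.
split; first by rewrite size_rcons /upd !eqxx addn1.
move=> j jl; rewrite upd_other // /upd eqxx nth_rcons h2 //=.
by case: (ltngtP j (size l)) => // lt; rewrite nth_default // ltnW.
Qed.

Lemma list_spec m t s z F : m 0 0 = n -> rows_ok n m ->
  m 21 0 = t -> m 22 0 = s -> m 23 0 = z ->
  (forall u v, m 15 (u * n + v) = conn F u v) ->
  (forall u, (m 16 u == 0) = sink F u /\ (m 17 u == 0) = source F u) ->
  forall j, j < n + n + 1 ->
  run list_cmd m 18 j = nth t (t :: take z (enum (loose F)) ++ enum (low F t)) j /\
  run list_cmd m 19 j = nth s (take z (enum (loose F)) ++ s :: enum (high F t)) j.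
Proof.
move=> mn mr mt ms mz m15 m67; rewrite /list_cmd !run_seq.
set m1 := run clear_cmd m.
have fr1 a j : a \notin [:: 10; 18; 19] -> m1 a j = m a j by move=> h; apply: run_frame.
have clear j : j < n + n + 1 -> m1 18 j = t /\ m1 19 j = s.
  move: j; rewrite /m1 /clear_cmd.
  apply: (@run_for1 10 lenE _ m (n + n + 1) (fun k m' => forall j, j < k -> m' 18 j = t /\ m' 19 j = s)); try stable; rewrite //.
    by rewrite /= mn.
  move=> k m' ltk fr x1 H1 j; rewrite ltnS leq_eqVlt /= /upd /= x1 (fr 21) // (fr 22) // mt ms.
  by case: eqP => // _ /H1.
rewrite !run_put; set m2 := upd (upd m1 _ _ _) _ _ _.
have fr2 a j : a \notin [:: 25; 26] -> m2 a j = m1 a j.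
  by rewrite !inE negb_or => /andP[h1 h2]; rewrite /m2 !upd_other.
pose I k m' := list_at m' 18 25 (t :: take z (below (loose F) k)) t /\
   list_at m' 19 26 (take z (below (loose F) k)) s.
have I0 : I 0 m2.
  rewrite /I below0 /=; split; split=> // j jl; rewrite fr2 //; case: (clear j jl) => h1 h2.
    by rewrite h1; case: j {jl h1 h2} => //= j; rewrite nth_nil.
  by rewrite h2 nth_nil.
set m3 := run loose_cmd m2.
have fr3 a j : a \notin writes loose_cmd -> m3 a j = m2 a j by move=> h; apply: run_frame.
have [[k1 l1] [k2 l2]] : I n m3.
  rewrite /m3 /loose_cmd; apply: (@run_for1 10 nE _ m2 n I); try stable; rewrite //.
    by rewrite /= fr2 // fr1.
  move=> k m' ltk fr x1 [L1 L2]; pose u := Ordinal ltk.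
  have d1 : (m' 16 k + m' 17 k == 0) = (u \in loose F).
    rewrite addn_eq0 !fr // !fr2 // !fr1 //.
    by case: (m67 u) => /= -> ->; rewrite inE.
  have d2 : m' 23 0 = z by rewrite fr // fr2 // fr1.
  have d3 : m' 26 0 = size (take z (below (loose F) k)) by case: L2.
  have d4 : m' 25 0 = (size (take z (below (loose F) k))).+1 by case: L1.
  rewrite /= x1 d1 d2 d3 /I (below_step _ u) /=.
  case: (boolP (u \in loose F)) => uF /=; last by rewrite cats0; split.
  rewrite subn_eq0 -ltnNge size_take_min.
  case: (ltnP (minn z (size (below (loose F) k))) z) => lt.
    have lt' : size (below (loose F) k) < z by move: lt; rewrite gtn_min ltnn.
    have e1 : take z (below (loose F) k) = below (loose F) k by rewrite take_oversize // ltnW.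
    rewrite take_oversize; last by rewrite size_cat /= addn1.
    rewrite cats1 -rcons_cons; rewrite e1 in L1 L2 d3 d4.
    have [P1 P1'] := @push_spec m' 18 25 _ _ (Var 10) u isT x1 L1.
    pose m'' := run (Push 18 25 (Var 10)) m'.
    have [P2 P2'] : list_at (run (Push 19 26 (Var 10)) m'') 19 26 (rcons (below (loose F) k) u) s.
      by apply: push_spec.
    by split; split; [exact: P1 | move=> j jl; have := P1' j jl; rewrite /= /upd /= x1 | exact: P2 | move=> j jl; have := P2' j jl; rewrite /= /upd /=].
  have e1 : take z (below (loose F) k ++ [:: u]) = take z (below (loose F) k).
    by apply: takel_cat; move: lt; rewrite leq_min => /andP[].
  by rewrite e1; split.
set m4 := upd m3 _ _ _.
have fr4 a j : a != 26 -> m4 a j = m3 a j by move=> h; rewrite /m4 upd_other.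
rewrite below_all in k1 l1 k2 l2; set Z := take z (enum (loose F)) in k1 l1 k2 l2 *.
pose J k m' := list_at m' 18 25 (t :: Z ++ below (low F t) k) t /\
   list_at m' 19 26 (rcons Z s ++ below (high F t) k) s.
have J0 : J 0 m4.
  rewrite /J !below0 !cats0; split; split=> // [|j jl].
    by rewrite size_rcons /m4 /upd /= k2 addn1.
  rewrite /m4 /upd /= l2 // nth_rcons; case: (ltngtP j (size Z)) => // lt; last by rewrite lt nth_default.
  by rewrite nth_default // ltnW.
suff : J n (run ends_cmd m4).
  case=> -[_ h1] [_ h2] j jl; rewrite h1 // h2 // !below_all.
  by rewrite cat_rcons.
rewrite /ends_cmd; apply: (@run_for1 10 nE _ m4 n J); try stable; rewrite //.
  by rewrite /= fr4 // fr3 // fr2 // fr1.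
move=> k m' ltk fr x1 [L1 L2]; pose u := Ordinal ltk.
have m3u a : a <= n -> m' 3 a = a * n by move=> an; rewrite fr // fr4 // fr3 // fr2 // fr1 // mr.
have [d1 d2] : (m' 16 k == 0) = sink F u /\ (m' 17 k == 0) = source F u.
  by rewrite !fr // !fr4 // !fr3 // !fr2 // !fr1 //; apply: (m67 u).
have d3 : m' 15 (t * n + k) = conn F t u by rewrite fr // fr4 // fr3 // fr2 // fr1 // -m15.
have d4 : m' 15 (k * n + t) = conn F u t by rewrite fr // fr4 // fr3 // fr2 // fr1 // -m15.
have d5 : m' 21 0 = t by rewrite fr // fr4 // fr3 // fr2 // fr1.
rewrite run_seq; set c2 := CIf _ _ _; set c1 := CIf _ _ _.
have step1 : list_at (run c1 m') 18 25 (t :: Z ++ below (low F t) k.+1) t.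
  rewrite (below_step _ u) /c1 /= x1 d1 d5 m3u ?(ltnW (ltn_ord _)) // d3.
  rewrite [u \in low F t]inE.
  case: (sink F u) => /=; last by rewrite cats0.
  case: (conn F t u) => /=; last by rewrite cats0.
  have [P1 P1'] := @push_spec m' 18 25 _ _ (Var 10) u isT x1 L1.
  by rewrite catA cats1 -rcons_cons; split; [exact: P1 | move=> j jl; have := P1' j jl; rewrite /= /upd /= x1].
have fc1 a j : a \notin [:: 18; 25] -> run c1 m' a j = m' a j by move=> h; apply: run_frame.
have L2' : list_at (run c1 m') 19 26 (rcons Z s ++ below (high F t) k) s.
  by case: L2 => h1 h2; split=> [|j jl]; rewrite fc1 // h2.
move: (run c1 m') fc1 step1 L2' => m5 fc1 step1 L2'.
have fc2 a j : a \notin [:: 19; 26] -> run c2 m5 a j = m5 a j by move=> h; apply: run_frame.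
split.
  by case: step1 => h1 h2; split=> [|j jl]; rewrite fc2 // h2.
rewrite (below_step _ u) /c2 /= !fc1 // x1 d2 d5 m3u ?(ltnW ltk) // d4.
rewrite [u \in high F t]inE.
case: (source F u) => /=; last by rewrite cats0.
case: (conn F u t) => /=; last by rewrite cats0.
have x1' : eval m5 (Var 10) = u by rewrite /= fc1.
have [Q Q'] := @push_spec m5 19 26 _ _ (Var 10) u isT x1' L2'.
rewrite catA cats1; split; first exact: Q.
by move=> j jl; have := Q' j jl; rewrite /= /upd /= (fc1 10) // (fc1 26) // x1.
Qed.

Lemma build_spec m (t s : 'I_n) z k (LT LH : seq 'I_n) : m 0 0 = n -> rows_ok n m ->
  m 21 0 = t -> m 22 0 = s -> m 23 0 = z -> m 24 0 = k -> z + k <= n + n ->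
  (forall j, j < n + n + 1 -> m 18 j = nth t LT j /\ m 19 j = nth s LH j) ->
  matrix_set n (run build_cmd m) 14 = matrix_set n m 14 :\ (t, s) :|:
    [set e in mkseq (fun j => (nth t LT j, nth s LH j)) (z + k).+1].
Proof.
move=> mn mr mt ms mz mk zk mL; rewrite /build_cmd run_seq run_put.
pose f j := (nth t LT j, nth s LH j).
pose S i := matrix_set n m 14 :\ (t, s) :|: [set e in mkseq f (minn i (z + k).+1)].
rewrite -/f (_ : _ :|: _ = S (n + n + 1)); last by rewrite /S (minn_idPr _) // addn1 ltnS.
set m0 := upd m 14 _ _.
have fr0 a j : a != 14 -> m0 a j = m a j by move=> h; rewrite /m0 upd_other.
have mem m' e : (e \in matrix_set n m' 14) = (m' 14 (pos e) != 0) by rewrite inE.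
apply: (@run_for1 10 lenE _ m0 (n + n + 1) (fun i m' => matrix_set n m' 14 = S i)); try stable; rewrite //.
- by rewrite /= fr0 // mn.
- apply/setP=> -[a b]; rewrite /S min0n /= set_nil setU0 in_setD1 !mem.
  rewrite /m0 /upd /= mt ms mr ?(ltnW (ltn_ord _)) // /pos /= cell_inj xpair_eqE.
  by case: (_ && _).
move=> i m' lti fr xi H1.
have gt : (z + k + 1 - i != 0) = (i < (z + k).+1) by rewrite addn1 subn_eq0 -ltnNge.
case: (mL i lti) => hT hH.
rewrite /= xi !(fr 23) // !(fr 24) // !fr0 // mz mk gt.
have e18 : m' 18 i = nth t LT i by rewrite fr // fr0.
have e19 : m' 19 i = nth s LH i by rewrite fr // fr0.
have e3 (a : 'I_n) : m' 3 a = a * n by rewrite fr // fr0 // mr // ltnW.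
case: ltnP => lt; last first.
  by rewrite H1 /S (minn_idPr lt) (minn_idPr (leqW lt)).
have -> : S i.+1 = f i |: S i.
  have mkS : mkseq f i.+1 = rcons (mkseq f i) (f i).
    by rewrite /mkseq -[in LHS](addn1 i) iotaD map_cat cats1.
  rewrite /S (minn_idPl lt) (minn_idPl (ltnW lt)) setUCA mkS; congr (_ :|: _).
  by apply/setP=> e; rewrite in_setU1 !inE mem_rcons in_cons.
apply/setP=> -[a b]; rewrite mem /= e18 e19 e3 /upd /= /pos /= cell_inj in_setU1 -H1 mem /pos /=.
by rewrite /f xpair_eqE; case: (_ && _).
Qed.

Lemma count_spec m : input_ok B E m -> rows_ok n m -> let N := matrix_set n m 14 in
  (forall u v, m 15 (u * n + v) = conn (E :|: N) u v) ->
  let m' := run count_cmd m in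
  [/\ m' 27 0 = #|N|, (m' 28 0 == 0) = (N \subset ~: E) & m' 29 0 = reach_count (E :|: N)].
Proof.
move=> [mn mB mA] mr N m15 m'; rewrite /m' /count_cmd !run_seq !run_put {m'}.
set m0 := upd (upd (upd m _ _ _) _ _ _) _ _ _.
have fr0 a j : a \notin [:: 27; 28; 29] -> m0 a j = m a j.
  by rewrite !inE !negb_or => /and3P[h1 h2 h3]; rewrite /m0 !upd_other.
pose X := reach_set (E :|: N).
pose I p m' := [/\ m' 27 0 = cnt N p, m' 28 0 = cnt (N :&: E) p & m' 29 0 = cnt X p].
have -> : (N \subset ~: E) = (#|N :&: E| == 0).
  by rewrite cards_eq0 setI_eq0 disjoints_subset.
rewrite reach_countE -/X -!(cnt_max _).
suff [-> -> ->] : I (n * n) (run (CFor 10 nE (CFor 11 nE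
    (CSeq (CIf (Cell 14 (Var 10) (Var 11))
      (CSeq (CPut 27 (ECst 0) (EAdd (Var 27) (ECst 1)))
            (CPut 28 (ECst 0) (EAdd (Var 28) (Cell 1 (Var 10) (Var 11))))) CSkip)
     (CPut 29 (ECst 0) (EAdd (Var 29) (Cell 15 (Var 10) (Var 11))))))) m0) by [].
apply: (@run_for2 n 10 11 nE _ m0 I); try stable; rewrite //.
- by move=> m' fr; rewrite /= fr // fr0.
- by rewrite /I !cnt0.
move=> u v m1 fr1 x1 y1 [h1 h2 h3].
have m13 : m1 3 u = u * n by rewrite fr1 // fr0 // mr // ltnW.
have m11 : m1 1 (u * n + v) = ((u, v) \in E) by rewrite fr1 // fr0.
have m14 : (m1 14 (u * n + v) != 0) = ((u, v) \in N) by rewrite fr1 // fr0 // inE.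
have m15' : m1 15 (u * n + v) = ((u, v) \in X) by rewrite fr1 // fr0 // m15 inE.
rewrite /I !cnt_step in_setI -h1 -h2 -h3 /= x1 y1 m13 m14.
case: ((u, v) \in N); rewrite /upd /= ?x1 ?y1 ?m13 ?m11 ?m15' //=.
by rewrite !addn0.
Qed.

Lemma copy_spec m : m 0 0 = n -> rows_ok n m ->
  matrix_set n (run copy_cmd m) 2 = matrix_set n m 14.
Proof.
move=> mn mr; pose I p m' := forall e, pos e < p -> m' 2 (pos e) = m 14 (pos e).
suff h : I (n * n) (run copy_cmd m).
  by apply/setP=> -[a b]; rewrite !inE h // /pos pos_max.
apply: (@run_for2 n 10 11 nE _ m I); try stable; rewrite //.
  by move=> m' fr; rewrite /= fr.
move=> u v m1 fr1 x1 y1 H1 [a b]; rewrite /pos pos_lt /= x1 y1 (fr1 3) // mr ?(ltnW (ltn_ord _)) //.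
rewrite (fr1 14) // /upd /= cell_inj.
case: (boolP ((a == u) && (b == v))) => [/andP[/eqP -> /eqP ->] //|_].
by rewrite orbF => /(H1 (a, b)).
Qed.

(* [keep_cmd] maintains that array 2 holds a feasible set at least as good as
   the number in array 30. *)
Definition best_ok m : Prop := let N := matrix_set n m 2 in
  mci_feasible E B N /\ m 30 0 <= reach_count (E :|: N).

Lemma keep_spec m : input_ok B E m -> rows_ok n m -> best_ok m ->
  let N := matrix_set n m 14 in
  m 27 0 = #|N| -> (m 28 0 == 0) = (N \subset ~: E) -> m 29 0 = reach_count (E :|: N) ->
  let m' := run keep_cmd m in
  [/\ best_ok m', m 30 0 <= m' 30 0 &
      mci_feasible E B N -> reach_count (E :|: N) <= m' 30 0].
Proof.
move=> [mn mB mA] mr bo N m27 m28 m29.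
move=> m'; rewrite /m' /keep_cmd !run_if !run_seq run_put {m'}.
have -> : (eval m (EAdd (Var 28) (ESub (Var 27) (EGet 0 (ECst 1)))) != 0) = ~~ mci_feasible E B N.
  by rewrite /= addn_eq0 m28 m27 mB subn_eq0.
case: (boolP (mci_feasible E B N)) => [fN|_]; last by split.
have -> : (eval m (ESub (Var 29) (Var 30)) != 0) = (m 30 0 < m 29 0).
  by rewrite /= subn_eq0 -ltnNge.
rewrite [~~ true]/=; case: ltnP => le; last by split=> // _; rewrite -m29.
rewrite -[upd m _ _ _]/(upd m 30 0 (m 29 0)).
set m0 := upd m 30 0 (m 29 0).
have c2 : matrix_set n (run copy_cmd m0) 2 = N by rewrite copy_spec.
have c30 : run copy_cmd m0 30 0 = reach_count (E :|: N) by rewrite run_frame // -m29.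
by split; rewrite /best_ok ?c2 ?c30 //= -m29 ltnW.
Qed.

End Pieces2.

(** Exhaustive search without following the failing rounds: success in the round with the right
    guess [G] is enough, as no round undoes it. *)
Definition searches (Inv Done : memory -> Prop) c (G : memory -> Prop) : Prop :=
  forall m, Inv m -> [/\ Inv (run c m), Done m -> Done (run c m) & G m -> Done (run c m)].

Lemma searches_for Inv Done x b c (G G' : memory -> Prop) i0 : x \notin writes c ->
  (forall m k, Inv m -> Inv (upd m x 0 k)) -> (forall m k, Done m -> Done (upd m x 0 k)) ->
  searches Inv Done c G -> (forall m, Inv m -> i0 < eval m b) ->
  (forall m m', G' m -> (forall a j, a \notin x :: writes c -> m' a j = m a j) ->
     m' x 0 = i0 -> G m') ->
  searches Inv Done (CFor x b c) G'.
Proof.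
move=> xc stI stD sc lt GG m Im; split.
- apply: (@run_for1 x b c m (eval m b) (fun _ => Inv)) => //.
  by move=> i m' _ _ _ /sc[].
- move=> Dm; suff [] : Inv (run (CFor x b c) m) /\ Done (run (CFor x b c) m) by [].
  apply: (@run_for1 x b c m (eval m b) (fun _ m' => Inv m' /\ Done m')) => //.
    by move=> i m' k [h1 h2]; split; [apply: stI | apply: stD].
  by move=> i m' _ _ _ [/sc[h1 h2 _] /h2].
move=> Gm.
suff [_ h] : Inv (run (CFor x b c) m) /\ (i0 < eval m b -> Done (run (CFor x b c) m)).
  by apply: h; apply: lt.
apply: (@run_for1 x b c m (eval m b) (fun i m' => Inv m' /\ (i0 < i -> Done m'))) => //.
  by move=> i m' k [h1 h2]; split; [apply: stI | move=> /h2; apply: stD].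
move=> i m' _ fr xi [/sc[h1 h2 h3] h4]; split=> //.
rewrite ltnS leq_eqVlt => /orP[/eqP e|/h4 //].
by apply: h3; apply: (GG m) => //; rewrite xi.
Qed.

(** * The search *)

Definition body_cmd : cmd :=
  CSeq decode_cmd (CSeq closure_cmd (CSeq degree_cmd (CSeq list_cmd
  (CSeq build_cmd (CSeq closure_cmd (CSeq count_cmd keep_cmd)))))).

Definition main_cmd : cmd :=
  CFor 20 (Var 9) (CFor 21 nE (CFor 22 nE
    (CFor 23 (EAdd nE (ECst 1)) (CFor 24 (EAdd nE (ECst 1)) body_cmd)))).

Definition setup_cmd : cmd := CSeq row_cmd (CSeq diff_cmd (CSeq rank_cmd first_cmd)).

Definition mci_cmd : cmd :=
  CSeq setup_cmd (CSeq threshold_cmd (CSeq rep_cmd main_cmd)).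

(* Keeps unification from executing the programs. *)
Local Opaque run.

Section Main.
Variables (n B R : nat) (E : {set 'I_n * 'I_n}).
Implicit Types (u v t s : 'I_n) (m : memory) (X N : {set 'I_n * 'I_n}).
Local Notation X := (rep_pairs E R).

Lemma matrix_frame m m' a : (forall j, m' a j = m a j) -> matrix_set n m' a = matrix_set n m a.
Proof. by move=> h; apply/setP=> e; rewrite !inE h. Qed.

Definition base m : Prop :=
  [/\ input_ok B E m, rows_ok n m, forall e, m 8 (pos e) = (e \in X) & m 9 0 = 2 ^ #|X|].

Lemma base_frame m m' : (forall a j, a \in [:: 0; 1; 3; 8; 9] -> m' a j = m a j) ->
  base m -> base m'.
Proof.
move=> fr [[h1 h2 h3] h4 h5 h6]; split.
- by split=> [||u v]; rewrite fr.
- by move=> k kn; rewrite fr // h4.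
- by move=> e; rewrite fr.
- by rewrite fr.
Qed.

Lemma run_base c m : all (fun a => a \notin writes c) [:: 0; 1; 3; 8; 9] ->
  base m -> base (run c m).
Proof. by move=> /allP h; apply: base_frame => a j /h; apply: run_frame. Qed.

Lemma best_frame m m' : (forall a j, a \in [:: 2; 30] -> m' a j = m a j) ->
  best_ok B E m -> best_ok B E m'.
Proof.
move=> fr; rewrite /best_ok (matrix_frame (m := m)) => [|j]; last by rewrite fr.
by rewrite fr.
Qed.

Lemma run_best c m : all (fun a => a \notin writes c) [:: 2; 30] ->
  best_ok B E m -> best_ok B E (run c m).
Proof. by move=> /allP h; apply: best_frame => a j /h; apply: run_frame. Qed.

Definition guess c t s z k m : Prop :=
  [/\ m 20 0 = c, m 21 0 = nat_of_ord t, m 22 0 = nat_of_ord s, m 23 0 = z & m 24 0 = k].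

Lemma body_spec m : base m -> best_ok B E m ->
  [/\ base (run body_cmd m), best_ok B E (run body_cmd m), m 30 0 <= run body_cmd m 30 0 &
   forall c t s z k, guess c t s z k m -> z + k <= n + n ->
     let N := candidate E (decoded X c) t s z k in
     mci_feasible E B N -> reach_count (E :|: N) <= run body_cmd m 30 0].
Proof.
move=> bm om; rewrite /body_cmd 7!run_seq.
(* Each intermediate memory becomes a variable, so that no term nests the runs of several
   programs. *)
have [m1 E1] : {m' | m' = run decode_cmd m} by exists (run decode_cmd m).
rewrite -E1.
have f1 a j : a \notin writes decode_cmd -> m1 a j = m a j.
  by rewrite E1; exact: run_frame.
have b1 : base m1 by rewrite E1; exact: (run_base _ bm).
have o1 : best_ok B E m1 by rewrite E1; exact: (run_best _ om).
have [m2 E2] : {m' | m' = run closure_cmd m1} by exists (run closure_cmd m1).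
rewrite -E2.
have f2 a j : a \notin writes closure_cmd -> m2 a j = m1 a j.
  by rewrite E2; exact: run_frame.
have b2 : base m2 by rewrite E2; exact: (run_base _ b1).
have o2 : best_ok B E m2 by rewrite E2; exact: (run_best _ o1).
have [m3 E3] : {m' | m' = run degree_cmd m2} by exists (run degree_cmd m2).
rewrite -E3.
have f3 a j : a \notin writes degree_cmd -> m3 a j = m2 a j.
  by rewrite E3; exact: run_frame.
have b3 : base m3 by rewrite E3; exact: (run_base _ b2).
have o3 : best_ok B E m3 by rewrite E3; exact: (run_best _ o2).
have [m4 E4] : {m' | m' = run list_cmd m3} by exists (run list_cmd m3).
rewrite -E4.
have f4 a j : a \notin writes list_cmd -> m4 a j = m3 a j.
  by rewrite E4; exact: run_frame.
have b4 : base m4 by rewrite E4; exact: (run_base _ b3).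
have o4 : best_ok B E m4 by rewrite E4; exact: (run_best _ o3).
have [m5 E5] : {m' | m' = run build_cmd m4} by exists (run build_cmd m4).
rewrite -E5.
have f5 a j : a \notin writes build_cmd -> m5 a j = m4 a j.
  by rewrite E5; exact: run_frame.
have b5 : base m5 by rewrite E5; exact: (run_base _ b4).
have o5 : best_ok B E m5 by rewrite E5; exact: (run_best _ o4).
have [m6 E6] : {m' | m' = run closure_cmd m5} by exists (run closure_cmd m5).
rewrite -E6.
have f6 a j : a \notin writes closure_cmd -> m6 a j = m5 a j.
  by rewrite E6; exact: run_frame.
have b6 : base m6 by rewrite E6; exact: (run_base _ b5).
have o6 : best_ok B E m6 by rewrite E6; exact: (run_best _ o5).
have [m7 E7] : {m' | m' = run count_cmd m6} by exists (run count_cmd m6).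
rewrite -E7.
have f7 a j : a \notin writes count_cmd -> m7 a j = m6 a j.
  by rewrite E7; exact: run_frame.
have b7 : base m7 by rewrite E7; exact: (run_base _ b6).
have o7 : best_ok B E m7 by rewrite E7; exact: (run_best _ o6).
have [m8 E8] : {m' | m' = run keep_cmd m7} by exists (run keep_cmd m7).
rewrite -E8; have b8 : base m8 by rewrite E8; exact: (run_base _ b7).
have e30 : m7 30 0 = m 30 0 by rewrite f7 // f6 // f5 // f4 // f3 // f2 // f1.
have e6 : matrix_set n m6 14 = matrix_set n m5 14.
  by apply: matrix_frame => j; rewrite f6.
have e7 : matrix_set n m7 14 = matrix_set n m5 14.
  by rewrite -e6; apply: matrix_frame => j; rewrite f7.
case: (bm) => i0 r0 h8 _; case: (b1) => i1 r1 _ _; case: (b2) => i2 r2 _ _.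
case: (b3) => i3 r3 _ _; case: (b4) => i4 r4 _ _.
case: (b5) => i5 r5 _ _; case: (b6) => i6 r6 _ _; case: (b7) => i7 r7 _ _.
have c6 : forall u v, m6 15 (u * n + v) = conn (E :|: matrix_set n m6 14) u v.
  by move=> u v; rewrite e6 E6 (closure_spec i5 r5).
have [k27 k28 k29] : [/\ m7 27 0 = #|matrix_set n m7 14|,
    (m7 28 0 == 0) = (matrix_set n m7 14 \subset ~: E) &
    m7 29 0 = reach_count (E :|: matrix_set n m7 14)].
  by rewrite e7 -e6 E7; exact: (count_spec i6 r6 c6).
have := keep_spec i7 r7 o7 k27 k28 k29; rewrite /= -E8 => -[g1 g2 g3].
split; [exact: b8 | exact: g1 | by rewrite -e30 |].
move=> c t s z k [gc gt gs gz gk] zk fN; set N := candidate _ _ _ _ _ _ in fN *.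
suff NE : matrix_set n m7 14 = N by rewrite -NE; apply: g3; rewrite NE.
rewrite e7.
have [mn _ _] := i0.
have D1 : matrix_set n m1 14 = decoded X c by rewrite E1; exact: (decode_spec mn r0 gc h8).
pose F := E :|: decoded X c.
have D2 : matrix_set n m2 14 = decoded X c.
  by rewrite -D1; apply: matrix_frame => j; rewrite f2.
have c3 u v : m3 15 (u * n + v) = conn F u v.
  by rewrite f3 // E2 (closure_spec i1 r1) D1.
have d3 u : (m3 16 u == 0) = sink F u /\ (m3 17 u == 0) = source F u.
  by rewrite /F -D2 E3; exact: (degree_spec i2 r2).
have D4 : matrix_set n m4 14 = decoded X c.
  by rewrite -D2; apply: matrix_frame => j; rewrite f4 // f3.
have [mn3 _ _] := i3; have [mn4 _ _] := i4.
have g21 : m3 21 0 = t by rewrite f3 // f2 // f1.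
have g22 : m3 22 0 = s by rewrite f3 // f2 // f1.
have g23 : m3 23 0 = z by rewrite f3 // f2 // f1.
have L : forall j, j < n + n + 1 -> m4 18 j = nth t (cand_tails E (decoded X c) t z) j /\
    m4 19 j = nth s (cand_heads E (decoded X c) t s z) j.
  by rewrite E4; exact: (list_spec mn3 r3 g21 g22 g23 c3 d3).
have l21 : m4 21 0 = t by rewrite f4.
have l22 : m4 22 0 = s by rewrite f4.
have l23 : m4 23 0 = z by rewrite f4.
have l24 : m4 24 0 = k by rewrite f4 // f3 // f2 // f1.
by rewrite E5 (build_spec mn4 r4 l21 l22 l23 l24 zk L) D4.
Qed.

Lemma main_spec m c t s z k w : base m -> best_ok B E m -> c < 2 ^ #|X| -> z <= n -> k <= n ->
  let N := candidate E (decoded X c) t s z k in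
  mci_feasible E B N -> w <= reach_count (E :|: N) ->
  best_ok B E (run main_cmd m) /\ w <= run main_cmd m 30 0.
Proof.
move=> bm om cX zn kn N fN wN.
pose Inv m' := base m' /\ best_ok B E m'; pose Done m' := w <= m' 30 0.
have zk : z + k <= n + n by apply: leq_add.
have sbody : searches Inv Done body_cmd (guess c t s z k).
  move=> m1 [b1 o1]; case: (body_spec b1 o1) => h1 h2 h3 h4; split=> //.
    by move=> h; apply: leq_trans h h3.
  by move=> gu; apply: leq_trans wN _; apply: h4 gu _ _.
have stI x m1 l : x \in [:: 20; 21; 22; 23; 24] -> Inv m1 -> Inv (upd m1 x 0 l).
  move=> hx [h1 h2]; split.
    apply: base_frame h1 => a j ha; apply: upd_other; apply: contraTneq ha => ->.
    by move: hx; rewrite !inE => /or4P[|||/orP[]] /eqP ->.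
  apply: best_frame h2 => a j ha; apply: upd_other; apply: contraTneq ha => ->.
  by move: hx; rewrite !inE => /or4P[|||/orP[]] /eqP ->.
have stD x m1 l : x \in [:: 20; 21; 22; 23; 24] -> Done m1 -> Done (upd m1 x 0 l).
  move=> hx; rewrite /Done upd_other //.
  by move: hx; rewrite !inE => /or4P[|||/orP[]] /eqP ->.
have nI m1 : Inv m1 -> m1 0 0 = n by case=> -[[]].
suff /(_ m (conj bm om))[[_ h1] _ /(_ I) h2] : searches Inv Done main_cmd (fun _ => True) by [].
have I' y m1 l : y \in [:: 20; 21; 22; 23; 24] -> Inv m1 -> Inv (upd m1 y 0 l).
  exact: stI.
pose G1 m' := m' 20 0 = c; pose G2 m' := G1 m' /\ m' 21 0 = t.
pose G3 m' := G2 m' /\ m' 22 0 = s; pose G4 m' := G3 m' /\ m' 23 0 = z.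
apply: (@searches_for Inv Done 20 (Var 9) _ G1 _ c).
- by [].
(* Neither [Inv] nor [Done] depends on the five loop counters. *)
- by move=> m1 l; apply: (I' 20).
- by move=> m1 l; apply: (stD 20).
- apply: (@searches_for Inv Done 21 nE _ G2 _ t).
  + by [].
  + by move=> m1 l; apply: (I' 21).
  + by move=> m1 l; apply: (stD 21).
  + apply: (@searches_for Inv Done 22 nE _ G3 _ s).
    * by [].
    * by move=> m1 l; apply: (I' 22).
    * by move=> m1 l; apply: (stD 22).
    * apply: (@searches_for Inv Done 23 (EAdd nE (ECst 1)) _ G4 _ z).
      -- by [].
      -- by move=> m1 l; apply: (I' 23).
      -- by move=> m1 l; apply: (stD 23).
      -- apply: (@searches_for Inv Done 24 (EAdd nE (ECst 1)) body_cmd _ G4 k _ _ _ sbody).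
         ++ by [].
         ++ by move=> m1 l; apply: (I' 24).
         ++ by move=> m1 l; apply: (stD 24).
         ++ by move=> m1 /nI h; rewrite /= h addn1 ltnS.
         by move=> m1 m2 [[[h1 h2] h3] h4] fr x2; split; rewrite ?(fr 20) ?(fr 21) ?(fr 22) ?(fr 23).
      -- by move=> m1 /nI h; rewrite /= h addn1 ltnS.
      by move=> m1 m2 [[h1 h2] h3] fr x2; rewrite /G4 /G3 /G2 /G1 (fr 20) ?(fr 21) ?(fr 22).
    * by move=> m1 /nI h; rewrite /= h.
    by move=> m1 m2 [h1 h2] fr x2; rewrite /G3 /G2 /G1 (fr 20) ?(fr 21).
  + by move=> m1 /nI h; rewrite /= h.
  by move=> m1 m2 h1 fr x2; rewrite /G2 /G1 (fr 20).
- by move=> m1 [[_ _ _ h] _]; rewrite /= h.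
by move=> m1 m2 _ fr x2.
Qed.

Lemma main_best m : base m -> best_ok B E m -> best_ok B E (run main_cmd m).
Proof.
move=> bm om; pose Inv m' := base m' /\ best_ok B E m'.
have stI x m1 l : x \in [:: 20; 21; 22; 23; 24] -> Inv m1 -> Inv (upd m1 x 0 l).
  move=> hx [h1 h2]; split.
    apply: base_frame h1 => a j ha; apply: upd_other; apply: contraTneq ha => ->.
    by move: hx; rewrite !inE => /or4P[|||/orP[]] /eqP ->.
  apply: best_frame h2 => a j ha; apply: upd_other; apply: contraTneq ha => ->.
  by move: hx; rewrite !inE => /or4P[|||/orP[]] /eqP ->.
suff [] : Inv (run main_cmd m) by [].
have step x b c : x \in [:: 20; 21; 22; 23; 24] -> x \notin writes c ->
    (forall m', Inv m' -> Inv (run c m')) -> forall m', Inv m' -> Inv (run (CFor x b c) m').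
  move=> hx xc h m' Im; apply: (@run_for1 x b c m' (eval m' b) (fun _ => Inv)) => //.
    by move=> *; apply: stI.
  by move=> *; apply: h.
do 5!(apply: (step) => //).
by move=> m' [h1 h2]; case: (body_spec h1 h2).
Qed.

End Main.

(** * Computability of the parameter function, correctness and running time *)

Lemma ltn_2expn k : k < 2 ^ k.
Proof. exact: ltn_expl. Qed.

Lemma tower_computable C : computable (fun k => 2 ^ (2 ^ (24 * k + C))).
Proof.
pose c1 := CPut 2 (ECst 0) (iter 24 (EAdd (Var 0)) (ECst C)).
pose pow x y e := CSeq (CPut x (ECst 0) (ECst 1)) (CFor y e (CPut x (ECst 0) (EAdd (Var x) (Var x)))).
pose c2 := pow 1 3 (Var 2); pose c3 := CSeq (pow 4 5 (Var 1)) (CPut 0 (ECst 0) (Var 4)).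
(* Three pieces, because each loop bound is written by the piece before; powers are computed by
   repeated doubling. *)
exists (Seq (compile c1) (Seq (compile c2) (compile c3))) => k.
set m0 := nat_input k; pose m1 := run c1 m0; pose m2 := run c2 m1.
have ex c m K : well_formed c -> (forall b, b \in map (eval m) (bounds c) -> b <= K) ->
    exists t, exec (compile c) m t (run c m).
  by move=> h1 h2; case: (exec_run h1 h2) => t; exists t.
have [t1 e1] : exists t, exec (compile c1) m0 t m1 by apply: (ex c1 m0 0).
have [t2 e2] : exists t, exec (compile c2) m1 t m2.
  by apply: (ex c2 m1 (m1 2 0)) => // b; rewrite /= inE => /eqP ->.
have [t3 e3] : exists t, exec (compile c3) m2 t (run c3 m2).
  by apply: (ex c3 m2 (m2 1 0)) => // b; rewrite /= inE => /eqP ->.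
exists (t1 + (t2 + t3)), (run c3 m2); split.
  by apply: ExecSeq e1 _; apply: ExecSeq e2 e3.
have powE x y a m : x != y -> y != a -> x != a -> run (pow x y (Var a)) m x 0 = 2 ^ m a 0.
  move=> xy ya xa; rewrite run_seq run_put; set m' := upd m x _ _.
  have <- : m' a 0 = m a 0 by rewrite /m' upd_other // eq_sym.
  apply: (@run_for1 y _ _ m' (m' a 0) (fun i m => m x 0 = 2 ^ i)) => //.
  - by rewrite inE eq_sym.
  - by move=> i m3 l h; rewrite upd_other.
  - by rewrite /m' /upd !eqxx.
  by move=> i m3 _ _ _ h; rewrite run_put /upd !eqxx /= h expnS mul2n addnn.
have evalE j m : eval m (iter j (EAdd (Var 0)) (ECst C)) = j * m 0 0 + C.
  by elim: j => //= j ->; rewrite mulSn addnA.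
have e2' : m1 2 0 = 24 * k + C by rewrite /m1 /c1 run_put evalE.
by rewrite run_seq run_put /upd /= powE // /m2 powE // e2'.
Qed.

Section Assembly.
Variable x : mci_instance.
Local Notation n := (nvertices x).
Local Notation E := (edges x).
Local Notation q := (nfirst E).
Local Notation R := (rep_bound q).
Local Notation m0 := (mci_input x).
Local Notation mA := (run setup_cmd m0).
Local Notation mB := (run threshold_cmd mA).
Local Notation mC := (run rep_cmd mB).

Lemma input_mci_input : input_ok (budget x) E m0.
Proof.
split=> // u v; rewrite /m0 /=; congr nat_of_bool; apply/existsP/idP => [[[a b]]|uvE].
  by rewrite /= cell_inj => /andP[abE /andP[/eqP -> /eqP ->]].
by exists (u, v); rewrite uvE eqxx.
Qed.

Lemma setup_spec : [/\ input_ok (budget x) E mA, rows_ok n mA,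
  forall u : 'I_n, mA 5 u = trank E u & mA 6 0 = q].
Proof.
have i0 := input_mci_input; have [mn mB mA'] := i0.
rewrite /setup_cmd !run_seq.
set m1 := run row_cmd m0; have r1 : rows_ok n m1 by apply: row_spec.
have i1 : input_ok (budget x) E m1 by split=> [||u v]; rewrite /m1 run_frame.
set m2 := run diff_cmd m1.
have d2 : forall u v : 'I_n, (m2 4 (u * n + v) == 0) = twin E u v.
  by apply: (diff_spec i1 r1) => u v; rewrite /m1 run_frame.
have r2 : rows_ok n m2 by move=> k kn; rewrite /m2 run_frame // r1.
have n2 : m2 0 0 = n by rewrite /m2 /m1 !run_frame.
set m3 := run rank_cmd m2.
have k3 : forall u : 'I_n, m3 5 u = trank E u.
  by apply: rank_spec => // u; rewrite /m2 /m1 !run_frame.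
have n3 : m3 0 0 = n by rewrite /m3 run_frame.
split.
- by split=> [||u v]; rewrite /m3 /m2 !run_frame //; case: i1.
- by move=> k kn; rewrite /m3 run_frame // run_frame // r2.
- by move=> u; rewrite run_frame.
by apply: first_spec => //; rewrite /m3 /m2 /m1 !run_frame.
Qed.

Lemma rep_base : base (budget x) R E mC.
Proof.
have [[i1 i2 i3] r k h6] := setup_spec.
have h7 : mB 7 0 + 11 = R by apply: threshold_spec => //; rewrite !run_frame.
have nB : mB 0 0 = n by rewrite run_frame.
have rB : rows_ok n mB by move=> l ln; rewrite run_frame // r.
have kB : forall u : 'I_n, mB 5 u = trank E u by move=> u; rewrite run_frame // k.
have zB : forall u v : 'I_n, mB 8 (u * n + v) = 0 by move=> u v; rewrite !run_frame.
have [h8 h9] := rep_spec nB rB kB h7 zB.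
split=> //; first by split=> [||u v]; rewrite run_frame // run_frame.
by move=> l ln; rewrite run_frame // rB.
Qed.

Lemma rep_best : best_ok (budget x) E mC.
Proof.
have e2 j : mC 2 j = 0 by rewrite !run_frame.
have e30 : mC 30 0 = 0 by rewrite !run_frame.
rewrite /best_ok e30; split=> //.
have -> : matrix_set n mC 2 = set0 by apply/setP=> e; rewrite !inE e2.
by rewrite /mci_feasible sub0set cards0.
Qed.

Lemma mci_cmd_correct : mci_solved x (run mci_cmd m0).
Proof.
rewrite /mci_cmd !run_seq; set mD := run main_cmd mC.
have dE := acyclic_dag (@edges_acyclic x).
have oN : mci_output x mD = matrix_set n mD 2 by apply/setP=> e; rewrite !inE.
rewrite /mci_solved oN.
have bo := main_best rep_base rep_best; rewrite -/mD in bo.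
have [fN bN] := bo.
have qE : ntwins E <= q by rewrite ntwins_nfirst.
have [N0 N0R [w pl wmax]] := solution_plan_exists (budget x) dE qE.
suff wle : w <= reach_count (E :|: matrix_set n mD 2).
  by split=> // N' /wmax h; apply: leq_trans h wle.
have N0X : N0 \subset rep_pairs E R.
  apply/subsetP=> -[a b] abN; rewrite inE /= !N0R //; apply/touchedP.
    by exists a; rewrite abN orbT.
  by exists b; rewrite abN.
have [c cX cP] := decoded_exists N0X.
have cardn (A : {set 'I_n}) : #|A| <= n by rewrite -[X in _ <= X]card_ord max_card.
case: pl => [[t0 [s0 [z [t [s h]]]]]|[Ns NB wN]].
  have [h1 h2 h3] := core_plan_candidate h.
  have [_ _ _ [zl tl sl] _] := h.
  have zn : z <= n := leq_trans zl (cardn _).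
  have mn : maxn t s <= n by rewrite geq_max (leq_trans tl (cardn _)) (leq_trans sl (cardn _)).
  rewrite -cP in h1 h2 h3.
  have fN' : mci_feasible E (budget x) (candidate E (decoded (rep_pairs E R) c) t0 s0 z (maxn t s)).
    by rewrite /mci_feasible h1 h2.
  have [_ h4] := main_spec rep_base rep_best cX zn mn fN' h3.
  exact: leq_trans h4 bN.
(* An empty [N0] has no edge [(t0, s0)] to guess, but then [w] is at most the count for [E] alone,
   which every output attains. *)
case: (set_0Vmem N0) => [N00|[[t0 s0] tsN]].
  apply: leq_trans wN _; rewrite N00 setU0; apply: reach_count_le; apply: connS.
  exact: subsetUl.
have h3 : w <= reach_count (E :|: candidate E (decoded (rep_pairs E R) c) t0 s0 0 0).
  by rewrite cP candidate0.
have fN' : mci_feasible E (budget x) (candidate E (decoded (rep_pairs E R) c) t0 s0 0 0).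
  by rewrite cP candidate0 // /mci_feasible ss_feasible.
have [_ h4] := main_spec rep_base rep_best cX (leq0n n) (leq0n n) fN' h3.
exact: leq_trans h4 bN.
Qed.

Lemma rep_pairs_card : #|rep_pairs E R| <= (q * R) ^ 2.
Proof.
have -> : rep_pairs E R = setX [set v | trank E v < R] [set v | trank E v < R].
  by apply/setP=> e; rewrite !inE.
by rewrite cardsX -mulnn leq_mul // card_reps.
Qed.

Lemma mci_cmd_time : exists2 t, exec (compile mci_cmd) m0 t (run mci_cmd m0) &
  t <= weight mci_cmd * (n.+1 * (3 * 2 ^ ((q * R) ^ 2))) ^ depth mci_cmd.
Proof.
set P := 2 ^ _; set K := n.+1 * _.
have P0 : 0 < P by rewrite expn_gt0.
have K0 : 0 < K by rewrite !muln_gt0 P0.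
have nK : n + n + 1 <= K.
  apply: leq_trans (_ : n.+1 * 3 <= _); first by lia.
  by rewrite leq_mul2l /= leq_pmulr.
have n1K : n + 1 <= K by apply: leq_trans nK; lia.
have n0K : n <= K by apply: leq_trans n1K; lia.
have PK : P <= K.
  by apply: leq_trans (_ : 3 * P <= _); [apply: leq_pmull | apply: leq_pmull].
have [[i1 i2 i3] r k h6] := setup_spec.
have [[j1 j2 j3] rj _ h9] := rep_base.
have qK : q + 1 <= K.
  apply: leq_trans PK; rewrite addn1; apply: leq_trans (ltn_2expn q) _.
  rewrite leq_exp2l // expnMn; apply: leq_trans (_ : q ^ 2 <= _).
    by rewrite -mulnn; case: (q) => // l; rewrite leq_pmulr.
  by rewrite leq_pmulr // expn_gt0 /rep_bound addn1.
have qK' : q <= K by apply: leq_trans qK; rewrite addn1.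
have wK : 2 ^ #|rep_pairs E R| <= K.
  by apply: leq_trans PK; rewrite leq_exp2l // rep_pairs_card.
(* The pieces are timed separately: array 6 bounds loops of the second and is written by the first,
   and array 9 likewise links the third to the fourth. *)
have [tA eA lA] : exists2 t, exec (compile setup_cmd) m0 t mA & t <= time_bound K setup_cmd.
  by apply: exec_run => // b; rewrite /= !inE; case: eqP => [-> //|_]; do ?case: eqP => [-> //|_].
have [tB eB lB] : exists2 t, exec (compile threshold_cmd) mA t mB & t <= time_bound K threshold_cmd.
  apply: exec_run => // b; rewrite [map _ _]/= !inE -/mA h6.
  by case/orP=> /eqP ->.
have nB : mB 0 0 = n by rewrite run_frame.
have [tC eC lC] : exists2 t, exec (compile rep_cmd) mB t mC & t <= time_bound K rep_cmd.
  apply: exec_run => // b; rewrite [map _ _]/= !inE nB.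
  by case/orP=> /eqP ->.
have [tD eD lD] : exists2 t, exec (compile main_cmd) mC t (run main_cmd mC) & t <= time_bound K main_cmd.
  apply: exec_run => // b.
  have bs : {subset map (eval mC) (bounds main_cmd) <=
      [:: 2 ^ #|rep_pairs E R|; n; n + 1; n + n + 1]}.
    rewrite -h9 -j1; apply/allP; rewrite [bounds _]/= [map _ _]/= [all _ _]/=.
    by rewrite !inE !eqxx ?orbT.
  move/bs; rewrite !inE => /or4P[] /eqP -> //.
rewrite {1}/mci_cmd !run_seq; exists (tA + (tB + (tC + tD))).
  by apply: ExecSeq eA _; apply: ExecSeq eB _; apply: ExecSeq eC eD.
apply: leq_trans (time_boundP _ K0); rewrite [time_bound _ _]/=.
by apply: leq_add lA _; apply: leq_add lB _; apply: leq_add lC lD.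
Qed.

End Assembly.

(** With y = 2^(4k + 1), q is at most y and [rep_bound q] at most 16 y^2, so the square of their
    product is at most (16 y^3)^2 = 2^(24k + 14). The factors [W] and [d] are absorbed because W + d
    is below 2^(W + d), and one more doubling covers the factor 3. *)
Lemma tower_bound W d q k : q <= k.*2 + 2 ^ k.*2 * 2 ^ k.*2 ->
  W * (3 * 2 ^ ((q * rep_bound q) ^ 2)) ^ d <= 2 ^ (2 ^ (24 * k + (W + d + 15))).
Proof.
move=> hq; pose y := 2 ^ (4 * k + 1).
have y0 : 0 < y by rewrite expn_gt0.
have qy : q <= y.
  apply: leq_trans hq _; rewrite -expnD /y addn1 expnS mul2n -[in X in _ <= X]addnn.
  have -> : k.*2 + k.*2 = 4 * k by lia.
  rewrite leq_add2r; apply: leq_trans (ltnW (ltn_2expn _)) _.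
  by rewrite leq_exp2l //; lia.
have Ry : rep_bound q <= 2 ^ 4 * y ^ 2.
  rewrite /rep_bound -!mulnn; have : q * q <= y * y by apply: leq_mul.
  have : y <= y * y by rewrite leq_pmulr.
  by move: qy y0; clear; move: (y * y) (q * q) => a b; lia.
have xy : (q * rep_bound q) ^ 2 <= 2 ^ (24 * k + 14).
  apply: leq_trans (_ : (y * (2 ^ 4 * y ^ 2)) ^ 2 <= _).
    by rewrite leq_exp2r // leq_mul.
  rewrite /y -!expnM -!expnD -expnM leq_exp2l //; lia.
apply: leq_trans (_ : 2 ^ W * (2 ^ (2 + 2 ^ (24 * k + 14))) ^ d <= _).
  apply: leq_mul; first by rewrite ltnW ?ltn_2expn.
  case: (d) => // d'; rewrite leq_exp2r // expnD leq_mul // leq_exp2l //.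
rewrite -expnM -expnD leq_exp2l //.
set Y := 2 ^ (24 * k + 14).
have Y2 : 2 <= Y by rewrite -[2]/(2 ^ 1) leq_exp2l // addn_gt0 orbT.
apply: leq_trans (_ : (W + d) * (2 * Y) <= _).
  rewrite [X in _ <= X]mulnDl leq_add //; first by rewrite leq_pmulr // muln_gt0 /= (leq_trans _ Y2).
  by rewrite mulnC leq_mul2l mul2n -addnn leq_add2r Y2 orbT.
rewrite -expnS -addnS.
apply: leq_trans (leq_mul (ltnW (ltn_2expn (W + d))) (leqnn _)) _.
by rewrite -expnD leq_exp2l //; lia.
Qed.

Theorem theorem5 :
  fixed_parameter_tractable mci_input mci_solved nvertices
    (fun x : mci_instance => matching_number (edges x)).
Proof.
pose W := weight mci_cmd; pose d := depth mci_cmd.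
exists (compile mci_cmd), (fun k => 2 ^ (2 ^ (24 * k + (W + d + 15)))), d.
split; first exact: tower_computable.
move=> x; case: (mci_cmd_time x) => t ex le; exists t, (run mci_cmd (mci_input x)).
split=> //; last exact: mci_cmd_correct.
apply: leq_trans le _; rewrite expnMn mulnCA mulnC leq_mul2r; apply/orP; right.
apply: tower_bound; apply: nfirst_matching.
exact: acyclic_dag (@edges_acyclic x).
Qed.
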